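(* Let $(Q,W,C)$ and $(Q',W',C')$ be QPs in $\mathcal W_1$ (reduced QPs with algebraic cuts), and let $k$ be a strict source or a strict sink of $(Q,W,C)$. If $\mathcal P(Q,W,C)\cong\mathcal P(Q',W',C')$ as algebras, then there are algebra isomorphisms $$\mathcal P(Q,W)\cong\mathcal P(Q',W')\quad\text{and}\quad\mathcal P(\mu_k(Q,W))\cong\mathcal P(\mu_k(Q',W')),$$ where the vertex of $Q'$ corresponding to $k$ under the given isomorphism $\mathcal P(Q,W,C)\cong\mathcal P(Q',W',C')$ is again denoted by $k$.
   Context: $K$ is an algebraically closed field. For a quiver $Q$, an arrow or path $a$ goes from $s(a)$ to $e(a)$, and paths are composed from left to right. All quivers $Q$ underlying QPs are finite, connected and not just one vertex. QPs: $\widehat{KQ}=\prod_{i\ge0}KQ_i$, where $KQ_i$ is the span of paths of length $i$; bars denote closure in the radical-adic topology. A QP is $(Q,W)$ with potential $W\in\prod_{i\ge2}KQ_{i,\rm cyc}$, where $KQ_{i,\rm cyc}$ is spanned by cycles of length $i$. The cyclic derivative $\partial_a$ is the continuous linear map with $\partial_a(a_1\cdots a_d)=\sum_{a_i=a}a_{i+1}\cdots a_da_1\cdots a_{i-1}$ on cycles. The Jacobian algebra is $\mathcal P(Q,W)=\widehat{KQ}/\overline{\langle\partial_aW\mid a\in Q_1\rangle}$. Potentials $W,W'$ are cyclically equivalent if $W-W'$ is in the closure of the span of all $a_1\cdots a_d-a_2\cdots a_da_1$ with $a_1\cdots a_d$ a cycle. A QP is reduced if $W\in\prod_{i\ge3}KQ_{i,\rm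 cyc}$, and trivial if $W$ is a linear combination of 2-cycles and $\mathcal P(Q,W)\cong\widehat{KQ_0}$. The direct sum of QPs with the same vertex set has the disjoint union of arrows and the sum of potentials. Two QPs on the same vertex set are right-equivalent if there is an algebra isomorphism of the complete path algebras, identity on $\widehat{KQ_0}$, sending the first potential to one cyclically equivalent to the second. Cuts: $C\subset Q_1$ is a cut if each cycle appearing in $W$ contains exactly one arrow of $C$. The truncated Jacobian algebra is $\mathcal P(Q,W,C)=\mathcal P(Q,W)/\overline{\langle C\rangle}=\widehat{KQ_C}/\overline{\langle\partial_cW\mid c\in C\rangle}$, where $Q_C$ has vertices $Q_0$ and arrows $Q_1\setminus C$. A vertex $k$ is a strict source (resp. strict sink) if all arrows ending (resp. starting) at $k$ belong to $C$ and all arrows starting (resp. ending) at $k$ do not belong to $C$. $C$ is algebraic if (1) $\mathcal P(Q,W,C)$ is finite dimensional of global dimension at most 2, and (2) $\{\partial_cW\}_{c\in C}$ is a minimal set of generators of the ideal $\overline{\langle\partial_cW\mid c\in C\rangle}$ of $\widehat{KQ_C}$ (no $\partial_cW$ lies in the closed ideal generated by the others). $\mathcal W_1$ is the set of reduced QPs with algebraic cuts. Mutation: for a vertex $k$ not on a loop (possibly on a 2-cycle), with $W$ replaced, if necessary, by a cyclically equivalent potential no cycle of which starts at $k$, $\widetilde\mu_k(Q,W)=(Q'',W'')$ where $Q''$ is obtained from $Q$ by replacing each $a:k\to v$ by $a^*:v\to k$, each $b:u\to k$ by $b^*:k\to u$, and adding $[ba]:u\to v$ for each pair $u\xrightarrow{b}k\xrightarrow{a}v$;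 and $W''=[W]+\sum_{e(b)=k=s(a)}[ba]a^*b^*$, with $[W]$ obtained from $W$ by replacing each composition $ba$ through $k$ by $[ba]$. $\mu_k(Q,W)$ is the reduced part of $\widetilde\mu_k(Q,W)$, i.e. the reduced summand in a decomposition, up to right-equivalence, of $\widetilde\mu_k(Q,W)$ as a direct sum of a reduced QP and a trivial QP (unique up to right-equivalence). The algebra isomorphism $\mathcal P(Q,W,C)\cong\mathcal P(Q',W',C')$ of basic algebras induces a bijection between vertices (isomorphism classes of simple modules). *)

(* Defs.v *)
From HB Require Import structures.
From mathcomp Require Import all_boot all_algebra.
From mathcomp Require Import boolp classical_sets functions.

Set Implicit Arguments.
Unset Strict Implicit.
Unset Printing Implicit Defensive.

Import GRing.Theory.
Import Quotient.
Local Open Scope quotient_scope.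
Local Open Scope classical_set_scope.
Local Open Scope ring_scope.

(* An algebra over K is a ring with a central ring morphism from K.  The       *)
(* library's algType excludes the zero ring, whereas a quotient by an          *)
(* arbitrary ideal may be zero.                                                *)
Record kalg (K : pzRingType) := Kalg {
  kalg_ring :> pzRingType ;
  kalg_str : {rmorphism K -> kalg_ring} ;
  kalg_central : forall (k : K) (x : kalg_ring), kalg_str k * x = x * kalg_str k
}.

Section Algebras.
Variable K : pzRingType.

Definition alg_iso (A B : kalg K) (f : {rmorphism A -> B}) : Prop :=
  (forall k : K, f (kalg_str A k) = kalg_str B k) /\ bijective f.

Definition isomorphic (A B : kalg K) : Prop :=
  exists f : {rmorphism A -> B}, alg_iso f.

Definition finite_dim (A : kalg K) : Prop :=
  exists n (v : 'I_n -> A), forall x, exists l : 'I_n -> K,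
    x = \sum_(i < n) kalg_str A (l i) * v i.

End Algebras.

Section Ideals.
Variable A : pzRingType.

Record ideal := Ideal {
  ideal_set :> A -> Prop ;
  ideal0 : ideal_set 0 ;
  idealD : forall x y, ideal_set x -> ideal_set y -> ideal_set (x + y) ;
  idealMl : forall a x, ideal_set x -> ideal_set (a * x) ;
  idealMr : forall a x, ideal_set x -> ideal_set (x * a)
}.

Definition ideal_span (S : set A) : set A :=
  [set x | exists n (u s v : 'I_n -> A),
     (forall i, S (s i)) /\ x = \sum_(i < n) u i * s i * v i].

End Ideals.

Definition lin_span (K : pzRingType) (A : lmodType K) (S : set A) : set A :=
  [set x | exists n (l : 'I_n -> K) (s : 'I_n -> A),
     (forall i, S (s i)) /\ x = \sum_(i < n) l i *: s i].

Section QuotientAlgebra.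
Variables (A : pzRingType) (I : ideal A).

Definition ideal_pred : A -> bool := fun x => `[< I x >].

Lemma ideal_pred_zmod : zmod_closed ideal_pred.
Proof.
split=> [|x y /asboolP Ix /asboolP Iy]; first exact/asboolP/ideal0.
by apply/asboolP/idealD => //; rewrite -mulN1r; apply: idealMl.
Qed.

HB.instance Definition _ := GRing.isZmodClosed.Build A ideal_pred ideal_pred_zmod.

Definition ideal_zmod : zmodClosed A := GRing.ZmodClosed.clone A ideal_pred _.

Definition quotalg : Type := {quot ideal_zmod}.

HB.instance Definition _ := Choice.on quotalg.
HB.instance Definition _ := GRing.Zmodule.on quotalg.

Definition quot_pi (x : A) : quotalg := \pi_({quot ideal_zmod}) x.

Lemma quot_piP (q : quotalg) : exists x, q = quot_pi x.
Proof. by exists (repr (q : {quot ideal_zmod})); rewrite /quot_pi reprK. Qed.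

Lemma quot_pi_eq x y : quot_pi x = quot_pi y <-> I (x - y).
Proof.
split=> [/eqP|Ixy]; first by rewrite /quot_pi piE => /asboolP.
by apply/eqP; rewrite /quot_pi piE; apply/asboolP.
Qed.

Lemma quot_piD x y : quot_pi (x + y) = quot_pi x + quot_pi y.
Proof. by rewrite /quot_pi !piE. Qed.

Definition quot_repr (q : quotalg) : A := repr (q : {quot ideal_zmod}).

Lemma quot_reprK q : quot_pi (quot_repr q) = q.
Proof. by rewrite /quot_pi /quot_repr reprK. Qed.

Definition quot_one : quotalg := quot_pi 1.
Definition quot_mul (p q : quotalg) : quotalg :=
  quot_pi (quot_repr p * quot_repr q).

Lemma quot_piM x y : quot_pi (x * y) = quot_mul (quot_pi x) (quot_pi y).
Proof.
apply/quot_pi_eq.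
set x' := quot_repr _; set y' := quot_repr _.
have Ix : I (x - x') by apply/quot_pi_eq; rewrite quot_reprK.
have Iy : I (y - y') by apply/quot_pi_eq; rewrite quot_reprK.
have -> : x * y - x' * y' = (x - x') * y + x' * (y - y').
  by rewrite mulrBl mulrBr addrA subrK.
by apply: idealD; [apply: idealMr | apply: idealMl].
Qed.

Lemma quot_mulA : associative quot_mul.
Proof.
move=> p q r; rewrite -[p]quot_reprK -[q]quot_reprK -[r]quot_reprK.
by rewrite -!quot_piM mulrA.
Qed.

Lemma quot_mul1 : left_id quot_one quot_mul.
Proof. by move=> p; rewrite -[p]quot_reprK -quot_piM mul1r. Qed.

Lemma quot_mulr1 : right_id quot_one quot_mul.
Proof. by move=> p; rewrite -[p]quot_reprK -quot_piM mulr1. Qed.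

Lemma quot_mulDl : left_distributive quot_mul +%R.
Proof.
move=> p q r; rewrite -[p]quot_reprK -[q]quot_reprK -[r]quot_reprK.
by rewrite -quot_piD -!quot_piM -quot_piD mulrDl.
Qed.

Lemma quot_mulDr : right_distributive quot_mul +%R.
Proof.
move=> p q r; rewrite -[p]quot_reprK -[q]quot_reprK -[r]quot_reprK.
by rewrite -quot_piD -!quot_piM -quot_piD mulrDr.
Qed.

HB.instance Definition _ := GRing.Zmodule_isPzRing.Build quotalg
  quot_mulA quot_mul1 quot_mulr1 quot_mulDl quot_mulDr.

Lemma quot_pi_zmod : zmod_morphism quot_pi.
Proof.
move=> x y; apply: (addIr (quot_pi y)); rewrite -quot_piD.
by rewrite !subrK.
Qed.

Lemma quot_pi_monoid : monoid_morphism quot_pi.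
Proof. by split=> // x y; rewrite quot_piM. Qed.

HB.instance Definition _ :=
  GRing.isZmodMorphism.Build A quotalg quot_pi quot_pi_zmod.
HB.instance Definition _ :=
  GRing.isMonoidMorphism.Build A quotalg quot_pi quot_pi_monoid.

End QuotientAlgebra.

Section QuotientKalg.
Variables (K : pzRingType) (A : kalg K) (I : ideal A).

Lemma quot_central (k : K) (q : quotalg I) :
  (quot_pi I \o kalg_str A) k * q = q * (quot_pi I \o kalg_str A) k.
Proof. by rewrite -[q]quot_reprK /= -!rmorphM kalg_central. Qed.

Definition quot_kalg : kalg K := Kalg quot_central.

End QuotientKalg.

Section Modules.
Variable A : pzRingType.

Definition projective (P : lmodType A) : Prop :=
  forall (M N : lmodType A) (g : {linear M -> N}) (f : {linear P -> N}),
    (forall y, exists x, g x = y) ->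
    exists h : {linear P -> M}, forall x, g (h x) = f x.

Fixpoint proj_dim_le (n : nat) (M : lmodType A) : Prop :=
  if n is n'.+1 then
    exists (P N : lmodType A) (i : {linear N -> P}) (p : {linear P -> M}),
      [/\ projective P, proj_dim_le n' N, injective i,
          (forall y, exists x, p x = y)
        & forall x, p x = 0 <-> exists y, x = i y]
  else projective M.

(* Left global dimension; for a finite dimensional algebra it equals the right *)
(* one.                                                                        *)
Definition gl_dim_le (n : nat) : Prop :=
  forall M : lmodType A, proj_dim_le n M.

Definition simple_module (M : lmodType A) : Prop :=
  (exists x : M, x != 0) /\
  forall S : {pred M}, submod_closed S -> S =i pred1 0 \/ S =i predT.

End Modules.

Record quiver (V : finType) := Quiver {
  arr : finType ;
  src : arr -> V ;
  tgt : arr -> V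
}.

Arguments src {V} q _.
Arguments tgt {V} q _.

Section Paths.
Variables (V : finType) (Q : quiver V).
Implicit Types (x : V) (s t : seq (arr Q)).

Fixpoint walk x s : bool :=
  if s is a :: s' then (src Q a == x) && walk (tgt Q a) s' else true.

Definition wend x s : V := last x (map (tgt Q) s).

(* A path is its starting vertex with its sequence of arrows, composed from    *)
(* left to right.                                                              *)
Definition qpath : Type := {xs : V * seq (arr Q) | walk xs.1 xs.2}.

HB.instance Definition _ := SubChoice.on qpath.

Definition pstart (p : qpath) : V := (val p).1.
Definition parrs (p : qpath) : seq (arr Q) := (val p).2.
Definition pend (p : qpath) : V := wend (pstart p) (parrs p).
Definition plen (p : qpath) : nat := size (parrs p).
Definition pcyclic (p : qpath) : bool := pstart p == pend p.

Lemma walk_cat x s t : walk x (s ++ t) = walk x s && walk (wend x s) t.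
Proof. by elim: s x => //= a s IHs x; rewrite IHs andbA. Qed.

Lemma wend_cat x s t : wend x (s ++ t) = wend (wend x s) t.
Proof. by rewrite /wend map_cat last_cat. Qed.

End Paths.

(* The complete path algebra: formal, possibly infinite, combinations of paths *)
Definition cpalg (K : fieldType) (V : finType) (Q : quiver V) : Type :=
  qpath Q -> K.

Section CompletePathAlgebra.
Variables (K : fieldType) (V : finType) (Q : quiver V).
Local Notation A := (cpalg K Q).
Implicit Types (f g h : A) (x : V) (s t : seq (arr Q)).

HB.instance Definition _ := Choice.copy A (qpath Q -> K).
HB.instance Definition _ := GRing.Zmodule.copy A (qpath Q -> K).

Definition cp_scale (k : K) (f : A) : A := fun p => k * f p.

Lemma cp_scaleA a b f : cp_scale a (cp_scale b f) = cp_scale (a * b) f.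
Proof. by apply/funext => p; rewrite /cp_scale mulrA. Qed.

Lemma cp_scale1 : left_id 1 cp_scale.
Proof. by move=> f; apply/funext => p; rewrite /cp_scale mul1r. Qed.

Lemma cp_scaleDr : right_distributive cp_scale +%R.
Proof. by move=> k f g; apply/funext => p; rewrite /cp_scale -mulrDr. Qed.

Lemma cp_scaleDl f : {morph cp_scale^~ f : a b / a + b}.
Proof. by move=> a b; apply/funext => p; rewrite /cp_scale mulrDl. Qed.

HB.instance Definition _ := GRing.Zmodule_isLmodule.Build K A
  cp_scaleA cp_scale1 cp_scaleDr cp_scaleDl.

(* coef f x s is the coefficient in f of the path with arrows s starting at x, *)
(* and 0 if there is no such path.                                             *)
Definition coef f x s : K := oapp f 0 (insub (x, s)).

Definition of_coef (F : V -> seq (arr Q) -> K) : A :=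
  fun p => F (pstart p) (parrs p).

Lemma coefP f g : (forall x s, coef f x s = coef g x s) -> f = g.
Proof.
move=> fg; apply/funext => p; have := fg (pstart p) (parrs p).
by rewrite /coef /pstart /parrs -surjective_pairing valK.
Qed.

Lemma coefE f p : f p = coef f (pstart p) (parrs p).
Proof. by rewrite /coef /pstart /parrs -surjective_pairing valK. Qed.

Lemma coef_of F x s : coef (of_coef F) x s = if walk x s then F x s else 0.
Proof.
rewrite /coef; case: insubP => [p /= -> pE|/= /negPf -> //].
by rewrite /of_coef /pstart /parrs (pE : \val p = _).
Qed.

Lemma coef_notwalk f x s : ~~ walk x s -> coef f x s = 0.
Proof. by move=> w; rewrite /coef; case: insubP => //= p; rewrite (negPf w). Qed.

Lemma coefD f g x s : coef (f + g) x s = coef f x s + coef g x s.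
Proof. by rewrite /coef; case: insub => [p|] //=; rewrite addr0. Qed.

Lemma coefZ k f x s : coef (k *: f) x s = k * coef f x s.
Proof. by rewrite /coef; case: insub => [p|] //=; rewrite mulr0. Qed.

Definition cp_one : A := of_coef (fun _ s => (s == [::])%:R).

Definition cp_mul f g : A := of_coef (fun x s =>
  \sum_(i < (size s).+1)
     coef f x (take i s) * coef g (wend x (take i s)) (drop i s)).

Lemma coef_mul f g x s : coef (cp_mul f g) x s =
  \sum_(i < (size s).+1)
     coef f x (take i s) * coef g (wend x (take i s)) (drop i s).
Proof.
rewrite coef_of; case: ifPn => // nw; rewrite big1 // => i _.
move: nw; rewrite -{1}(cat_take_drop i s) walk_cat negb_and.
by case/orP=> nw; rewrite (coef_notwalk _ nw) ?mul0r ?mulr0.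
Qed.

Lemma cp_mulA : associative cp_mul.
Proof.
move=> f g h; apply: coefP => x s; rewrite !coef_mul.
set n := (size s).+1.
pose F j i := coef f x (take j s)
  * (coef g (wend x (take j s)) (take (i - j) (drop j s))
  * coef h (wend x (take i s)) (drop i s)).
transitivity (\sum_(0 <= j < n) \sum_(0 <= i < n | (j <= i)%N) F j i).
  rewrite big_mkord; apply: eq_bigr => j _; rewrite coef_mul mulr_sumr.
  have jn : (j <= size s)%N by rewrite -ltnS.
  rewrite size_drop -(big_mkord xpredT (fun i => coef f x (take j s) *
    (coef g (wend x (take j s)) (take i (drop j s)) *
     coef h (wend (wend x (take j s)) (take i (drop j s)))
       (drop i (drop j s))))).
  have -> : \sum_(0 <= i < n | (j <= i)%N) F j i = \sum_(j <= i < n) F j i.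
    rewrite (@big_cat_nat _ _ _ j) //=; last exact: ltnW.
    rewrite big_nat_cond big_pred0 ?add0r => [|i]; last first.
      by rewrite leq0n /=; case: ltnP.
    rewrite big_nat_cond [RHS]big_nat_cond; apply: eq_bigl => i.
    by case: (leqP j i) => //=; rewrite andbT.
  have -> : \sum_(j <= i < n) F j i = \sum_(0 <= i < n - j) F j (i + j)%N.
    by rewrite -[X in \sum_(X <= i < n) _]add0n big_addn.
  rewrite /n subSn //.
  apply: eq_big_nat => i _; rewrite /F addnK -wend_cat drop_drop.
  by congr (_ * (_ * coef h (wend x _) _)); rewrite [(i + j)%N]addnC takeD.
rewrite (exchange_big_dep_nat xpredT) //= big_mkord; apply: eq_bigr => i _.
have iS : (i <= size s)%N by rewrite -ltnS.
rewrite coef_mul mulr_suml size_take_min (minn_idPl iS).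
rewrite -(big_mkord xpredT (fun j => coef f x (take j (take i s)) *
  coef g (wend x (take j (take i s))) (drop j (take i s)) *
  coef h (wend x (take i s)) (drop i s))).
rewrite (@big_cat_nat _ _ _ i.+1) //=.
rewrite [X in _ + X]big_nat_cond [X in _ + X]big_pred0 ?addr0 => [|j]; last first.
  by case: (leqP j i) => ji; rewrite ?andbF // ltnNge ji.
rewrite big_nat_cond [RHS]big_nat_cond.
rewrite (eq_bigl (fun j => (0 <= j < i.+1)%N && true)); last first.
  by move=> j; rewrite ltnS /=; case: leqP.
apply: eq_bigr => j /andP[/andP[_ ji] _].
rewrite /F mulrA take_takel //.
by rewrite take_drop subnK.
Qed.

Lemma coef_one x s : coef cp_one x s = (s == [::])%:R.
Proof. by rewrite coef_of; case: s => //= a s; case: ifP. Qed.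

Lemma cp_mul1 : left_id cp_one cp_mul.
Proof.
move=> f; apply: coefP => x s; rewrite coef_mul (bigD1 ord0) //= big1 ?addr0.
  by rewrite coef_one take0 eqxx mul1r drop0.
move=> i i0; rewrite coef_one -size_eq0 size_takel; last by rewrite -ltnS.
by rewrite -[(i == 0 :> nat)%N]/(i == ord0) (negPf i0) mul0r.
Qed.

Lemma cp_mulr1 : right_id cp_one cp_mul.
Proof.
move=> f; apply: coefP => x s; rewrite coef_mul (bigD1 ord_max) //= big1 ?addr0.
  by rewrite coef_one take_size drop_size eqxx mulr1.
move=> i; rewrite -(inj_eq val_inj) /= => i0.
rewrite coef_one -size_eq0 size_drop subn_eq0 leqNgt.
by rewrite ltn_neqAle i0 -ltnS ltn_ord mulr0.
Qed.

Lemma cp_mulDl : left_distributive cp_mul +%R.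
Proof.
move=> f g h; apply: coefP => x s; rewrite coefD !coef_mul -big_split /=.
by apply: eq_bigr => i _; rewrite coefD mulrDl.
Qed.

Lemma cp_mulDr : right_distributive cp_mul +%R.
Proof.
move=> f g h; apply: coefP => x s; rewrite coefD !coef_mul -big_split /=.
by apply: eq_bigr => i _; rewrite coefD mulrDr.
Qed.

HB.instance Definition _ := GRing.Zmodule_isPzRing.Build A
  cp_mulA cp_mul1 cp_mulr1 cp_mulDl cp_mulDr.

Lemma cp_scaleAl (k : K) (f g : A) : k *: (f * g) = (k *: f) * g.
Proof.
apply: coefP => x s; rewrite coefZ !coef_mul mulr_sumr.
by apply: eq_bigr => i _; rewrite coefZ mulrA.
Qed.

Lemma cp_scaleAr (k : K) (f g : A) : k *: (f * g) = f * (k *: g).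
Proof.
apply: coefP => x s; rewrite coefZ !coef_mul mulr_sumr.
by apply: eq_bigr => i _; rewrite coefZ mulrCA.
Qed.

Definition cp_str (k : K) : A := k *: (1 : A).

Lemma cp_str_zmod : zmod_morphism cp_str.
Proof. by move=> a b; rewrite /cp_str scalerBl. Qed.

Lemma cp_str_monoid : monoid_morphism cp_str.
Proof.
split=> [|a b]; first exact: scale1r.
by rewrite /cp_str -cp_scaleAl mul1r scalerA.
Qed.

HB.instance Definition _ := GRing.isZmodMorphism.Build K A cp_str cp_str_zmod.
HB.instance Definition _ :=
  GRing.isMonoidMorphism.Build K A cp_str cp_str_monoid.

Lemma cp_str_central (k : K) (f : A) : cp_str k * f = f * cp_str k.
Proof. by rewrite /cp_str -cp_scaleAl -cp_scaleAr mul1r mulr1. Qed.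

Definition cp_kalg : kalg K := Kalg cp_str_central.

Definition delta (p : qpath Q) : A := fun q => (q == p)%:R.

Definition idem (x : V) : A :=
  of_coef (fun y s => ((y == x) && (s == [::]))%:R).

Definition arrow_elt (a : arr Q) : A :=
  of_coef (fun _ s => (s == [:: a])%:R).

(* The n-th power of the radical consists of the elements supported on paths   *)
(* of length at least n.                                                       *)
Definition adic_closure (S : set A) : set A :=
  [set f | forall n, exists2 g, S g & forall p, (plen p < n)%N -> f p = g p].

Section ClosedIdeal.
Variable S : set A.
Let I := adic_closure (ideal_span S).

Lemma ideal_span0 : ideal_span S 0.
Proof.
exists 0, (fun=> 0), (fun=> 0), (fun=> 0).
by split=> [[]//|]; rewrite big_ord0.
Qed.

Lemma ideal_spanD f g :
  ideal_span S f -> ideal_span S g -> ideal_span S (f + g).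
Proof.
move=> [m [u [s [v [Ss ->]]]]] [n [u' [s' [v' [Ss' ->]]]]].
pose glue (w : 'I_m -> A) (w' : 'I_n -> A) (i : 'I_(m + n)) :=
  match fintype.split i with inl j => w j | inr j => w' j end.
exists (m + n)%N, (glue u u'), (glue s s'), (glue v v'); split.
  by move=> i; rewrite /glue; case: fintype.split.
rewrite big_split_ord /=; congr (_ + _); apply: eq_bigr => i _; rewrite /glue.
  by rewrite -[lshift n i]/(unsplit (inl i)) unsplitK.
by rewrite -[rshift m i]/(unsplit (inr i)) unsplitK.
Qed.

Lemma ideal_spanMl a f : ideal_span S f -> ideal_span S (a * f).
Proof.
move=> [n [u [s [v [Ss ->]]]]]; exists n, (fun i => a * u i), s, v; split=> //.
by rewrite mulr_sumr; apply: eq_bigr => i _; rewrite !mulrA.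
Qed.

Lemma ideal_spanMr a f : ideal_span S f -> ideal_span S (f * a).
Proof.
move=> [n [u [s [v [Ss ->]]]]]; exists n, u, s, (fun i => v i * a); split=> //.
by rewrite mulr_suml; apply: eq_bigr => i _; rewrite !mulrA.
Qed.

Lemma coef_agree n f g : (forall p, (plen p < n)%N -> f p = g p) ->
  forall x s, (size s < n)%N -> coef f x s = coef g x s.
Proof.
move=> fg x s sn; rewrite /coef; case: insubP => //= p _ pE; apply: fg.
by rewrite /plen /parrs (pE : \val p = _).
Qed.

Lemma closed_ideal0 : I 0.
Proof. by move=> n; exists 0 => //; apply: ideal_span0. Qed.

Lemma closed_idealD f g : I f -> I g -> I (f + g).
Proof.
move=> If Ig n; have [f' If' ff'] := If n; have [g' Ig' gg'] := Ig n.
exists (f' + g'); first exact: ideal_spanD.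
by move=> p pn; rewrite -[LHS]/(f p + g p) ff' // gg'.
Qed.

Lemma closed_idealMl a f : I f -> I (a * f).
Proof.
move=> If n; have [f' If' ff'] := If n.
exists (a * f'); first exact: ideal_spanMl.
move=> p pn; rewrite !coefE !coef_mul; apply: eq_bigr => i _; congr (_ * _).
apply: (coef_agree ff'); rewrite size_drop.
exact: leq_ltn_trans (leq_subr _ _) pn.
Qed.

Lemma closed_idealMr a f : I f -> I (f * a).
Proof.
move=> If n; have [f' If' ff'] := If n.
exists (f' * a); first exact: ideal_spanMr.
move=> p pn; rewrite !coefE !coef_mul; apply: eq_bigr => i _; congr (_ * _).
apply: (coef_agree ff'); rewrite size_take_min.
exact: leq_ltn_trans (geq_minr _ _) pn.
Qed.

Definition closed_ideal : ideal cp_kalg :=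
  Ideal closed_ideal0 closed_idealD closed_idealMl closed_idealMr.

End ClosedIdeal.
End CompletePathAlgebra.

Arguments cp_kalg K {V} Q.
Arguments idem K {V} Q x.
Arguments arrow_elt K {V Q} a.

(* The element of KQ' whose coefficient at a path a_1 ... a_d is that of f at  *)
(* the concatenation of the words d(a_1), ..., d(a_d), and 0 if one of these   *)
(* is undefined.                                                               *)
Definition pull (K : fieldType) (V : finType) (Q Q' : quiver V)
    (d : arr Q' -> option (seq (arr Q))) (f : cpalg K Q) : cpalg K Q' :=
  of_coef (fun x s => if all (isSome \o d) s
                      then coef f x (flatten (pmap d s)) else 0).

Section Potentials.
Variables (K : fieldType) (V : finType).
Implicit Types Q : quiver V.

Definition potential_ge (n : nat) Q (W : cpalg K Q) : Prop :=
  forall p, W p != 0 -> pcyclic p /\ (n <= plen p)%N.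

Definition is_QP Q (W : cpalg K Q) : Prop := potential_ge 2 W.
Definition reduced_QP Q (W : cpalg K Q) : Prop := potential_ge 3 W.

(* The coefficient of a path s in the derivative of W with respect to a is the *)
(* sum, over all factorizations s = t ++ u, of the coefficient of the cycle    *)
(* u ++ a :: t, which starts where t ends.                                     *)
Definition cderiv Q (W : cpalg K Q) (a : arr Q) : cpalg K Q :=
  of_coef (fun x s => \sum_(i < (size s).+1)
    coef W (wend x (take i s)) (drop i s ++ a :: take i s)).

Definition jacobian Q (W : cpalg K Q) : kalg K :=
  quot_kalg (closed_ideal (range (cderiv W))).

Definition cyc_equiv Q (W W' : cpalg K Q) : Prop :=
  adic_closure (lin_span [set f | exists c c' : qpath Q,
    [/\ pcyclic c, pcyclic c', parrs c != [::], parrs c' = rot 1 (parrs c)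
      & f = delta K c - delta K c']]) (W - W').

Definition right_equiv Q (W : cpalg K Q) Q' (W' : cpalg K Q') : Prop :=
  exists f : {rmorphism cp_kalg K Q -> cp_kalg K Q'},
    [/\ alg_iso f, forall x, f (idem K Q x) = idem K Q' x
      & cyc_equiv (f W) W'].

Definition quiver0 : quiver V :=
  @Quiver V void (of_void V) (of_void V).

Definition trivial_QP Q (W : cpalg K Q) : Prop :=
  (forall p, W p != 0 -> pcyclic p /\ plen p = 2) /\
  isomorphic (jacobian W) (cp_kalg K quiver0).

Definition qsum Q Q' : quiver V :=
  @Quiver V (arr Q + arr Q')%type
    (fun a => match a with inl b => src Q b | inr b => src Q' b end)
    (fun a => match a with inl b => tgt Q b | inr b => tgt Q' b end).

Definition psum Q (W : cpalg K Q) Q' (W' : cpalg K Q') : cpalg K (qsum Q Q') :=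
  pull (Q' := qsum Q Q')
    (fun a => match a with inl b => Some [:: b] | inr _ => None end) W +
  pull (Q' := qsum Q Q')
    (fun a => match a with inl _ => None | inr b => Some [:: b] end) W'.

End Potentials.

Section Cuts.
Variables (K : fieldType) (V : finType) (Q : quiver V).
Implicit Types (W : cpalg K Q) (C : {set arr Q}).

Definition is_cut W C : Prop :=
  forall p, W p != 0 -> count (mem C) (parrs p) = 1%N.

Definition cut_quiver C : quiver V :=
  @Quiver V {a : arr Q | a \notin C}
    (fun a => src Q (val a)) (fun a => tgt Q (val a)).

(* For c in a cut C no arrow of C occurs in the derivative with respect to c,  *)
(* so cut_deriv is that derivative seen in the path algebra of Q_C.            *)
Definition cut_deriv W C (c : arr Q) : cpalg K (cut_quiver C) :=
  pull (Q' := cut_quiver C) (fun a => Some [:: val a]) (cderiv W c).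

Arguments cut_deriv W C c : clear implicits.

Definition cut_ideal W C : ideal (cp_kalg K (cut_quiver C)) :=
  closed_ideal [set f | exists2 c, c \in C & f = cut_deriv W C c].

Definition truncated W C : kalg K := quot_kalg (cut_ideal W C).

Definition strict_source C (k : V) : Prop :=
  forall a, (tgt Q a = k -> a \in C) /\ (src Q a = k -> a \notin C).

Definition strict_sink C (k : V) : Prop :=
  forall a, (src Q a = k -> a \in C) /\ (tgt Q a = k -> a \notin C).

Definition algebraic_cut W C : Prop :=
  [/\ is_cut W C, finite_dim (truncated W C), gl_dim_le (truncated W C) 2
    & forall c, c \in C ->
        ~ closed_ideal [set f | exists2 c', (c' \in C) && (c' != c)
                              & f = cut_deriv W C c'] (cut_deriv W C c)].

(* Standing assumption on quivers of QPs: connected, more than one vertex.     *)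
Definition standing_quiver : Prop :=
  (1 < #|V|)%N /\
  forall x y : V, connect
    [rel u v | [exists a, ((src Q a == u) && (tgt Q a == v))
                       || ((src Q a == v) && (tgt Q a == u))]] x y.

Definition in_W1 W C : Prop :=
  [/\ standing_quiver, reduced_QP W & algebraic_cut W C].

Definition simple_at W C (k : V) (M : lmodType (truncated W C)) : Prop :=
  simple_module M /\
  exists x : M, quot_pi (cut_ideal W C) (idem K (cut_quiver C) k) *: x != 0.

End Cuts.

(* k' corresponds to k under phi: the simple module at k' restricted along phi *)
(* is isomorphic to the simple module at k.                                    *)
Definition vertex_corr (K : fieldType) (V V' : finType)
    (Q : quiver V) (Q' : quiver V') (W : cpalg K Q) (W' : cpalg K Q')
    (C : {set arr Q}) (C' : {set arr Q'})
    (phi : {rmorphism truncated W C -> truncated W' C'}) (k : V) (k' : V') :=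
  exists (M : lmodType (truncated W C)) (M' : lmodType (truncated W' C'))
         (f : {linear M -> M' | phi \; *:%R}),
    [/\ simple_at k M, simple_at k' M' & bijective f].

Section Mutation.
Variables (K : fieldType) (V : finType) (Q : quiver V) (k : V).

Definition loop_free_at : Prop :=
  forall a : arr Q, ~ (src Q a = k /\ tgt Q a = k).

Definition arr_away : finType := {a : arr Q | (src Q a != k) && (tgt Q a != k)}.
Definition arr_from : finType := {a : arr Q | src Q a == k}.
Definition arr_to : finType := {a : arr Q | tgt Q a == k}.

(* M_star a is a^* for a starting at k, M_costar b is b^* for b ending at k.   *)
Definition mut_arr : finType :=
  ((arr_away + arr_to * arr_from) + (arr_from + arr_to))%type.
Definition M_away (a : arr_away) : mut_arr := inl (inl a).
Definition M_comp (ba : arr_to * arr_from) : mut_arr := inl (inr ba).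
Definition M_star (a : arr_from) : mut_arr := inr (inl a).
Definition M_costar (b : arr_to) : mut_arr := inr (inr b).

Definition mut_quiver : quiver V :=
  @Quiver V mut_arr
    (fun m => match m with
       | inl (inl a) => src Q (val a)
       | inl (inr ba) => src Q (val ba.1)
       | inr (inl a) => tgt Q (val a)
       | inr (inr b) => tgt Q (val b)
       end)
    (fun m => match m with
       | inl (inl a) => tgt Q (val a)
       | inl (inr ba) => tgt Q (val ba.2)
       | inr (inl a) => src Q (val a)
       | inr (inr b) => src Q (val b)
       end).

Definition mut_word (m : mut_arr) : option (seq (arr Q)) :=
  match m with
  | inl (inl a) => Some [:: val a]
  | inl (inr ba) => Some [:: val ba.1; val ba.2]
  | inr _ => None
  end.

Definition mut_bracket (W : cpalg K Q) : cpalg K mut_quiver :=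
  pull (Q' := mut_quiver) mut_word W.

Definition premut (W : cpalg K Q) : cpalg K mut_quiver :=
  mut_bracket W +
  \sum_(ba : arr_to * arr_from)
     arrow_elt K (Q := mut_quiver) (M_comp ba) *
     arrow_elt K (Q := mut_quiver) (M_star ba.2) *
     arrow_elt K (Q := mut_quiver) (M_costar ba.1).

(* (R, U) is a reduced part of the premutation of (Q, W) at k.                 *)
Definition is_mutation (W : cpalg K Q) (R : quiver V) (U : cpalg K R) : Prop :=
  [/\ loop_free_at, reduced_QP U
    & exists W1 : cpalg K Q,
       [/\ is_QP W1, cyc_equiv W W1, (forall p, W1 p != 0 -> pstart p != k)
         & exists (T : quiver V) (S : cpalg K T),
             trivial_QP S /\ right_equiv (premut W1) (psum U S)]].

End Mutation.

(* Main.v *)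
From Pilot Require Import Defs.
From HB Require Import structures.
From mathcomp Require Import all_boot all_algebra.
From mathcomp Require Import boolp classical_sets.
(* Names such as coefD denote here the coefficients of path algebra elements,
   not those of polynomials. *)
Import Pilot.Defs.

(** The truncated algebra with its cut determines the potential up to
    right-equivalence, and Jacobian algebras, also after mutation, only depend
    on that class. Homomorphisms are lifted to complete path algebras and
    compared there; J denotes the ideal generated by the arrows.

    Lifting. The characters of a complete path algebra are its vertices
    (character_vertex), so an isomorphism phi of truncated algebras induces a
    bijection sigma of vertices; a module argument identifies it with the
    correspondence of simple modules (simple_vertex). After conjugation by a
    unit, phi respects the idempotents of the vertices, hence lifts to
    F : KQ_C -> KQ'_C', and its inverse lifts to some G. The two ideals of
    relations lie in the square of J, so the composites of F and G are the
    identity modulo J^2, hence bijective (unipotent_inj, unipotent_surj), and F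
    is an isomorphism carrying one ideal onto the other (lift_iso).

    Recovering the potential. A potential W of degree one for the cut has the
    same cyclic derivatives as the sum of the c (d_c W), c in C (cut_potential).
    The algebra being finite dimensional, its ideal contains a power of J, and
    this lets every relation d_c W be expanded as a convergent sum of terms
    u r v, where r runs over the relations d_c' W' transported along the
    inverse of F (expand_solve). Sending c' to the sum of the matching v c u
    extends that inverse to KQ' -> KQ and takes W' to W, because rotating
    v c u r into c u r v gives back the sum of the c (d_c W) (relation_lift).
    Minimality of the relations forces the composite with the analogous map
    KQ -> KQ' to be the identity modulo J^2 (cut_unipotent); so both maps are
    bijective (QP_right_equiv).

    Derivatives. All of this is controlled by the operation cD b f y that
    replaces p b q by q y p in f. It satisfies a Leibniz rule (cDM) and a chain rule
    (chain_rule), and it preserves closed ideals (cD_closed). Cyclic equivalence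
    enters only through equality of all cyclic derivatives (dd_equiv), which
    the chain rule transports, and which is enough for Jacobian algebras
    (jac_iso).

    Mutation. Trivial summands do not change the Jacobian algebra (psum_jac),
    so premutations can be compared instead of mutations. A
    right-equivalence h extends to premutations: composite arrows follow h,
    and the new arrows a* and b* follow the inverse transpose of the action of
    h on the arrows a and b at k, which preserves the sum of the cycles
    [ba]a*b* up to rotation (theta_cycles). A strict source or sink k carries
    no cycle of Q_C, and this rules out loops at the corresponding vertex of
    Q'. *)

Set Implicit Arguments.
Unset Strict Implicit.
Unset Printing Implicit Defensive.
Import GRing.Theory.
Local Open Scope classical_set_scope.
Local Open Scope ring_scope.

(** * Coefficients and the radical filtration *)

Section Coefficients.
Variables (K : fieldType) (V : finType) (Q : quiver V).
Local Notation A := (cpalg K Q).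
Implicit Types (f g h : A) (x y v : V) (s t : seq (arr Q)) (a b : arr Q).

Lemma coef0 x s : coef (0 : A) x s = 0.
Proof. by rewrite /coef; case: insub. Qed.

Lemma coefN f x s : coef (- f) x s = - coef f x s.
Proof. by rewrite /coef; case: insub => [p|] //=; rewrite oppr0. Qed.

Lemma coefB f g x s : coef (f - g) x s = coef f x s - coef g x s.
Proof. by rewrite coefD coefN. Qed.

Lemma coef_sum I (r : seq I) (P : pred I) (F : I -> A) x s :
  coef (\sum_(i <- r | P i) F i) x s = \sum_(i <- r | P i) coef (F i) x s.
Proof.
by apply: (big_morph (fun f => coef f x s)) => [f g|]; rewrite ?coefD ?coef0.
Qed.

Lemma coefM f g x s : coef (f * g) x s =
  \sum_(i < (size s).+1)
     coef f x (take i s) * coef g (wend x (take i s)) (drop i s).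
Proof. exact: coef_mul. Qed.

Lemma coefM_nil f g x : coef (f * g) x [::] = coef f x [::] * coef g x [::].
Proof. by rewrite coefM big_ord1. Qed.

Lemma coefM_cons f g x a s : coef (f * g) x (a :: s) =
  coef f x [::] * coef g x (a :: s) +
  \sum_(i < (size s).+1)
     coef f x (a :: take i s) * coef g (wend (tgt Q a) (take i s)) (drop i s).
Proof. by rewrite coefM big_ord_recl. Qed.

Lemma coef_1 x s : coef (1 : A) x s = (s == [::])%:R.
Proof. exact: coef_one. Qed.

Lemma coef_idem v x s : coef (idem K Q v) x s = ((x == v) && (s == [::]))%:R.
Proof.
rewrite coef_of; case: ifPn => //; case: s => //= a s.
by rewrite andbF.
Qed.

Lemma coef_arrow a x s :
  coef (arrow_elt K a) x s = ((x == src Q a) && (s == [:: a]))%:R.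
Proof.
rewrite coef_of; case: eqP => [->/=|_]; last by rewrite andbF; case: ifP.
by rewrite !andbT (eq_sym x); case: eqP.
Qed.

Lemma walk_start x a s : walk x (a :: s) -> x = src Q a.
Proof. by move=> /= /andP[/eqP]. Qed.

Lemma coef_idemM v f x s :
  coef (idem K Q v * f) x s = (x == v)%:R * coef f x s.
Proof.
case: s => [|a s]; first by rewrite coefM_nil coef_idem andbT.
rewrite coefM_cons coef_idem andbT big1 ?addr0 // => i _.
by rewrite coef_idem andbF mul0r.
Qed.

Lemma coefM_idem v f x s :
  coef (f * idem K Q v) x s = (wend x s == v)%:R * coef f x s.
Proof.
rewrite coefM (bigD1 ord_max) //= big1 ?addr0 => [|i].
  by rewrite take_size drop_size coef_idem andbT mulrC.
rewrite -(inj_eq val_inj) /= => i0.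
rewrite coef_idem -[_ == [::]]size_eq0 size_drop subn_eq0 leqNgt.
by rewrite ltn_neqAle i0 -ltnS ltn_ord andbF mulr0.
Qed.

Lemma coef_arrowM_cons a f x b s : coef (arrow_elt K a * f) x (b :: s) =
  ((x == src Q a) && (b == a))%:R * coef f (tgt Q a) s.
Proof.
rewrite coefM_cons coef_arrow andbF mul0r add0r big_ord_recl take0 drop0 /=.
rewrite coef_arrow big1 => [|i _].
  rewrite addr0 /wend /= eqseq_cons eqxx andbT.
  by case: (eqVneq b a) => [->//|_]; rewrite andbF !mul0r.
rewrite coef_arrow; case: s i => [|c s] [i hi] //=.
by rewrite eqseq_cons !andbF mul0r.
Qed.

Lemma coef_arrowM_nil a f x : coef (arrow_elt K a * f) x [::] = 0.
Proof. by rewrite coefM_nil coef_arrow andbF mul0r. Qed.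

Lemma coefM_arrow_rcons a f x b s : coef (f * arrow_elt K a) x (rcons s b) =
  ((wend x s == src Q a) && (b == a))%:R * coef f x s.
Proof.
rewrite coefM size_rcons big_ord_recr /=.
rewrite (@drop_oversize _ (size s).+1) ?size_rcons // coef_arrow andbF mulr0 addr0.
rewrite big_ord_recr /=.
rewrite -cats1 take_size_cat // drop_size_cat // coef_arrow eqseq_cons andbT.
rewrite mulrC big1 ?add0r // => i _; rewrite coef_arrow drop_cat ltn_ord.
case: (eqVneq (drop i s ++ [:: b]) [:: a]) => [/(congr1 size)|_]; last first.
  by rewrite andbF mulr0.
rewrite size_cat size_drop /= addn1 => -[/eqP].
by rewrite subn_eq0 leqNgt ltn_ord.
Qed.

Lemma idemM v w : idem K Q v * idem K Q w = (v == w)%:R *: idem K Q v.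
Proof.
apply: coefP => x s; rewrite coef_idemM coefZ !coef_idem.
case: (eqVneq x v) => [->|_] /=; last by rewrite !(mulr0, mul0r).
by case: (v == w); rewrite ?mul1r ?mul0r.
Qed.

Lemma idem_mul v : idem K Q v * idem K Q v = idem K Q v.
Proof. by rewrite idemM eqxx scale1r. Qed.

Lemma sum_idem : \sum_v idem K Q v = 1.
Proof.
apply: coefP => x s; rewrite coef_sum coef_1 (bigD1 x) //= coef_idem eqxx.
by rewrite big1 ?addr0 // => v /negPf; rewrite coef_idem eq_sym => ->.
Qed.

Lemma idem_arrow a : idem K Q (src Q a) * arrow_elt K a = arrow_elt K a.
Proof.
apply: coefP => x s; rewrite coef_idemM coef_arrow.
by case: (x == _); rewrite ?mul1r ?mul0r.
Qed.

Lemma arrow_idem a : arrow_elt K a * idem K Q (tgt Q a) = arrow_elt K a.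
Proof.
apply: coefP => x s; rewrite coefM_idem coef_arrow.
case: (eqVneq s [:: a]) => [->|_]; last by rewrite andbF mulr0.
by rewrite /wend /= eqxx mul1r.
Qed.

Lemma cp_scalerAl (k : K) f g : (k *: f) * g = k *: (f * g).
Proof. by rewrite cp_scaleAl. Qed.

Lemma cp_scalerAr (k : K) f g : f * (k *: g) = k *: (f * g).
Proof. by rewrite cp_scaleAr. Qed.

(** Membership in the n-th power of the ideal of the arrows. *)
Definition ordge (n : nat) (f : A) : Prop :=
  forall x s, (size s < n)%N -> coef f x s = 0.

Lemma ordge0 f : ordge 0 f. Proof. by []. Qed.

Lemma ordge_0 n : ordge n 0.
Proof. by move=> x s _; rewrite coef0. Qed.

Lemma ordge_le m n f : (m <= n)%N -> ordge n f -> ordge m f.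
Proof. by move=> mn fn x s sm; apply: fn; apply: leq_trans mn. Qed.

Lemma ordgeD n f g : ordge n f -> ordge n g -> ordge n (f + g).
Proof. by move=> fn gn x s sn; rewrite coefD fn ?gn ?addr0. Qed.

Lemma ordgeN n f : ordge n f -> ordge n (- f).
Proof. by move=> fn x s sn; rewrite coefN fn ?oppr0. Qed.

Lemma ordgeB n f g : ordge n f -> ordge n g -> ordge n (f - g).
Proof. by move=> fn gn; apply/ordgeD/ordgeN. Qed.

Lemma ordgeZ n k f : ordge n f -> ordge n (k *: f).
Proof. by move=> fn x s sn; rewrite coefZ fn ?mulr0. Qed.

Lemma ordge_sum n I (r : seq I) (P : pred I) (F : I -> A) :
  (forall i, P i -> ordge n (F i)) -> ordge n (\sum_(i <- r | P i) F i).
Proof. by move=> Fn x s sn; rewrite coef_sum big1 // => i /Fn ->. Qed.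

Lemma ordgeM m n f g : ordge m f -> ordge n g -> ordge (m + n) (f * g).
Proof.
move=> fm gn x s smn; rewrite coefM big1 // => i _.
have iS : (i <= size s)%N by rewrite -ltnS.
have [im|mi] := ltnP i m; first by rewrite fm ?mul0r // size_takel.
rewrite gn ?mulr0 // size_drop.
by rewrite ltn_subLR // (leq_trans smn) // leq_add2r.
Qed.

Lemma ordgeMr n f g : ordge n g -> ordge n (f * g).
Proof. by move/(ordgeM (ordge0 f)). Qed.

Lemma ordgeMl n f g : ordge n f -> ordge n (f * g).
Proof. by move=> fn; have := ordgeM fn (ordge0 g); rewrite addn0. Qed.

Lemma ordge1P f : ordge 1 f <-> forall v, coef f v [::] = 0.
Proof. by split=> [f1 v|f1 v [|//] _]; apply: f1. Qed.

Lemma ordge_arrow a : ordge 1 (arrow_elt K a).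
Proof. by apply/ordge1P => v; rewrite coef_arrow andbF. Qed.

Lemma ordge_eq f g : (forall n, ordge n (f - g)) -> f = g.
Proof.
move=> fg; apply: coefP => x s; apply/eqP; rewrite -subr_eq0 -coefB.
by rewrite (fg (size s).+1).
Qed.

Lemma ordge_sym n f g : ordge n (f - g) -> ordge n (g - f).
Proof. by rewrite -opprB => /ordgeN; rewrite opprK. Qed.

Lemma ordge_trans n f g h : ordge n (f - g) -> ordge n (g - h) -> ordge n (f - h).
Proof. by move=> fg gh; rewrite -(subrK g f) -addrA; apply: ordgeD. Qed.

(** The value at a path s is read off at stage (size s).+1, from which on it is
    constant as soon as u n.+1 - u n has order n for all n. *)
Definition lim (u : nat -> A) : A := of_coef (fun x s => coef (u (size s).+1) x s).

Lemma limP (u : nat -> A) : (forall n, ordge n (u n.+1 - u n)) ->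
  forall n, ordge n (lim u - u n).
Proof.
move=> cu n x s sn; rewrite coefB coef_of.
case: ifPn => [_|w]; last by rewrite coef_notwalk ?subr0.
apply/eqP; rewrite subr_eq0 eq_sym; apply/eqP.
elim: n sn => // n IHn; rewrite ltnS leq_eqVlt => /orP[/eqP <-//|sn].
by rewrite -IHn //; apply/eqP; rewrite -subr_eq0 -coefB cu.
Qed.

(** Every element is the sum of its constant part and of the a * lstrip a f.
    This decomposition, recursive in f, replaces the expansion in a possibly
    infinite sum of paths: an identity is proved modulo the n-th power of the
    radical by induction on n, stripping one arrow at each step. *)
Definition lstrip a f : A :=
  of_coef (fun y s => if y == tgt Q a then coef f (src Q a) (a :: s) else 0).

Definition rstrip a f : A :=
  of_coef (fun y s => if wend y s == src Q a then coef f y (rcons s a) else 0).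

Lemma coef_lstrip a f y s : coef (lstrip a f) y s =
  if y == tgt Q a then coef f (src Q a) (a :: s) else 0.
Proof.
rewrite coef_of; case: ifPn => // w; case: eqP => // yE.
by rewrite coef_notwalk //= eqxx -yE.
Qed.

Lemma walk_rcons x s a : walk x (rcons s a) = walk x s && (src Q a == wend x s).
Proof. by rewrite -cats1 walk_cat /= andbT. Qed.

Lemma coef_rstrip a f y s : coef (rstrip a f) y s =
  if wend y s == src Q a then coef f y (rcons s a) else 0.
Proof.
rewrite coef_of; case: ifPn => // w; case: eqP => // yE.
by rewrite coef_notwalk // walk_rcons (negPf w).
Qed.

Definition consts f : A := \sum_v coef f v [::] *: idem K Q v.

Lemma coef_consts f x s : coef (consts f) x s =
  (s == [::])%:R * coef f x [::].
Proof.
rewrite coef_sum (bigD1 x) //= coefZ coef_idem eqxx big1 ?addr0 => [|v vx].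
  by rewrite mulrC.
by rewrite coefZ coef_idem eq_sym (negPf vx) mulr0.
Qed.

Lemma lstripE f : f = consts f + \sum_a arrow_elt K a * lstrip a f.
Proof.
apply: coefP => x s; rewrite coefD coef_consts coef_sum.
case: s => [|b s] /=.
  by rewrite mul1r big1 ?addr0 // => a _; rewrite coef_arrowM_nil.
rewrite mul0r add0r (bigD1 b) //= coef_arrowM_cons eqxx andbT.
rewrite coef_lstrip eqxx big1 ?addr0 => [|a ab]; last first.
  by rewrite coef_arrowM_cons (eq_sym b) (negPf ab) andbF mul0r.
case: (eqVneq x (src Q b)) => [->|xb]; first by rewrite mul1r.
by rewrite mul0r coef_notwalk //= eq_sym (negPf xb).
Qed.

Lemma rstripE f : f = consts f + \sum_a rstrip a f * arrow_elt K a.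
Proof.
apply: coefP => x s; rewrite coefD coef_consts coef_sum.
case: (lastP s) => [|{}s b] /=.
  rewrite mul1r big1 ?addr0 // => a _.
  by rewrite coefM_nil coef_arrow andbF mulr0.
rewrite -size_eq0 size_rcons mul0r add0r (bigD1 b) //= coefM_arrow_rcons eqxx.
rewrite andbT coef_rstrip big1 ?addr0 => [|a ab]; last first.
  by rewrite coefM_arrow_rcons (eq_sym b) (negPf ab) andbF mul0r.
case: (eqVneq (wend x s) (src Q b)) => [_|xb]; first by rewrite mul1r.
by rewrite mul0r coef_notwalk // walk_rcons (eq_sym (src Q b)) (negPf xb) andbF.
Qed.

Lemma ordge_lstrip n a f : ordge n.+1 f -> ordge n (lstrip a f).
Proof. by move=> fn x s sn; rewrite coef_lstrip fn ?if_same. Qed.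

Lemma consts_ordge1 f : ordge 1 f -> consts f = 0.
Proof. by move/ordge1P=> f1; rewrite /consts big1 // => v _; rewrite f1 scale0r. Qed.

Lemma lstripE1 f : ordge 1 f -> f = \sum_a arrow_elt K a * lstrip a f.
Proof. by move=> /consts_ordge1 f1; rewrite {1}[f]lstripE f1 add0r. Qed.

Lemma rstripE1 f : ordge 1 f -> f = \sum_a rstrip a f * arrow_elt K a.
Proof. by move=> /consts_ordge1 f1; rewrite {1}[f]rstripE f1 add0r. Qed.

Lemma lstrip_idem a f : idem K Q (tgt Q a) * lstrip a f = lstrip a f.
Proof.
apply: coefP => x s; rewrite coef_idemM coef_lstrip.
by case: (x == _); rewrite ?mul1r ?mul0r.
Qed.

Lemma rstrip_idem a f : rstrip a f * idem K Q (src Q a) = rstrip a f.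
Proof.
apply: coefP => x s; rewrite coefM_idem coef_rstrip.
by case: (_ == _); rewrite ?mul1r ?mul0r.
Qed.

Lemma lstripM a f g : lstrip a (f * g) =
  lstrip a f * g + coef f (src Q a) [::] *: lstrip a g.
Proof.
apply: coefP => x s; rewrite coefD coefZ coefM !coef_lstrip coefM_cons.
case: eqP => [->|xa]; last first.
  rewrite mulr0 addr0 big1 // => i _.
  by rewrite coef_lstrip (introF eqP xa) mul0r.
rewrite addrC; congr (_ + _); apply: eq_bigr => i _.
by rewrite coef_lstrip eqxx.
Qed.

Lemma lstripD a f g : lstrip a (f + g) = lstrip a f + lstrip a g.
Proof.
apply: coefP => x s; rewrite !(coefD, coef_lstrip).
by case: ifP; rewrite ?addr0.
Qed.

Lemma lstripZ a k f : lstrip a (k *: f) = k *: lstrip a f.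
Proof.
apply: coefP => x s; rewrite !(coefZ, coef_lstrip).
by case: ifP; rewrite ?mulr0.
Qed.

Lemma lstrip0 a : lstrip a 0 = 0.
Proof. by apply: coefP => x s; rewrite coef_lstrip !coef0 if_same. Qed.

Lemma lstrip_sum a I (r : seq I) (P : pred I) (F : I -> A) :
  lstrip a (\sum_(i <- r | P i) F i) = \sum_(i <- r | P i) lstrip a (F i).
Proof. exact: (big_morph _ (lstripD a) (lstrip0 a)). Qed.

Lemma lstrip_arrow a b :
  lstrip a (arrow_elt K b) = (a == b)%:R *: idem K Q (tgt Q a).
Proof.
apply: coefP => x s; rewrite coef_lstrip coefZ coef_arrow coef_idem eqseq_cons.
case: (eqVneq a b) => [->|_]; last by rewrite andbF mul0r if_same.
by rewrite eqxx mul1r; case: eqP.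
Qed.

Lemma lstrip_constM a v : lstrip a (idem K Q v) = 0.
Proof. by apply: coefP => x s; rewrite coef_lstrip coef0 coef_idem andbF if_same. Qed.

Lemma rstripD a f g : rstrip a (f + g) = rstrip a f + rstrip a g.
Proof.
apply: coefP => x s; rewrite !(coefD, coef_rstrip).
by case: ifP; rewrite ?addr0.
Qed.

Lemma rstrip0 a : rstrip a 0 = 0.
Proof. by apply: coefP => x s; rewrite coef_rstrip !coef0 if_same. Qed.

Lemma rstrip_sum a I (r : seq I) (P : pred I) (F : I -> A) :
  rstrip a (\sum_(i <- r | P i) F i) = \sum_(i <- r | P i) rstrip a (F i).
Proof. exact: (big_morph _ (rstripD a) (rstrip0 a)). Qed.

Lemma rstrip_arrow a b :
  rstrip a (arrow_elt K b) = (a == b)%:R *: idem K Q (src Q a).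
Proof.
apply: coefP => x s; rewrite coef_rstrip coefZ coef_arrow coef_idem.
rewrite -[[:: b]]/(rcons [::] b) eqseq_rcons.
case: (eqVneq a b) => [<-|_]; last by rewrite !andbF mul0r if_same.
rewrite andbT mul1r; case: s => [|c s]; first by rewrite /wend /= !andbT; case: eqP.
by rewrite !andbF if_same.
Qed.

Lemma rstripM a f g : ordge 1 g -> rstrip a (f * g) = f * rstrip a g.
Proof.
move=> /ordge1P g1; apply: coefP => x s; rewrite coefM coef_rstrip coefM size_rcons.
rewrite big_ord_recr /= (@drop_oversize _ (size s).+1) ?size_rcons // g1 mulr0 addr0.
case: ifP => sE.
  apply: eq_bigr => i _; rewrite coef_rstrip -wend_cat cat_take_drop sE.
  have iS : (i <= size s)%N by rewrite -ltnS.
  by rewrite drop_rcons // -[rcons s a]cats1 takel_cat.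
rewrite big1 // => i _.
by rewrite coef_rstrip -wend_cat cat_take_drop sE mulr0.
Qed.

End Coefficients.

(** * Homomorphisms and quotients *)

Lemma rmorphism_of (A B : pzRingType) (f : A -> B) :
  zmod_morphism f -> monoid_morphism f -> exists h : {rmorphism A -> B}, h =1 f.
Proof.
move=> fz fm.
pose h : {rmorphism A -> B} := HB.pack f
  (GRing.isZmodMorphism.Build A B f fz) (GRing.isMonoidMorphism.Build A B f fm).
by exists h.
Qed.

Lemma alg_iso_inv (K : pzRingType) (A B : kalg K) (f : {rmorphism A -> B}) :
  alg_iso f -> exists g : {rmorphism B -> A},
    [/\ alg_iso g, cancel f g & cancel g f].
Proof.
move=> [fk [g fK gK]].
have [h hE] : exists h : {rmorphism B -> A}, h =1 g.
  apply: rmorphism_of.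
    by move=> x y; apply: (can_inj fK); rewrite rmorphB !gK.
  by split=> [|x y]; apply: (can_inj fK); rewrite ?rmorph1 ?rmorphM !gK.
exists h; split; last 2 first.
- by move=> x; rewrite hE fK.
- by move=> x; rewrite hE gK.
split; first by move=> k; rewrite hE -fk fK.
by exists f => x; rewrite hE ?fK ?gK.
Qed.

Lemma quot_pi0 (A : pzRingType) (I : ideal A) x : quot_pi I x = 0 <-> I x.
Proof. by rewrite -(rmorph0 (quot_pi I)) quot_pi_eq subr0. Qed.

Lemma quot_iso (K : pzRingType) (A B : kalg K) (I : ideal A) (J : ideal B)
    (f : {rmorphism A -> B}) (g : {rmorphism B -> A}) :
  (forall k, f (kalg_str A k) = kalg_str B k) ->
  (forall x, I x -> J (f x)) -> (forall y, J y -> I (g y)) ->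
  (forall x, I (x - g (f x))) -> (forall y, J (y - f (g y))) ->
  isomorphic (quot_kalg I) (quot_kalg J).
Proof.
move=> fk fI gJ gf fg.
pose F (q : quotalg I) : quotalg J := quot_pi J (f (quot_repr q)).
pose G (q : quotalg J) : quotalg I := quot_pi I (g (quot_repr q)).
have FE x : F (quot_pi I x) = quot_pi J (f x).
  by apply/quot_pi_eq; rewrite -rmorphB; apply/fI/quot_pi_eq; rewrite quot_reprK.
have GE x : G (quot_pi J x) = quot_pi I (g x).
  by apply/quot_pi_eq; rewrite -rmorphB; apply/gJ/quot_pi_eq; rewrite quot_reprK.
have [h hE] : exists h : {rmorphism quotalg I -> quotalg J}, h =1 F.
  apply: rmorphism_of.
    move=> p q; rewrite -[p]quot_reprK -[q]quot_reprK -rmorphB !FE.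
    by rewrite !rmorphB.
  split=> [|p q]; first by rewrite -(rmorph1 (quot_pi I)) FE !rmorph1.
  rewrite -[p]quot_reprK -[q]quot_reprK -rmorphM !FE.
  by rewrite !rmorphM.
exists h; split=> [k|]; first by rewrite hE /= FE fk.
exists G => q; rewrite hE -[q]quot_reprK.
  by rewrite FE GE; apply/quot_pi_eq; rewrite -opprB -mulN1r; apply: idealMl.
by rewrite GE FE; apply/quot_pi_eq; rewrite -opprB -mulN1r; apply: idealMl.
Qed.

(** * Closed ideals, units and characters *)

Section ClosedIdeals.
Variables (K : fieldType) (V : finType) (Q : quiver V).
Local Notation A := (cpalg K Q).
Implicit Types (f g : A).

(** Stated for predicates, so that preimages of closed ideals and the powers
    of the radical are covered without building an ideal. *)
Record is_closed (I : A -> Prop) : Prop := IsClosed {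
  ci0 : I 0 ;
  ciD : forall f g, I f -> I g -> I (f + g) ;
  ciMl : forall a f, I f -> I (a * f) ;
  ciMr : forall a f, I f -> I (f * a) ;
  ciC : forall f, (forall n, exists2 g, I g & ordge n (f - g)) -> I f
}.

Lemma ciN I f : is_closed I -> I f -> I (- f).
Proof. by move=> cI If; rewrite -mulN1r; apply: ciMl. Qed.

Lemma ciB I f g : is_closed I -> I f -> I g -> I (f - g).
Proof. by move=> cI If Ig; apply: ciD => //; apply: ciN. Qed.

Lemma ciZ I k f : is_closed I -> I f -> I (k *: f).
Proof. by move=> cI If; rewrite -(mul1r f) -cp_scalerAl; apply: ciMl. Qed.

Lemma ci_sum I T (r : seq T) (P : pred T) (F : T -> A) : is_closed I ->
  (forall i, P i -> I (F i)) -> I (\sum_(i <- r | P i) F i).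
Proof.
move=> cI IF; elim/big_ind: _ => //; first exact: ci0.
by move=> x y; apply: ciD.
Qed.

Lemma adicP (S : set A) f : adic_closure S f <->
  forall n, exists2 g, S g & ordge n (f - g).
Proof.
split=> H n; have [g Sg fg] := H n; exists g => //.
  by move=> x s sn; rewrite coefB (coef_agree fg) ?subrr.
by move=> p pn; apply/eqP; rewrite -subr_eq0 !coefE -coefB fg.
Qed.

Lemma closed_ideal_closed (S : set A) : is_closed (closed_ideal S).
Proof.
split; [exact: ideal0 | exact: idealD | exact: idealMl | exact: idealMr |].
move=> f H; apply/adicP => n; have [g /adicP/(_ n)[g' Sg' gg'] fg] := H n.
by exists g' => //; apply: ordge_trans gg'.
Qed.

Lemma ideal_span_gen (S : set A) f : S f -> ideal_span S f.
Proof.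
move=> Sf; exists 1%N, (fun=> 1), (fun=> f), (fun=> 1); split=> //.
by rewrite big_ord1 mul1r mulr1.
Qed.

Lemma closed_ideal_gen (S : set A) f : S f -> closed_ideal S f.
Proof.
move=> Sf; apply/adicP => n; exists f; first exact: ideal_span_gen.
by rewrite subrr; apply: ordge_0.
Qed.

Lemma closed_ideal_min (S : set A) I : is_closed I -> (forall f, S f -> I f) ->
  forall f, closed_ideal S f -> I f.
Proof.
move=> cI SI f /adicP H; apply: (ciC cI) => n.
have [g [m [u [s [v [Ss ->]]]]] fg] := H n; eexists; last exact: fg.
apply: (@ci_sum I _ _ _ _ cI) => i _; apply: (ciMr cI); apply: (ciMl cI); exact/SI/Ss.
Qed.

Lemma zero_closed : is_closed (fun f => f = 0).
Proof.
split=> // [f g -> ->|a f ->|a f ->|f H]; rewrite ?addr0 ?mulr0 ?mul0r //.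
by apply: ordge_eq => n; have [g ->] := H n.
Qed.

Lemma ordge_closed n : is_closed (ordge n).
Proof.
split=> [|f g|a f|a f|f H]; [exact: ordge_0| exact: ordgeD|exact: ordgeMr| exact: ordgeMl|].
by have [g gn /ordgeD/(_ gn)] := H n; rewrite subrK.
Qed.

(** The inverse is the geometric series. Left and right inverses are obtained
    separately as fixed points, and coincide by associativity. *)
Lemma geometric (j : A) : ordge 1 j ->
  exists w : A, w * (1 - j) = 1 /\ (1 - j) * w = 1.
Proof.
move=> j1.
have L : exists w : A, w = 1 + j * w.
  pose u n := iter n (fun x => 1 + j * x) (0 : A).
  have cu n : ordge n (u n.+1 - u n).
    elim: n => [//|n IHn]; rewrite /u !iterS opprD addrACA subrr add0r -mulrBr.
    exact: (@ordgeM _ _ _ 1 n).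
  exists (lim u); apply: ordge_eq => n.
  apply: (@ordge_trans _ _ _ n _ (u n.+1)).
    by apply: (@ordge_le _ _ _ n n.+1) => //; apply: limP.
  rewrite /u iterS opprD addrACA subrr add0r -mulrBr; apply: ordgeMr.
  by apply: ordge_sym; apply: limP.
have R : exists w : A, w = 1 + w * j.
  pose u n := iter n (fun x => 1 + x * j) (0 : A).
  have cu n : ordge n (u n.+1 - u n).
    elim: n => [//|n IHn]; rewrite /u !iterS opprD addrACA subrr add0r -mulrBl.
    by rewrite -addn1; exact: (@ordgeM _ _ _ n 1).
  exists (lim u); apply: ordge_eq => n.
  apply: (@ordge_trans _ _ _ n _ (u n.+1)).
    by apply: (@ordge_le _ _ _ n n.+1) => //; apply: limP.
  rewrite /u iterS opprD addrACA subrr add0r -mulrBl; apply: ordgeMl.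
  by apply: ordge_sym; apply: limP.
have [w wE] := L; have [w' w'E] := R.
have wl : (1 - j) * w = 1 by rewrite mulrBl mul1r {1}wE addrK.
have wr : w' * (1 - j) = 1 by rewrite mulrBr mulr1 {1}w'E addrK.
have ww : w = w' by rewrite -(mul1r w) -wr -mulrA wl mulr1.
by exists w; rewrite {1}ww.
Qed.

Lemma unit_of (u : A) : (forall v, coef u v [::] = 1) ->
  exists w : A, w * u = 1 /\ u * w = 1.
Proof.
move=> u1; have [|w] := @geometric (1 - u); last by rewrite subKr; exists w.
by apply/ordge1P => v; rewrite coefB coef_1 u1 subrr.
Qed.

Lemma consts_sub f : ordge 1 (f - consts f).
Proof. by apply/ordge1P => v; rewrite coefB coef_consts mul1r subrr. Qed.

(** If chi j were a nonzero scalar c, the character would kill 1 - j / c,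
    which is a unit. *)
Lemma character_rad (chi : {rmorphism A -> K}) (j : A) :
  (forall k f, chi (k *: f) = k * chi f) -> ordge 1 j -> chi j = 0.
Proof.
move=> chiZ j1; apply/eqP/negPn/negP => lj.
have [w [_]] := geometric (ordgeZ (chi j)^-1 j1).
move/(congr1 chi); rewrite rmorphM rmorphB rmorph1 chiZ mulVf // subrr mul0r.
by move/eqP; rewrite eq_sym oner_eq0.
Qed.

(** A character factors through the constant parts, and exactly one of the
    orthogonal idempotents idem v can have a nonzero image in a field. *)
Lemma character_vertex (chi : {rmorphism A -> K}) :
  (forall k f, chi (k *: f) = k * chi f) ->
  exists v, forall f, chi f = coef f v [::].
Proof.
move=> chiZ.
have chiE f : chi f = \sum_v coef f v [::] * chi (idem K Q v).
  rewrite -[in LHS](subrK (consts f) f) rmorphD character_rad //; last first.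
    exact: consts_sub.
  by rewrite add0r rmorph_sum; apply: eq_bigr => v _; rewrite /= chiZ.
have [v cv] : exists v, chi (idem K Q v) != 0.
  apply: contrapT => /forallNP N.
  have := rmorph1 chi; rewrite -sum_idem rmorph_sum big1 => [|v _].
    by move/eqP; rewrite eq_sym oner_eq0.
  by apply/eqP/negPn/negP/N.
have cv1 : chi (idem K Q v) = 1.
  by apply: (mulfI cv); rewrite mulr1 -rmorphM idem_mul.
exists v => f; rewrite chiE (bigD1 v) //= cv1 mulr1 big1 ?addr0 // => w wv.
suff -> : chi (idem K Q w) = 0 by rewrite mulr0.
by rewrite -(mul1r (chi _)) -cv1 -rmorphM idemM eq_sym (negPf wv) scale0r rmorph0.
Qed.

End ClosedIdeals.

(** * Continuous homomorphisms *)

Section ContinuousHoms.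
Variables (K : fieldType) (V V' : finType) (Q : quiver V) (Q' : quiver V').
Local Notation A := (cpalg K Q).
Local Notation B := (cpalg K Q').
Variable sigma : V -> V'.

(** Mapping arrows into the radical makes h continuous, by ch_ord; so h is
    determined by its values on idempotents and arrows. *)
Record cont_hom (h : {rmorphism A -> B}) : Prop := ContHom {
  chZ : forall k f, h (k *: f) = k *: h f ;
  chI : forall v, h (idem K Q v) = idem K Q' (sigma v) ;
  chJ : forall a, ordge 1 (h (arrow_elt K a))
}.

Lemma chE h f : cont_hom h -> h f = \sum_v coef f v [::] *: idem K Q' (sigma v) +
  \sum_a h (arrow_elt K a) * h (lstrip a f).
Proof.
move=> ch; rewrite {1}[f]lstripE rmorphD /= !rmorph_sum /=; congr (_ + _).
  by apply: eq_bigr => v _; rewrite (chZ ch) (chI ch).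
by apply: eq_bigr => a _; rewrite rmorphM.
Qed.

Lemma ch_ord h n f : cont_hom h -> ordge n f -> ordge n (h f).
Proof.
move=> ch; elim: n f => [//|n IHn] f fn.
rewrite [f]lstripE1; last exact: ordge_le fn.
rewrite rmorph_sum; apply: ordge_sum => a _ /=; rewrite rmorphM.
by apply: (@ordgeM _ _ _ 1 n); [exact: chJ|apply/IHn/ordge_lstrip].
Qed.

Lemma ch_closed h I : cont_hom h -> is_closed I -> is_closed (fun f => I (h f)).
Proof.
move=> ch cI; split=> [|f g If Ig|a f If|a f If|f H].
- by rewrite rmorph0; apply: ci0.
- by rewrite rmorphD; apply: ciD.
- by rewrite rmorphM; apply: ciMl.
- by rewrite rmorphM; apply: ciMr.
apply: (ciC cI) => n; have [g Ig fg] := H n; exists (h g) => //.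
by rewrite -rmorphB; apply: ch_ord.
Qed.

(** The difference g f - h f is the sum over the arrows a of
    (g a - h a) g (f_a) + h a (g (f_a) - h (f_a)) with f_a := lstrip a f: the
    first term lies in I, and the second gains one in order. *)
Lemma ch_ext_mod g h I : cont_hom g -> cont_hom h -> is_closed I ->
  (forall a, I (g (arrow_elt K a) - h (arrow_elt K a))) ->
  forall f, I (g f - h f).
Proof.
move=> cg ch cI gh f; apply: (ciC cI) => n.
elim: n f => [|n IHn] f; first by exists 0; [apply: ci0|].
have rE a : exists r, I r /\ ordge n (g (lstrip a f) - h (lstrip a f) - r).
  by have [r] := IHn (lstrip a f); exists r.
have [r rP] := choice rE.
exists (\sum_a ((g (arrow_elt K a) - h (arrow_elt K a)) * g (lstrip a f)
        + h (arrow_elt K a) * r a)).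
  apply: ci_sum => // a _; apply: ciD => //; first exact: ciMr.
  by apply: ciMl => //; have [] := rP a.
rewrite (chE _ cg) (chE _ ch) opprD addrACA subrr add0r -!sumrB.
apply: ordge_sum => a _.
have [_ ra] := rP a.
set x := g _; set y := h _; set u := g _; set v := h _.
have -> : x * u - y * v - ((x - y) * u + y * r a) = y * (u - v - r a).
  by rewrite !mulrBr mulrBl opprD opprB addrA [x * u - _ + _]addrC addrA subrK.
by apply: (@ordgeM _ _ _ 1 n); [exact: chJ|exact: ra].
Qed.

Lemma ch_ext g h : cont_hom g -> cont_hom h ->
  (forall a, g (arrow_elt K a) = h (arrow_elt K a)) -> g =1 h.
Proof.
move=> cg ch gh f; apply/eqP; rewrite -subr_eq0; apply/eqP.
apply: (ch_ext_mod cg ch (@zero_closed K V' Q') _ f) => a.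
by rewrite gh subrr.
Qed.

(** The recursion of chE is contracting, since arrows go to the radical; this
    identifies maps given by explicit coefficients with homomorphisms. *)
Lemma ch_fixpoint h (F : A -> B) : cont_hom h ->
  (forall f, F f = \sum_v coef f v [::] *: idem K Q' (sigma v) +
     \sum_a h (arrow_elt K a) * F (lstrip a f)) -> F =1 h.
Proof.
move=> ch FE f; apply: ordge_eq => n; elim: n f => [//|n IHn] f.
rewrite FE (chE _ ch) opprD addrACA subrr add0r -sumrB; apply: ordge_sum => a _.
by rewrite -mulrBr; apply: (@ordgeM _ _ _ 1 n); [exact: chJ|exact: IHn].
Qed.

Section Universal.
Variable y : arr Q -> B.
Hypotheses (sbij : bijective sigma) (yJ : forall a, ordge 1 (y a)).
Hypothesis yl : forall a, idem K Q' (sigma (src Q a)) * y a = y a.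
Hypothesis yr : forall a, y a * idem K Q' (sigma (tgt Q a)) = y a.

(** Stage n of the homomorphism sending a to y a: paths of length at least n
    are dropped. *)
Fixpoint happrox (n : nat) (f : A) : B :=
  if n is m.+1 then \sum_v coef f v [::] *: idem K Q' (sigma v) +
    \sum_a y a * happrox m (lstrip a f) else 0.

Let H f := lim (happrox ^~ f).

Let HE f : H f = \sum_v coef f v [::] *: idem K Q' (sigma v) +
  \sum_a y a * H (lstrip a f).
Proof.
have cH g n : ordge n (happrox n.+1 g - happrox n g).
  elim: n g => [//|n IHn] g.
  rewrite [happrox n.+2 g]/= [happrox n.+1 g]/=.
  rewrite opprD addrACA subrr add0r -sumrB; apply: ordge_sum => a _.
  by rewrite -mulrBr; apply: (@ordgeM _ _ _ 1 n); [|exact: IHn].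
apply: ordge_eq => n; apply: (@ordge_trans _ _ _ n _ (happrox n.+1 f)).
  by apply: (@ordge_le _ _ _ n n.+1) => //; apply: limP (cH f) _.
rewrite /= opprD addrACA subrr add0r -sumrB; apply: ordge_sum => a _.
rewrite -mulrBr; apply: ordgeMr; apply: ordge_sym.
exact: limP (cH _) _.
Qed.

Let Hlin k f g : H (k *: f + g) = k *: H f + H g.
Proof.
apply: ordge_eq => n; elim: n f g => [//|n IHn] f g.
rewrite (HE (_ + _)) (HE f) (HE g) scalerDr addrACA opprD addrACA.
rewrite !scaler_sumr -!big_split -!sumrB /= big1 ?add0r => [|v _]; last first.
  by rewrite coefD coefZ scalerDl scalerA subrr.
apply: ordge_sum => a _; rewrite -cp_scalerAr -mulrDr -mulrBr lstripD lstripZ.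
by apply: (@ordgeM _ _ _ 1 n); [exact: yJ|exact: IHn].
Qed.

Let Hidem v : H (idem K Q v) = idem K Q' (sigma v).
Proof.
rewrite HE (bigD1 v) //= coef_idem eqxx scale1r [X in _ + X + _]big1 => [|w wv].
  rewrite addr0 big1 ?addr0 // => a _; rewrite lstrip_constM.
  suff -> : H 0 = 0 by rewrite mulr0.
  by have := Hlin (-1) 0 0; rewrite scaler0 add0r scaleN1r addNr.
by rewrite coef_idem (negPf wv) scale0r.
Qed.

Let Hmul f g : H (f * g) = H f * H g.
Proof.
apply: ordge_eq => n; elim: n f g => [//|n IHn] f g.
have cE : (\sum_v coef f v [::] *: idem K Q' (sigma v)) * H g =
  (\sum_v (coef f v [::] * coef g v [::]) *: idem K Q' (sigma v)) +
  \sum_a coef f (src Q a) [::] *: (y a * H (lstrip a g)).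
  rewrite HE mulrDr !mulr_suml; congr (_ + _).
    apply: eq_bigr => v _; rewrite cp_scalerAl mulr_sumr (bigD1 v) //= big1 => [|w wv].
      by rewrite addr0 cp_scalerAr idem_mul scalerA.
    by rewrite cp_scalerAr idemM (inj_eq (bij_inj sbij)) eq_sym (negPf wv) scale0r scaler0.
  under eq_bigr do rewrite mulr_sumr.
  rewrite exchange_big; apply: eq_bigr => a _ /=.
  rewrite (bigD1 (src Q a)) //= big1 => [|w wv].
    by rewrite addr0 cp_scalerAl mulrA yl.
  by rewrite cp_scalerAl -yl -mulrA mulrA idemM (inj_eq (bij_inj sbij)) (negPf wv)
    scale0r mul0r scaler0.
have -> : H (f * g) = \sum_v (coef f v [::] * coef g v [::]) *: idem K Q' (sigma v)
    + \sum_a y a * H (lstrip a (f * g)).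
  by rewrite HE; congr (_ + _); apply: eq_bigr => v _; rewrite coefM_nil.
rewrite (HE f) mulrDl cE -[X in _ - X]addrA opprD addrACA subrr add0r mulr_suml.
rewrite -big_split -sumrB; apply: ordge_sum => a _ /=.
rewrite -mulrA -cp_scalerAr -mulrDr -mulrBr.
apply: (@ordgeM _ _ _ 1 n); first exact: yJ.
rewrite lstripM [_ + _ *: _]addrC Hlin opprD addrACA subrr add0r.
exact: IHn.
Qed.

(** Any assignment of arrows to elements of the radical with the right ends
    extends. *)
Lemma hom_exists : exists2 h : {rmorphism A -> B},
  cont_hom h & forall a, h (arrow_elt K a) = y a.
Proof.
have H0 : H 0 = 0 by have := Hlin (-1) 0 0; rewrite scaler0 add0r scaleN1r addNr.
have [h hE] : exists h : {rmorphism A -> B}, h =1 H.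
  apply: rmorphism_of.
    by move=> f g; rewrite -scaleN1r addrC Hlin scaleN1r addrC.
  split=> [|f g]; last exact: Hmul.
  have -> : (1 : A) = consts 1 by apply: coefP => x s; rewrite coef_consts !coef_1 mulr1.
  rewrite HE [X in _ + X]big1 => [|a _]; last first.
    rewrite /consts lstrip_sum big1 ?H0 ?mulr0 // => v _.
    by rewrite lstripZ lstrip_constM scaler0.
  rewrite addr0 -(sum_idem K Q') (reindex _ (onW_bij _ sbij)) /=.
  by apply: eq_bigr => v _; rewrite coef_consts coef_1 mulr1 scale1r.
have ha a : h (arrow_elt K a) = y a.
  rewrite hE HE big1 => [|v _]; last by rewrite coef_arrow andbF scale0r.
  rewrite add0r (bigD1 a) //= lstrip_arrow eqxx scale1r Hidem yr big1 ?addr0 //.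
  by move=> b ba; rewrite lstrip_arrow (negPf ba) scale0r H0 mulr0.
exists h => //; split=> [k f|v|a]; last by rewrite ha.
  by rewrite !hE -[k *: f]addr0 Hlin H0 addr0.
by rewrite hE Hidem.
Qed.

End Universal.
End ContinuousHoms.

Section Composition.
Variable K : fieldType.

Lemma cont_hom_idfun (V : finType) (Q : quiver V) :
  cont_hom id (idfun : {rmorphism cpalg K Q -> cpalg K Q}).
Proof. by split=> // a; apply: ordge_arrow. Qed.

Lemma cont_hom_comp (U V V' : finType) (R : quiver U) (Q : quiver V) (Q' : quiver V')
    (s : U -> V) (t : V -> V') (r : U -> V')
    (f : {rmorphism cpalg K R -> cpalg K Q}) (g : {rmorphism cpalg K Q -> cpalg K Q'}) :
  cont_hom s f -> cont_hom t g -> t \o s =1 r ->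
  cont_hom r (g \o f : {rmorphism cpalg K R -> cpalg K Q'}).
Proof.
move=> cf cg tsr; split=> [c x|v|a] /=.
- by rewrite (chZ cf) (chZ cg).
- by rewrite (chI cf) (chI cg) -tsr.
by apply/(ch_ord cg)/(chJ cf).
Qed.

Lemma ch_nil (V : finType) (Q Q' : quiver V)
    (h : {rmorphism cpalg K Q -> cpalg K Q'}) f v :
  cont_hom id h -> coef (h f) v [::] = coef f v [::].
Proof.
move=> ch; rewrite (chE _ ch) coefD coef_sum (bigD1 v) //= coefZ coef_idem eqxx mulr1.
rewrite big1 => [|w wv]; last by rewrite coefZ coef_idem eq_sym (negPf wv) mulr0.
rewrite coef_sum big1 ?addr0 // => a _.
by have /ordge1P ha := chJ ch a; rewrite coefM_nil ha mul0r.
Qed.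

End Composition.

(** * Cyclic derivatives *)

Lemma sum_triangle (R : nmodType) n (F : nat -> nat -> R) :
  \sum_(i < n.+1) \sum_(j < i.+1) F j (i - j)%N =
  \sum_(j < n.+1) \sum_(k < (n - j).+1) F j k.
Proof.
elim: n => [|n IHn]; first by rewrite !big_ord1.
rewrite big_ord_recr /= IHn [RHS]big_ord_recr /= subnn big_ord1.
rewrite [X in _ + X]big_ord_recr /= subnn addrA; congr (_ + _).
rewrite -big_split; apply: eq_bigr => j _ /=.
by rewrite subSn ?[RHS]big_ord_recr // -ltnS.
Qed.

Section CyclicDerivatives.
Variables (K : fieldType) (V : finType) (Q : quiver V).
Local Notation A := (cpalg K Q).
Implicit Types (f g w y z : A) (v x : V) (s t u : seq (arr Q)) (a b c : arr Q).

Definition rsuffix t f : A := of_coef (fun v u => coef f v (u ++ t)).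

Lemma coef_rsuffix t f v u : coef (rsuffix t f) v u = coef f v (u ++ t).
Proof.
rewrite coef_of; case: ifPn => // nw.
by rewrite coef_notwalk // walk_cat (negPf nw).
Qed.

Lemma rsuffixM b t f g : rsuffix (b :: t) (f * g) = f * rsuffix (b :: t) g +
  \sum_(j < (size t).+1) coef g (wend (tgt Q b) (take j t)) (drop j t)
     *: rsuffix (b :: take j t) f.
Proof.
apply: coefP => v u; rewrite coef_rsuffix coefD coef_sum !coefM size_cat /=.
rewrite -addSn big_split_ord /=; congr (_ + _); apply: eq_bigr => i _ /=.
  have iu : (i <= size u)%N by rewrite -ltnS.
  rewrite coef_rsuffix takel_cat // drop_cat; case: ltngtP iu => // -> _.
  by rewrite subnn drop0 drop_size.
rewrite coefZ coef_rsuffix -[(size u).+1](size_rcons u b) -!cat_rcons.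
rewrite take_cat drop_cat ltnNge leq_addr /= addKn wend_cat mulrC.
by rewrite {2}/wend map_rcons last_rcons.
Qed.

(** The bilinear operation replacing each occurrence p b q in the paths of f
    by q y p: the coefficient at s comes from the factorizations of s as q y p,
    where q is take i s and y p is drop i s. For y = 1 it is the cyclic
    derivative. *)
Definition cD b f y : A := of_coef (fun v s =>
  if v == tgt Q b then
    \sum_(i < (size s).+1) coef (y * rsuffix (b :: take i s) f)
        (wend v (take i s)) (drop i s)
  else 0).

Lemma coef_cD b f y v s : coef (cD b f y) v s =
  if v == tgt Q b then
    \sum_(i < (size s).+1) coef (y * rsuffix (b :: take i s) f)
        (wend v (take i s)) (drop i s)
  else 0.
Proof.
rewrite coef_of; case: ifPn => // nw; case: eqP => // vb.
rewrite big1 // => i _.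
move: nw; rewrite -{1}(cat_take_drop i s) walk_cat negb_and.
case/orP=> nw; last by rewrite coef_notwalk.
suff -> : rsuffix (b :: take i s) f = 0 by rewrite mulr0 coef0.
apply: coefP => x u; rewrite coef_rsuffix coef0 coef_notwalk //.
by rewrite walk_cat /= -vb (negPf nw) !andbF.
Qed.

Lemma rsuffixD t f g : rsuffix t (f + g) = rsuffix t f + rsuffix t g.
Proof. by apply: coefP => v u; rewrite !(coefD, coef_rsuffix). Qed.

Lemma rsuffixZ t k f : rsuffix t (k *: f) = k *: rsuffix t f.
Proof. by apply: coefP => v u; rewrite !(coefZ, coef_rsuffix). Qed.

Lemma cDDl b f g y : cD b (f + g) y = cD b f y + cD b g y.
Proof.
apply: coefP => v s; rewrite coefD !coef_cD; case: ifP; rewrite ?addr0 // => _.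
by rewrite -big_split; apply: eq_bigr => i _; rewrite rsuffixD mulrDr coefD.
Qed.

Lemma cDZl b k f y : cD b (k *: f) y = k *: cD b f y.
Proof.
apply: coefP => v s; rewrite coefZ !coef_cD; case: ifP; rewrite ?mulr0 // => _.
by rewrite mulr_sumr; apply: eq_bigr => i _; rewrite rsuffixZ cp_scalerAr coefZ.
Qed.

Lemma cDDr b f y z : cD b f (y + z) = cD b f y + cD b f z.
Proof.
apply: coefP => v s; rewrite coefD !coef_cD; case: ifP; rewrite ?addr0 // => _.
by rewrite -big_split; apply: eq_bigr => i _; rewrite mulrDl coefD.
Qed.

Lemma cDZr b k f y : cD b f (k *: y) = k *: cD b f y.
Proof.
apply: coefP => v s; rewrite coefZ !coef_cD; case: ifP; rewrite ?mulr0 // => _.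
by rewrite mulr_sumr; apply: eq_bigr => i _; rewrite cp_scalerAl coefZ.
Qed.

Lemma cD0l b y : cD b 0 y = 0.
Proof. by rewrite -(scale0r 0) cDZl !scale0r. Qed.

Lemma cD0r b f : cD b f 0 = 0.
Proof. by rewrite -(scale0r 0) cDZr !scale0r. Qed.

Lemma cDNl b f y : cD b (- f) y = - cD b f y.
Proof. by rewrite -scaleN1r cDZl scaleN1r. Qed.

Lemma cDNr b f y : cD b f (- y) = - cD b f y.
Proof. by rewrite -scaleN1r cDZr scaleN1r. Qed.

Lemma cD_suml b y I (r : seq I) (P : pred I) (F : I -> A) :
  cD b (\sum_(i <- r | P i) F i) y = \sum_(i <- r | P i) cD b (F i) y.
Proof. exact: (big_morph (fun f => cD b f y) (fun f g => cDDl b f g y) (cD0l b y)). Qed.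

Lemma cD_sumr b f I (r : seq I) (P : pred I) (F : I -> A) :
  cD b f (\sum_(i <- r | P i) F i) = \sum_(i <- r | P i) cD b f (F i).
Proof. exact: (big_morph (cD b f) (cDDr b f) (cD0r b f)). Qed.

(** Leibniz rule: the arrow b is removed from f or from g, and the other
    factor joins y on the side where the rotation leaves it. *)
Lemma cDM b f g y : cD b (f * g) y = cD b f (g * y) + cD b g (y * f).
Proof.
apply: coefP => v s; rewrite coefD !coef_cD; case: eqP => [vb|_]; last by rewrite addr0.
rewrite addrC.
pose F j k := coef g (wend v (take j s)) (take k (drop j s)) *
  coef (y * rsuffix (b :: take j s) f) (wend v (take (k + j) s)) (drop (k + j) s).
have -> : \sum_(i < (size s).+1) coef (g * y * rsuffix (b :: take i s) f)
    (wend v (take i s)) (drop i s) =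
    \sum_(j < (size s).+1) \sum_(k < (size s - j).+1) F j k.
  apply: eq_bigr => j _; rewrite -mulrA coefM size_drop.
  by apply: eq_bigr => k _; rewrite /F -wend_cat drop_drop (addnC k) takeD.
rewrite -sum_triangle -big_split; apply: eq_bigr => i _ /=.
have iS : (i <= size s)%N by rewrite -ltnS.
rewrite rsuffixM mulrDr coefD mulrA; congr (_ + _).
rewrite size_takel // mulr_sumr coef_sum; apply: eq_bigr => j _.
have ji : (j <= i)%N by rewrite -ltnS.
by rewrite cp_scalerAr coefZ /F take_takel // subnK // take_drop subnK // vb.
Qed.

Lemma ordge_cD b f y m n :
  ordge m.+1 f -> ordge n y -> ordge (m + n) (cD b f y).
Proof.
move=> fm yn v s sz; rewrite coef_cD; case: ifP => // _; rewrite big1 // => i _.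
have iS : (i <= size s)%N by rewrite -ltnS.
apply: (@ordgeM _ _ _ n (m - i)) => //; last first.
  rewrite size_drop addnC ltn_subLR // addnA.
  by apply: leq_trans sz _; rewrite leq_add2r -leq_subLR.
move=> x u um; rewrite coef_rsuffix fm // size_cat /= size_takel //.
by rewrite addnS ltnS addnC -ltn_subRL.
Qed.

Lemma ordge_cDr b f y n : ordge n y -> ordge n (cD b f y).
Proof.
move=> yn v s sz; rewrite coef_cD; case: ifP => // _; rewrite big1 // => i _.
by apply: (ordgeMl _ yn); rewrite size_drop; apply: leq_ltn_trans (leq_subr _ _) sz.
Qed.

Definition avoids b f := forall v u t, coef f v (u ++ b :: t) = 0.

Lemma cD_avoids b f y : avoids b f -> cD b f y = 0.
Proof.
move=> fb; apply: coefP => v s; rewrite coef_cD coef0; case: ifP => // _.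
rewrite big1 // => i _; suff -> : rsuffix (b :: take i s) f = 0 by rewrite mulr0 coef0.
by apply: coefP => x u; rewrite coef_rsuffix coef0.
Qed.

Lemma cD_idem b v y : cD b (idem K Q v) y = 0.
Proof. by apply: cD_avoids => x [|c u] t; rewrite coef_idem andbF. Qed.

Lemma cD_consts b f y : cD b (consts f) y = 0.
Proof.
by rewrite /consts cD_suml big1 // => v _; rewrite cDZl cD_idem scaler0.
Qed.

Lemma cD_idemMl b v f y : cD b (idem K Q v * f) y = cD b f (y * idem K Q v).
Proof. by rewrite cDM cD_idem add0r. Qed.

Lemma cD_idemMr b v f y : cD b (f * idem K Q v) y = cD b f (idem K Q v * y).
Proof. by rewrite cDM cD_idem addr0. Qed.

Lemma cD_arrow b a y : cD b (arrow_elt K a) y =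
  (a == b)%:R *: (idem K Q (tgt Q b) * y * idem K Q (src Q b)).
Proof.
case: (eqVneq a b) => [->|ab]; last first.
  rewrite scale0r; apply: cD_avoids => v u t; rewrite coef_arrow.
  case: u => [|d [|d' u]]; rewrite /= !eqseq_cons ?andbF //.
  by rewrite (eq_sym b) (negPf ab) andbF.
apply: coefP => v s; rewrite coef_cD coefZ -mulrA coef_idemM mul1r.
case: eqP => vb; last by rewrite mul0r.
have rsE t : rsuffix (b :: t) (arrow_elt K b) = (t == [::])%:R *: idem K Q (src Q b).
  apply: coefP => x u; rewrite coef_rsuffix coefZ coef_arrow coef_idem.
  case: u t => [|d [|d' u]] [|d'' t] //=;
    by rewrite ?eqseq_cons ?andbF ?eqxx ?mul0r ?mulr0 ?mul1r.
rewrite big_ord_recl take0 drop0 rsE scale1r mul1r big1 ?addr0 // => i _.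
rewrite rsE; case: s i => [|d s] [i hi] //=.
by rewrite scale0r mulr0 coef0.
Qed.

Lemma cD_arrowM b a f y : cD b (arrow_elt K a * f) y =
  (a == b)%:R *: (idem K Q (tgt Q b) * (f * y) * idem K Q (src Q b)) +
  cD b f (y * arrow_elt K a).
Proof. by rewrite cDM cD_arrow. Qed.

(** The recursive form of cD: each step moves an arrow from f to y, which
    makes order arguments by induction possible. *)
Lemma cD_lstrip b f y : cD b f y =
  idem K Q (tgt Q b) * (lstrip b f * y) * idem K Q (src Q b) +
  \sum_a cD b (lstrip a f) (y * arrow_elt K a).
Proof.
rewrite {1}[f]lstripE cDDl cD_consts add0r cD_suml.
under eq_bigr do rewrite cD_arrowM.
rewrite big_split (bigD1 b) //= eqxx scale1r big1 ?addr0 // => a /negPf ->.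
by rewrite scale0r.
Qed.

Lemma ordge_arrowM n y a : ordge n y -> ordge n.+1 (y * arrow_elt K a).
Proof. by move=> yn; rewrite -addn1; apply/ordgeM/ordge_arrow. Qed.

(** Although cD b f y is an infinite sum of terms u y v, cD_lstrip writes it as
    a finite sum of such terms up to arbitrarily high order. *)
Lemma cD_closed I b f y : is_closed I -> I y -> I (cD b f y).
Proof.
move=> cI Iy; apply: (ciC cI) => n.
suff H m : forall f y, I y -> ordge m y ->
    exists2 g, I g & ordge (n + m) (cD b f y - g).
  by have [//|g Ig] := H 0%N f y Iy; rewrite addn0; exists g.
elim: n m {f y Iy} => [|n IHn] m f y Iy ym.
  by exists 0; [exact: ci0|rewrite subr0; apply: ordge_cDr].
have rE a : exists r, I r /\
    ordge (n + m.+1) (cD b (lstrip a f) (y * arrow_elt K a) - r).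
  have [||r] := IHn m.+1 (lstrip a f) (y * arrow_elt K a); last by exists r.
    exact: ciMr.
  exact: ordge_arrowM.
have [r rP] := choice rE.
exists (idem K Q (tgt Q b) * (lstrip b f * y) * idem K Q (src Q b) + \sum_a r a).
  apply: ciD => //; first by apply: ciMr => //; do 2![apply: ciMl => //].
  by apply: ci_sum => // a _; have [] := rP a.
rewrite cD_lstrip opprD addrACA subrr add0r -sumrB addSnnS.
by apply: ordge_sum => a _; have [] := rP a.
Qed.

(** The cyclic derivative. Unlike cderiv it vanishes on non-cyclic paths,
    which makes dd_cycle hold for all f and g; on potentials both agree. *)
Definition dd b f := cD b f 1.

Lemma dd_cycle b f g : dd b (f * g) = dd b (g * f).
Proof. by rewrite /dd !cDM !mulr1 !mul1r addrC. Qed.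

Lemma ddD b f g : dd b (f + g) = dd b f + dd b g.
Proof. exact: cDDl. Qed.

Lemma ddB b f g : dd b (f - g) = dd b f - dd b g.
Proof. by rewrite /dd cDDl cDNl. Qed.

Lemma ddZ b k f : dd b (k *: f) = k *: dd b f.
Proof. exact: cDZl. Qed.

Lemma dd_sum b I (r : seq I) (P : pred I) (F : I -> A) :
  dd b (\sum_(i <- r | P i) F i) = \sum_(i <- r | P i) dd b (F i).
Proof. exact: cD_suml. Qed.

Lemma ordge_dd b f n : ordge n.+1 f -> ordge n (dd b f).
Proof. by move=> fn; rewrite -[n]addn0; apply: ordge_cD. Qed.

(** Implied by cyclic equivalence, and all that Jacobian algebras see. *)
Definition dd_equiv f g := forall b, dd b f = dd b g.

Definition cyclic_elt f := forall x s, coef f x s != 0 -> wend x s = x.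

Lemma dd_cderiv f b : cyclic_elt f -> cderiv f b = dd b f.
Proof.
move=> fc; apply: coefP => v s; rewrite coef_cD coef_of.
have E i : coef (1 * rsuffix (b :: take i s) f) (wend v (take i s)) (drop i s) =
    coef f (wend v (take i s)) (drop i s ++ b :: take i s).
  by rewrite mul1r coef_rsuffix.
have vb i : walk v s ->
    coef f (wend v (take i s)) (drop i s ++ b :: take i s) != 0 -> v = tgt Q b.
  move=> vs nz; have wk : walk (wend v (take i s)) (drop i s ++ b :: take i s).
    by apply: contraNT nz => /coef_notwalk ->.
  move: vs (fc _ _ nz) wk; rewrite -{1}(cat_take_drop i s) !walk_cat wend_cat.
  case: (take i s) => [|c t]; first by rewrite /wend /= => _ <-.
  by move=> /andP[/andP[/eqP <- _] _] _ /= /and4P[_ _ /eqP].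
case: ifPn => w; case: eqP => vE //.
- by apply: eq_bigr => i _; rewrite E.
- rewrite big1 // => i _; apply/eqP/negPn/negP => nz.
  by case: vE; apply: vb nz.
rewrite big1 // => i _; rewrite E coef_notwalk //; apply: contra w.
by rewrite walk_cat /= -vE => /and3P[wu _ wt]; rewrite -(cat_take_drop i s) walk_cat wt.
Qed.

Definition path_elt v t : A := of_coef (fun x s => ((x == v) && (s == t))%:R).

(** Split off the first arrow: f is this arrow and g the rest of the path. *)
Lemma delta_cycle (p q : qpath Q) : pcyclic q -> parrs p != [::] ->
    parrs q = rot 1 (parrs p) ->
  exists f g, delta K p = f * g /\ delta K q = g * f.
Proof.
have dE (r : qpath Q) : delta K r = path_elt (pstart r) (parrs r).
  apply: funext => r'; rewrite /delta /path_elt /of_coef -(inj_eq val_inj).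
  by rewrite /pstart /parrs; case: (val r') (val r) => ? ? [].
move=> cq p0 qE; case pE : (parrs p) p0 qE => [//|a t] _.
rewrite rot1_cons => qE.
have wp : walk (pstart p) (a :: t) by rewrite -pE; apply: (valP p).
have sp := walk_start wp.
have sq : pstart q = tgt Q a.
  by have /eqP := cq; rewrite /pend qE /wend map_rcons last_rcons.
have wq : walk (tgt Q a) (rcons t a) by rewrite -sq -qE; apply: (valP q).
exists (arrow_elt K a), (path_elt (tgt Q a) t).
move: wp wq => /= /andP[_ wt]; rewrite walk_rcons wt => /= /eqP ta.
have cE v u x s : walk v u -> coef (path_elt v u) x s = ((x == v) && (s == u))%:R.
  move=> wx; rewrite coef_of; case: ifPn => // nw.
  by case: eqP => // sv; case: eqP => // yx; rewrite sv yx wx in nw.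
have w1 : walk (src Q a) (a :: t) by rewrite /= eqxx.
have w2 : walk (tgt Q a) (rcons t a) by rewrite walk_rcons wt ta eqxx.
split; apply: coefP => x s; rewrite dE ?pE ?qE ?sp ?sq cE //.
- case: s => [|b s]; first by rewrite coef_arrowM_nil andbF.
  rewrite coef_arrowM_cons cE // eqxx eqseq_cons /=.
  by case: (x == _); case: (b == a); case: (s == t); rewrite ?mulr0 ?mul0r ?mulr1.
case: (lastP s) => [|{}s b].
  by rewrite coefM_nil coef_arrow !andbF mulr0; case: (t) => [|? ?]; rewrite andbF.
rewrite coefM_arrow_rcons cE // eqseq_rcons.
case: (eqVneq x (tgt Q a)) => [->|]; last by rewrite mulr0.
case: (eqVneq s t) => [->|_]; last by rewrite mulr0.
by rewrite ta eqxx; case: (b == a); rewrite ?mul0r ?mulr1.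
Qed.

(** Cyclic derivatives kill rotations by dd_cycle and are continuous. *)
Lemma cyc_equiv_dd f g : cyc_equiv f g -> dd_equiv f g.
Proof.
move=> /adicP H b; apply/eqP; rewrite -subr_eq0 -ddB; apply/eqP.
apply: ordge_eq => n; rewrite subr0.
have [h [m [l [s [Hs hE]]]] fh] := H n.+1.
have := ordge_dd b fh; rewrite ddB hE dd_sum big1 ?subr0 // => i _.
have [p [q [_ cq p0 qE sE]]] := Hs i; have [u [v [pE qE']]] := delta_cycle cq p0 qE.
by rewrite ddZ sE pE qE' ddB dd_cycle subrr scaler0.
Qed.

End CyclicDerivatives.

(** * The chain rule *)

Section ChainRule.
Variables (K : fieldType) (V V' : finType) (Q : quiver V) (Q' : quiver V').
Variables (sigma : V -> V') (h : {rmorphism cpalg K Q -> cpalg K Q'}).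
Hypothesis ch : cont_hom sigma h.

Lemma ch_sandwich a : h (arrow_elt K a) =
  idem K Q' (sigma (src Q a)) * h (arrow_elt K a) * idem K Q' (sigma (tgt Q a)).
Proof.
by rewrite -!(chI ch) -!rmorphM idem_arrow arrow_idem.
Qed.

(** Stripping an arrow c from w turns both sides into cD b (h c) (h (w_c z))
    plus the same expression for w_c and z c, by the Leibniz rule; the second
    argument gains one in order at each step. *)
Lemma chain_rule b w z :
  cD b (h w) (h z) = \sum_a cD b (h (arrow_elt K a)) (h (cD a w z)).
Proof.
apply: ordge_eq => n.
suff H m u y : ordge m y -> ordge (n + m) (cD b (h u) (h y) -
    \sum_a cD b (h (arrow_elt K a)) (h (cD a u y))).
  by have := H 0%N w z (@ordge0 _ _ _ z); rewrite addn0.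
elim: n m {w z} u y => [|n IHn] m w z zm.
  apply: ordgeB; first by apply: ordge_cDr; exact: ch_ord ch zm.
  by apply: ordge_sum => a _; apply/ordge_cDr/(ch_ord ch)/ordge_cDr.
have -> : \sum_a cD b (h (arrow_elt K a)) (h (cD a w z)) =
   \sum_c (cD b (h (arrow_elt K c)) (h (lstrip c w * z)) +
     \sum_a cD b (h (arrow_elt K a)) (h (cD a (lstrip c w) (z * arrow_elt K c)))).
  rewrite big_split /= exchange_big -big_split; apply: eq_bigr => a _ /=.
  rewrite (cD_lstrip a w) rmorphD cDDr; congr (_ + _).
    rewrite !rmorphM /= !(chI ch) [in RHS]ch_sandwich cD_idemMr cD_idemMl.
    by rewrite !mulrA.
  by rewrite rmorph_sum cD_sumr.
rewrite {1}[w]lstripE rmorphD cDDl {1}/consts rmorph_sum cD_suml big1 => [|v _].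
  rewrite add0r rmorph_sum cD_suml -sumrB; apply: ordge_sum => c _ /=.
  rewrite rmorphM cDM -!rmorphM opprD addrACA subrr add0r.
  rewrite addSnnS; apply: IHn; exact: ordge_arrowM.
by rewrite /= (chZ ch) (chI ch) cDZl cD_idem scaler0.
Qed.

Lemma chain_rule_dd b w :
  dd b (h w) = \sum_a cD b (h (arrow_elt K a)) (h (dd a w)).
Proof. by rewrite /dd -chain_rule rmorph1. Qed.

Lemma ch_dd_equiv w w' : dd_equiv w w' -> dd_equiv (h w) (h w').
Proof.
by move=> ww b; rewrite !chain_rule_dd; apply: eq_bigr => a _; rewrite ww.
Qed.

End ChainRule.

(** * Isomorphisms of Jacobian algebras *)

Section Jacobian.
Variable K : fieldType.

Definition jac_ideal (V : finType) (Q : quiver V) (W : cpalg K Q) : ideal (cp_kalg K Q) :=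
  closed_ideal (range (fun b => dd b W)).

Lemma jacobianE (V : finType) (Q : quiver V) (W : cpalg K Q) : cyclic_elt W ->
  jacobian W = quot_kalg (jac_ideal W).
Proof.
move=> Wc; rewrite /jacobian /jac_ideal.
by rewrite (_ : cderiv W = (fun b => dd b W)) //; apply/funext => b; apply: dd_cderiv.
Qed.

Lemma jac_dd (V : finType) (Q : quiver V) (W : cpalg K Q) b : jac_ideal W (dd b W).
Proof. by apply: closed_ideal_gen; exists b. Qed.

Variables (V V' : finType) (Q : quiver V) (Q' : quiver V').
Variables (sigma : V -> V') (tau : V' -> V).

(** Only the inclusion for one direction: by the chain rule for g, each
    derivative of W = g (h W) is a combination of the g (dd b W'), hence h maps
    it into the Jacobian ideal of W'. *)
Lemma jac_map (h : {rmorphism cpalg K Q -> cpalg K Q'})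
    (g : {rmorphism cpalg K Q' -> cpalg K Q}) W W' :
  cont_hom sigma h -> cont_hom tau g -> cancel h g -> cancel g h ->
  dd_equiv (h W) W' -> forall x, jac_ideal W x -> jac_ideal W' (h x).
Proof.
move=> ch cg hK gK hW; apply: closed_ideal_min => [|_ [a _ <-]].
  by apply: (ch_closed ch); apply: closed_ideal_closed.
rewrite -[W in dd a W]hK (chain_rule_dd cg) rmorph_sum.
apply: (@ci_sum _ _ _ (jac_ideal W') _ _ _ _ (closed_ideal_closed _)) => b _ /=.
apply: (@cD_closed _ _ _ (fun x => jac_ideal W' (h x))).
  by apply: (ch_closed ch); apply: closed_ideal_closed.
by rewrite gK hW; apply: jac_dd.
Qed.

Lemma cpalg_iso (h : {rmorphism cpalg K Q -> cpalg K Q'})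
    (g : {rmorphism cpalg K Q' -> cpalg K Q})
    (I : ideal (cp_kalg K Q)) (I' : ideal (cp_kalg K Q')) :
  cont_hom sigma h ->
  (forall x, I x -> I' (h x)) -> (forall y, I' y -> I (g y)) ->
  (forall x, I (x - g (h x))) -> (forall y, I' (y - h (g y))) ->
  isomorphic (quot_kalg I) (quot_kalg I').
Proof.
move=> ch; apply: (@quot_iso _ (cp_kalg K Q) (cp_kalg K Q') I I' h g) => k.
by rewrite /= /cp_str (chZ ch) rmorph1.
Qed.

End Jacobian.

Section JacobianIso.
Variables (K : fieldType) (V V' : finType) (Q : quiver V) (Q' : quiver V').

Lemma jac_iso sigma tau (h : {rmorphism cpalg K Q -> cpalg K Q'})
    (g : {rmorphism cpalg K Q' -> cpalg K Q}) W W' :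
  cont_hom sigma h -> cont_hom tau g -> cancel h g -> cancel g h ->
  dd_equiv (h W) W' -> cyclic_elt W -> cyclic_elt W' ->
  isomorphic (jacobian W) (jacobian W').
Proof.
move=> ch cg hK gK hW cW cW'; rewrite !jacobianE //.
have gW : dd_equiv (g W') W.
  move=> b; rewrite -[W in RHS]hK; apply: (ch_dd_equiv cg) => {}b.
  by rewrite hW.
apply: (cpalg_iso (g := g) ch) => [x|y|x|y].
- exact: jac_map ch cg hK gK hW x.
- exact: jac_map cg ch gK hK gW y.
- by rewrite hK subrr; apply: ideal0.
by rewrite gK subrr; apply: ideal0.
Qed.

(** Composing with the character at a vertex of Q' gives a character of KQ,
    which kills the arrows; so continuity is automatic. *)
Lemma alg_iso_cont (f : {rmorphism cp_kalg K Q -> cp_kalg K Q'}) sigma :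
  alg_iso f -> (forall v, f (idem K Q v) = idem K Q' (sigma v)) ->
  cont_hom sigma (f : {rmorphism cpalg K Q -> cpalg K Q'}).
Proof.
move=> [fk _] fe.
have fZ k x : f (k *: x : cpalg K Q) = k *: (f x : cpalg K Q').
  have := fk k; rewrite /= /cp_str => fk1.
  by rewrite -[x in LHS]mul1r cp_scaleAl rmorphM /= fk1 cp_scalerAl mul1r.
split=> // a; apply/ordge1P => v.
have [chi chiE] : exists chi : {rmorphism cpalg K Q -> K},
    chi =1 fun x => coef (f x) v [::].
  apply: rmorphism_of => [x y|]; first by rewrite rmorphB coefB.
  split=> [|x y]; first by rewrite rmorph1 coef_1.
  by rewrite rmorphM coefM_nil.
rewrite -chiE; apply: character_rad; last exact: ordge_arrow.
by move=> k x; rewrite !chiE fZ coefZ.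
Qed.

End JacobianIso.

Lemma alg_iso_cont_inv (K : fieldType) (V V' : finType) (Q : quiver V) (Q' : quiver V')
    (f : {rmorphism cp_kalg K Q -> cp_kalg K Q'}) sigma tau :
  alg_iso f -> (forall v, f (idem K Q v) = idem K Q' (sigma v)) -> cancel tau sigma ->
  exists g : {rmorphism cpalg K Q' -> cpalg K Q},
    [/\ cont_hom tau g, cancel f g & cancel g f].
Proof.
move=> fi fe tK; have [g [gi fK gK]] := alg_iso_inv fi.
exists g; split=> //; apply: alg_iso_cont => // v.
by rewrite -[v in LHS]tK -fe fK.
Qed.

Lemma right_equiv_jac (K : fieldType) (V : finType) (Q Q' : quiver V)
    (W : cpalg K Q) (W' : cpalg K Q') :
  cyclic_elt W -> cyclic_elt W' -> right_equiv W W' ->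
  isomorphic (jacobian W) (jacobian W').
Proof.
move=> cW cW' [f [fi fe fW]].
have cf := alg_iso_cont (sigma := id) fi fe.
have [g [cg fK gK]] := alg_iso_cont_inv (tau := id) fi fe (fun=> erefl).
exact: (jac_iso cf cg fK gK (cyc_equiv_dd fW)).
Qed.

Lemma isomorphic_sym (K : pzRingType) (A B : kalg K) : isomorphic A B -> isomorphic B A.
Proof. by move=> [f /alg_iso_inv[g [gi _ _]]]; exists g. Qed.

Lemma isomorphic_trans (K : pzRingType) (A B D : kalg K) :
  isomorphic A B -> isomorphic B D -> isomorphic A D.
Proof.
move=> [f [fk fb]] [g [gk gb]].
exists (g \o f : {rmorphism A -> D}); split=> [k|]; first by rewrite /= fk gk.
exact: bij_comp.
Qed.

Section Sandwich.
Variables (K : fieldType) (V : finType) (Q : quiver V).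
Implicit Types (f y : cpalg K Q).

Lemma cD_idemr b f y : cD b f y * idem K Q (src Q b) = cD b f y.
Proof.
apply: coefP => v s; rewrite coefM_idem !coef_cD; case: ifP; rewrite ?mulr0 // => _.
rewrite mulr_sumr; apply: eq_bigr => i _.
have rsE t : rsuffix (b :: t) f * idem K Q (src Q b) = rsuffix (b :: t) f.
  apply: coefP => x u; rewrite coefM_idem coef_rsuffix.
  case: eqP => [_|E]; first by rewrite mul1r.
  rewrite mul0r coef_notwalk // walk_cat /= negb_and; apply/orP; right.
  by rewrite negb_and eq_sym (introF eqP E).
rewrite -[rsuffix _ _ in RHS]rsE mulrA coefM_idem -wend_cat cat_take_drop.
by [].
Qed.

Lemma cD_ideml b f y : idem K Q (tgt Q b) * cD b f y = cD b f y.
Proof.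
apply: coefP => v s; rewrite coef_idemM coef_cD.
by case: eqP => _; rewrite ?mul1r ?mulr0.
Qed.

Lemma cD_sandwich b f y :
  idem K Q (tgt Q b) * cD b f y * idem K Q (src Q b) = cD b f y.
Proof. by rewrite cD_ideml cD_idemr. Qed.

End Sandwich.

(** * Embeddings of quivers *)

Section ArrowMaps.
Variables (K : fieldType) (V : finType) (Q Q' : quiver V).

(** The partial inverse d of e takes values in words because this is the form
    in which pull receives it. *)
Record embedding (e : arr Q -> arr Q') (d : arr Q' -> option (seq (arr Q))) : Prop :=
  Embedding {
    emb_src : forall a, src Q' (e a) = src Q a ;
    emb_tgt : forall a, tgt Q' (e a) = tgt Q a ;
    emb_d : forall a, d (e a) = Some [:: a] ;
    emb_None : forall b, (forall a, b <> e a) -> d b = None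
  }.

Variables (e : arr Q -> arr Q') (d : arr Q' -> option (seq (arr Q))).
Hypothesis ed : embedding e d.

Lemma emb_inj : injective e.
Proof. by move=> a b /(congr1 d); rewrite !(emb_d ed) => -[]. Qed.

Lemma embed_exists : exists2 h : {rmorphism cpalg K Q -> cpalg K Q'},
  cont_hom id h & forall a, h (arrow_elt K a) = arrow_elt K (e a).
Proof.
apply: hom_exists => [|a|a|a]; first by exists id.
- exact: ordge_arrow.
- by rewrite -(emb_src ed) idem_arrow.
by rewrite -(emb_tgt ed) arrow_idem.
Qed.

Lemma pull_embed (h : {rmorphism cpalg K Q -> cpalg K Q'}) f : cont_hom id h ->
  (forall a, h (arrow_elt K a) = arrow_elt K (e a)) -> pull d f = h f.
Proof.
move=> ch ha; move: f; apply: (ch_fixpoint ch) => f.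
apply: coefP => x s; rewrite coefD coef_of.
rewrite -[\sum_v coef f v [::] *: _]/(\sum_v coef f v [::] *: idem K Q' v).
have cE : coef (\sum_v coef f v [::] *: idem K Q' v) x s = (s == [::])%:R * coef f x [::].
  rewrite coef_sum (bigD1 x) //= coefZ coef_idem eqxx big1 ?addr0 => [|v vx].
    by rewrite mulrC.
  by rewrite coefZ coef_idem eq_sym (negPf vx) mulr0.
rewrite {}cE coef_sum.
case: s => [|b s] /=.
  by rewrite mul1r big1 ?addr0 // => a _; rewrite ha coef_arrowM_nil.
rewrite mul0r add0r.
have [[a ->]|N] := pselect (exists a, b = e a); last first.
  rewrite (emb_None ed) => [|a E]; last by apply: N; exists a.
  rewrite /= if_same big1 // => a _; rewrite ha coef_arrowM_cons.
  have /negPf -> : b != e a by apply/eqP => E; apply: N; exists a.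
  by rewrite andbF mul0r.
rewrite (bigD1 a) //= ha coef_arrowM_cons eqxx andbT big1 ?addr0 => [|c ca]; last first.
  by rewrite ha coef_arrowM_cons (inj_eq emb_inj) (eq_sym a) (negPf ca) andbF mul0r.
rewrite !(emb_d ed) /= (emb_src ed) (emb_tgt ed) eq_sym coef_of.
case: eqP => [->|_]; last by rewrite mul0r.
by rewrite mul1r /= coef_lstrip eqxx.
Qed.

Lemma embed_avoids (h : {rmorphism cpalg K Q -> cpalg K Q'}) f b : cont_hom id h ->
  (forall a, h (arrow_elt K a) = arrow_elt K (e a)) -> (forall a, b <> e a) ->
  avoids b (h f).
Proof.
move=> ch ha be v u t; rewrite -pull_embed // coef_of.
by rewrite all_cat /= (emb_None ed be) /= andbF; case: ifP.
Qed.

Lemma embed_cD (h : {rmorphism cpalg K Q -> cpalg K Q'}) a f y : cont_hom id h ->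
  (forall a, h (arrow_elt K a) = arrow_elt K (e a)) ->
  cD (e a) (h f) (h y) = h (cD a f y).
Proof.
move=> ch ha; rewrite (chain_rule ch) (bigD1 a) //= ha cD_arrow eqxx scale1r.
rewrite big1 ?addr0 => [|c ca].
  rewrite (emb_src ed) (emb_tgt ed) -[in RHS]cD_sandwich !rmorphM /=.
  by rewrite !(chI ch).
by rewrite ha cD_arrow (inj_eq emb_inj) (negPf ca) scale0r.
Qed.

(** The arrows outside of Q are sent to zero. *)
Lemma retract_exists : exists2 r : {rmorphism cpalg K Q' -> cpalg K Q},
  cont_hom id r & (forall a, r (arrow_elt K (e a)) = arrow_elt K a) /\
    (forall b, (forall a, b <> e a) -> r (arrow_elt K b) = 0).
Proof.
pose y b : cpalg K Q := if [pick a | b == e a] is Some a then arrow_elt K a else 0.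
have yP b : (exists2 a, b = e a & y b = arrow_elt K a) \/
    ((forall a, b <> e a) /\ y b = 0).
  rewrite /y; case: pickP => [a /eqP ->|N]; first by left; exists a.
  by right; split=> // a E; have := N a; rewrite E eqxx.
have [||b|b|r cr rE] := @hom_exists K V V Q' Q id y.
- by exists id.
- by move=> b; have [[a _ ->]|[_ ->]] := yP b; [exact: ordge_arrow|exact: ordge_0].
- by have [[a -> ->]|[_ ->]] := yP b; rewrite ?mulr0 // (emb_src ed) idem_arrow.
- by have [[a -> ->]|[_ ->]] := yP b; rewrite ?mul0r // (emb_tgt ed) arrow_idem.
exists r => //; split=> [a|b be]; rewrite rE.
  by have [[c /emb_inj <-]//|[N _]] := yP (e a); case: (N a).
by have [[a E]|[]//] := yP b; case: (be a).
Qed.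

Lemma retract_embed (h : {rmorphism cpalg K Q -> cpalg K Q'})
    (r : {rmorphism cpalg K Q' -> cpalg K Q}) : cont_hom id h -> cont_hom id r ->
  (forall a, h (arrow_elt K a) = arrow_elt K (e a)) ->
  (forall a, r (arrow_elt K (e a)) = arrow_elt K a) -> cancel h r.
Proof.
move=> ch cr ha ra f.
have cc := cont_hom_comp ch cr (fun=> erefl); have ci := @cont_hom_idfun K _ Q.
by rewrite -[f in RHS]/(idfun f); apply: (ch_ext cc ci) => a /=; rewrite ha ra.
Qed.

End ArrowMaps.

(** * Trivial summands *)

Section TrivialSummand.
Variables (K : fieldType) (V : finType).

Lemma cyclic_potential n (Q : quiver V) (W : cpalg K Q) : potential_ge n W -> cyclic_elt W.
Proof.
move=> Wp x s nz; have w : walk x s by apply: contraNT nz => /coef_notwalk ->.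
pose p : qpath Q := exist _ (x, s) w.
have [|/eqP E _] := Wp p; first by rewrite coefE.
exact: esym E.
Qed.

(** The Jacobian algebra is a product of copies of K; each coordinate is a
    character of KT, so it vanishes on the radical. *)
Lemma trivial_radical (T : quiver V) (S : cpalg K T) : trivial_QP S ->
  forall x, ordge 1 x -> jac_ideal S x.
Proof.
move=> [S2 [f [fk [g fK gK]]]].
have cS : cyclic_elt S.
  by apply: (@cyclic_potential 2) => p /S2[cp ->].
move=> x x1.
have {x1} : f (quot_pi _ x) = 0.
  apply: coefP => v [|a s]; last by case: (a).
  rewrite coef0.
  have [chi chiE] : exists chi : {rmorphism cpalg K T -> K},
      chi =1 fun x => coef (f (quot_pi _ x) : cpalg K (quiver0 V)) v [::].
    apply: rmorphism_of => [y z|]; first by rewrite !rmorphB coefB.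
    split=> [|y z]; first by rewrite !rmorph1 coef_1.
    by rewrite !rmorphM coefM_nil.
  rewrite -chiE; apply: character_rad x1 => k y; rewrite !chiE.
  rewrite -[y in LHS]mul1r cp_scaleAl !rmorphM.
  have := fk k; rewrite /= /cp_str => ->.
  by rewrite cp_scalerAl mul1r coefZ.
rewrite -(rmorph0 f) => /(can_inj fK) /quot_pi0.
rewrite /jac_ideal (_ : cderiv S = (fun b => dd b S)) //.
by apply/funext => b; apply: dd_cderiv.
Qed.

(** The inclusion of KR and the retraction killing the arrows of T are inverse
    to each other modulo the Jacobian ideals, because the arrows of T lie in the
    Jacobian ideal of S, by trivial_radical, hence in that of the sum. *)
Lemma psum_jac (R T : quiver V) (U : cpalg K R) (S : cpalg K T) :
  cyclic_elt U -> cyclic_elt (psum U S) -> trivial_QP S ->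
  isomorphic (jacobian U) (jacobian (psum U S)).
Proof.
move=> cU cP tS; rewrite !jacobianE //.
have eR : embedding (Q' := qsum R T) (fun a => inl a)
   (fun a => match a with inl b => Some [:: b] | inr _ => None end).
  by split=> // -[a|//] /(_ a).
have eT : embedding (Q' := qsum R T) (fun a => inr a)
   (fun a => match a with inl _ => None | inr b => Some [:: b] end).
  by split=> // -[//|a] /(_ a).
have [h ch ha] := embed_exists K eR; have [t ct ta] := embed_exists K eT.
have [r cr [ra rt]] := retract_exists K eR.
have hK := retract_embed ch cr ha ra.
have PE : psum U S = h U + t S.
  by rewrite /psum (pull_embed eR _ ch ha) (pull_embed eT _ ct ta).
have dl a : dd (inl a : arr (qsum R T)) (psum U S) = h (dd a U).
  rewrite PE ddD /dd -(rmorph1 h) (embed_cD eR) // rmorph1.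
  by rewrite (cD_avoids _ (embed_avoids eT _ ct ta _)) ?addr0.
have dr b : dd (inr b : arr (qsum R T)) (psum U S) = t (dd b S).
  rewrite PE ddD /dd -(rmorph1 t) (embed_cD eT) // rmorph1.
  by rewrite (cD_avoids _ (embed_avoids eR _ ch ha _)) ?add0r.
have tJ x : ordge 1 x -> jac_ideal (psum U S) (t x).
  move=> /(trivial_radical tS); move: x.
  apply: (closed_ideal_min (I := fun x => jac_ideal (psum U S) (t x))) => [|_ [b _ <-]].
    exact: (ch_closed ct (closed_ideal_closed _)).
  by rewrite -dr; apply: jac_dd.
have rt0 : forall x, ordge 1 x -> r (t x) = 0.
  move=> x x1; rewrite [x]lstripE1 // !rmorph_sum big1 // => a _ /=.
  by rewrite !rmorphM /= ta rt ?mul0r.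
apply: (cpalg_iso (g := r) ch) => [x|y|x|y].
- move: x; apply: (closed_ideal_min (I := fun x => jac_ideal (psum U S) (h x))) => [|_ [b _ <-]].
    exact: (ch_closed ch (closed_ideal_closed _)).
  by rewrite -dl; apply: jac_dd.
- move: y; apply: (closed_ideal_min (I := fun x => jac_ideal U (r x))) => [|_ [[a|b] _ <-]].
  + exact: (ch_closed cr (closed_ideal_closed _)).
  + by rewrite dl hK; apply: jac_dd.
  rewrite dr rt0; first exact: ideal0.
  apply: ordge_dd => x s s2; have [S2 _] := tS.
  have [w|w] := boolP (walk x s); last by rewrite coef_notwalk.
  apply/eqP/negPn/negP => nz; have [|_] := S2 (exist _ (x, s) w); first by rewrite coefE.
  by rewrite /plen /parrs /= => E; rewrite E in s2.
- by rewrite hK subrr; apply: ideal0.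
have ci := @cont_hom_idfun K _ (qsum R T).
have cc := cont_hom_comp cr ch (fun=> erefl).
apply: (ch_ext_mod ci cc (closed_ideal_closed (range (fun b => dd b (psum U S)))) _ y) => -[a|b] /=.
  by rewrite ra ha subrr; apply: (ideal0 (jac_ideal (psum U S))).
by rewrite rt // rmorph0 subr0 -ta; apply: (tJ _ (ordge_arrow _ _)).
Qed.

End TrivialSummand.

(** * Bracketing the compositions at a vertex *)

Lemma ordgeS (K : fieldType) (V : finType) (Q : quiver V) n (f : cpalg K Q) :
  ordge 1 f -> (forall a, ordge n (lstrip a f)) -> ordge n.+1 f.
Proof.
move=> f1 fn; rewrite [f]lstripE1 //; apply: ordge_sum => a _.
by apply: (@ordgeM _ _ _ 1 n); [exact: ordge_arrow|].
Qed.

Lemma lstrip_eq (K : fieldType) (V : finType) (Q : quiver V) (f g : cpalg K Q) :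
  (forall v, coef f v [::] = coef g v [::]) ->
  (forall a, lstrip a f = lstrip a g) -> f = g.
Proof.
move=> fg0 fg; rewrite [f]lstripE [g]lstripE; congr (_ + _).
  by apply: eq_bigr => v _; rewrite fg0.
by apply: eq_bigr => a _; rewrite fg.
Qed.

Lemma avoidsP (K : fieldType) (V : finType) (Q : quiver V) c (f : cpalg K Q) :
  avoids c f <-> forall v s, c \in s -> coef f v s = 0.
Proof.
split=> H => [v s cs|v u t]; first by case/splitPr: cs.
by apply: H; rewrite mem_cat inE eqxx orbT.
Qed.

Lemma cD_eq0_avoids (K : fieldType) (V : finType) (Q : quiver V) b c (f : cpalg K Q) :
  avoids c f -> avoids c (dd b f).
Proof.
move=> /avoidsP fc; apply/avoidsP => v s cs; rewrite coef_cD; case: ifP => // _.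
rewrite big1 // => i _; rewrite mul1r coef_rsuffix fc //.
by move: cs; rewrite -{1}(cat_take_drop i s) !mem_cat inE => /orP[->|->]; rewrite ?orbT.
Qed.

Section Bracket.
Variables (K : fieldType) (V : finType) (Q : quiver V) (k : V).
Local Notation mQ := (mut_quiver Q k).
Local Notation A := (cpalg K Q).
Local Notation B := (cpalg K mQ).
Local Notation br := (@mut_bracket K V Q k).
Implicit Types (f g : A).

Lemma away_src (a : arr_away Q k) : src Q (val a) != k.
Proof. by have /andP[] := valP a. Qed.
Lemma away_tgt (a : arr_away Q k) : tgt Q (val a) != k.
Proof. by have /andP[] := valP a. Qed.
Lemma from_src (a : arr_from Q k) : src Q (val a) = k.
Proof. exact/eqP/(valP a). Qed.
Lemma to_tgt (a : arr_to Q k) : tgt Q (val a) = k.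
Proof. exact/eqP/(valP a). Qed.

Lemma coef_br f x s : coef (br f) x s =
  if walk x s then
    if all (isSome \o @mut_word V Q k) s
    then coef f x (flatten (pmap (@mut_word V Q k) s)) else 0
  else 0.
Proof. exact: coef_of. Qed.

Lemma br_nil f v : coef (br f) v [::] = coef f v [::].
Proof. by rewrite coef_br. Qed.

Lemma br_away (a : arr_away Q k) f :
  lstrip (M_away a : arr mQ) (br f) = br (lstrip (val a) f).
Proof.
apply: coefP => y s; rewrite coef_lstrip !coef_br /= eqxx /=.
case: (eqVneq y (tgt Q (val a))) => [->|ya].
  by rewrite coef_lstrip eqxx.
by rewrite coef_lstrip (negPf ya) !if_same.
Qed.

Lemma br_comp (ba : arr_to Q k * arr_from Q k) f :
  lstrip (M_comp ba : arr mQ) (br f) = br (lstrip (val ba.2) (lstrip (val ba.1) f)).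
Proof.
apply: coefP => y s; rewrite coef_lstrip !coef_br /= eqxx /=.
case: (eqVneq y (tgt Q (val ba.2))) => [->|ya].
  by rewrite !coef_lstrip from_src to_tgt !eqxx.
by rewrite coef_lstrip (negPf ya) !if_same.
Qed.

Lemma br_star (a : arr_from Q k) f : lstrip (M_star a : arr mQ) (br f) = 0.
Proof.
by apply: coefP => y s; rewrite coef_lstrip !coef_br /= coef0 !if_same.
Qed.

Lemma br_costar (b : arr_to Q k) f : lstrip (M_costar b : arr mQ) (br f) = 0.
Proof.
by apply: coefP => y s; rewrite coef_lstrip !coef_br /= coef0 !if_same.
Qed.

Lemma brD f g : br (f + g) = br f + br g.
Proof.
apply: coefP => x s; rewrite coefD !coef_br; case: ifP; rewrite ?addr0 // => _.
by case: ifP; rewrite ?addr0 // => _; rewrite coefD.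
Qed.

Lemma brZ c f : br (c *: f) = c *: br f.
Proof.
apply: coefP => x s; rewrite coefZ !coef_br; case: ifP; rewrite ?mulr0 // => _.
by case: ifP; rewrite ?mulr0 // => _; rewrite coefZ.
Qed.

Lemma br0 : br 0 = 0.
Proof. by rewrite -(scale0r 0) brZ !scale0r. Qed.

Lemma brB f g : br (f - g) = br f - br g.
Proof. by rewrite brD -scaleN1r brZ scaleN1r. Qed.

Lemma br_sum I (r : seq I) (P : pred I) (F : I -> A) :
  br (\sum_(i <- r | P i) F i) = \sum_(i <- r | P i) br (F i).
Proof. exact: (big_morph br brD br0). Qed.

Lemma br_idem v : br (idem K Q v) = idem K mQ v.
Proof.
apply: lstrip_eq => [w|]; first by rewrite br_nil !coef_idem.
case=> [[a|ba]|[a|b]].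
- by rewrite br_away !lstrip_constM br0.
- by rewrite br_comp !lstrip_constM lstrip0 br0.
- by rewrite br_star lstrip_constM.
by rewrite br_costar lstrip_constM.
Qed.

Definition ends_off f := f * idem K Q k = 0.
Definition starts_off f := idem K Q k * f = 0.

Lemma ends_lstrip a f : ends_off f -> ends_off (lstrip a f).
Proof.
move=> fk; have := congr1 (lstrip a) fk.
by rewrite lstripM lstrip_constM scaler0 addr0 lstrip0.
Qed.

Lemma ends_off_to (b : arr_to Q k) f : ends_off f ->
  forall v, coef (lstrip (val b) f) v [::] = 0.
Proof.
move=> fk v; rewrite coef_lstrip; case: ifP => // _.
have := congr1 (fun x => coef x (src Q (val b)) [:: val b]) fk.
by rewrite coef0 coefM_idem /wend /= to_tgt eqxx mul1r.
Qed.

Lemma starts_off_at a f : tgt Q a != k -> starts_off (lstrip a f).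
Proof.
move=> ak; rewrite /starts_off -lstrip_idem mulrA idemM eq_sym (negPf ak).
by rewrite scale0r mul0r.
Qed.

Lemma ends_offMl f g : ends_off g -> ends_off (f * g).
Proof. by rewrite /ends_off -mulrA => ->; rewrite mulr0. Qed.

Lemma ends_off_idem f v : v != k -> ends_off (f * idem K Q v).
Proof.
by move=> vk; rewrite /ends_off -mulrA idemM (negPf vk) scale0r mulr0.
Qed.

Lemma ends_offE f v : f * idem K Q v = f -> v != k -> ends_off f.
Proof. by move=> <-; apply: ends_off_idem. Qed.

(** A factorization of a bracketed path corresponds to one of the underlying
    path that does not cut a composition ba at k, and f contributes nothing
    to the others. *)
Lemma brM f g : ends_off f -> br (f * g) = br f * br g.
Proof.
move=> fk; apply: ordge_eq => n; elim: n f fk => [//|n IHn] f fk.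
apply: ordgeS => [|m].
  by apply/ordge1P => v; rewrite coefB coefM_nil !br_nil coefM_nil subrr.
rewrite lstripD -scaleN1r lstripZ scaleN1r lstripM br_nil.
case: m => [[a|ba]|[a|b]].
- rewrite !br_away lstripM brD brZ opprD addrACA subrr addr0.
  exact/IHn/ends_lstrip.
- rewrite !br_comp lstripM lstripD lstripM lstripZ brD brD !brZ.
  rewrite ends_off_to // scale0r addr0 opprD addrACA subrr addr0.
  by apply/IHn/ends_lstrip/ends_lstrip.
- by rewrite !br_star mul0r scaler0 addr0 subr0; apply: ordge_0.
by rewrite !br_costar mul0r scaler0 addr0 subr0; apply: ordge_0.
Qed.

Lemma br_arrow (a : arr_away Q k) : br (arrow_elt K (val a)) = arrow_elt K (M_away a : arr mQ).
Proof.
apply: lstrip_eq => [v|]; first by rewrite br_nil !coef_arrow !andbF.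
case=> [[c|dc]|[c|d]]; rewrite lstrip_arrow.
- by rewrite br_away lstrip_arrow brZ br_idem.
- by rewrite br_comp lstrip_arrow lstripZ lstrip_constM scaler0 br0 scale0r.
- by rewrite br_star scale0r.
by rewrite br_costar scale0r.
Qed.

Hypothesis lf : loop_free_at Q k.

Lemma to_src (b : arr_to Q k) : src Q (val b) != k.
Proof. by apply/eqP => sk; case: (lf (a := val b)); rewrite to_tgt. Qed.
Lemma from_tgt (b : arr_from Q k) : tgt Q (val b) != k.
Proof. by apply/eqP => sk; case: (lf (a := val b)); rewrite from_src. Qed.

Lemma br_arrow2 (b : arr_to Q k) (a : arr_from Q k) :
  br (arrow_elt K (val b) * arrow_elt K (val a)) = arrow_elt K (M_comp (b, a) : arr mQ).
Proof.
apply: lstrip_eq => [v|].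
  by rewrite br_nil coefM_nil !coef_arrow !andbF mulr0.
have ba c : lstrip c (arrow_elt K (val b) * arrow_elt K (val a)) =
    (c == val b)%:R *: arrow_elt K (val a).
  rewrite lstripM coef_arrow andbF scale0r addr0 lstrip_arrow cp_scalerAl.
  case: eqP => [->|_]; rewrite ?scale0r // !scale1r.
  by have := @idem_arrow K _ _ (val a); rewrite from_src to_tgt.
case=> [[c|dc]|[c|d]]; rewrite [RHS]lstrip_arrow.
- rewrite br_away ba; case: eqP => [cb|_]; last by rewrite !scale0r br0.
  by have := away_tgt c; rewrite cb to_tgt eqxx.
- rewrite br_comp ba lstripZ lstrip_arrow scalerA brZ br_idem.
  case: dc => d c /=; congr (_ *: _); rewrite -natrM mulnb.
  by rewrite -[M_comp _ == _]/((d, c) == (b, a)).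
- by rewrite br_star scale0r.
by rewrite br_costar scale0r.
Qed.

(** When no path of f starts or ends at k, a path either starts with an arrow
    away from k, or enters k at once and leaves it with the next arrow. *)
Lemma off_decomp f : starts_off f -> ends_off f ->
  f = consts f + (\sum_(a : arr_away Q k) arrow_elt K (val a) * lstrip (val a) f +
    \sum_(ba : arr_to Q k * arr_from Q k) arrow_elt K (val ba.1) *
       (arrow_elt K (val ba.2) * lstrip (val ba.2) (lstrip (val ba.1) f))).
Proof.
move=> fs fe; rewrite {1}[f]lstripE; congr (_ + _).
rewrite (bigID (fun a => (src Q a != k) && (tgt Q a != k))) /=; congr (_ + _).
  exact: (@big_sub _ _ _ _ [pred a | (src Q a != k) && (tgt Q a != k)]).
rewrite (bigID (fun a => tgt Q a == k)) /= [X in _ + X]big1 ?addr0 => [|a]; last first.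
  rewrite negb_and !negbK => /andP[/orP[/eqP ak _|->]//].
  suff -> : lstrip a f = 0 by rewrite mulr0.
  apply: coefP => y s; rewrite coef_lstrip coef0; case: ifP => // _.
  have := congr1 (fun x => coef x (src Q a) (a :: s)) fs.
  by rewrite coef0 coef_idemM ak eqxx mul1r.
rewrite (eq_bigl [pred a | tgt Q a == k]) => [|a]; last first.
  by rewrite /= andbC; case: eqP => //= _; rewrite andbF.
rewrite (big_sub [pred a | tgt Q a == k]) /=.
rewrite -(pair_bigA _ (fun (b : arr_to Q k) (a : arr_from Q k) => arrow_elt K (val b) *
   (arrow_elt K (val a) * lstrip (val a) (lstrip (val b) f)))) /=.
apply: eq_bigr => b _; rewrite -mulr_sumr; congr (_ * _).
rewrite {1}[lstrip (val b) f]lstripE1; last exact/ordge1P/(ends_off_to b fe).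
rewrite (bigID (fun a => src Q a == k)) /= [X in _ + X]big1 ?addr0 => [|a ak]; last first.
  suff -> : lstrip a (lstrip (val b) f) = 0 by rewrite mulr0.
  apply: coefP => y s; rewrite !coef_lstrip coef0; case: ifP => // _.
  by case: eqP => // E; case/eqP: ak; rewrite E; apply: to_tgt.
exact: (big_sub [pred a | src Q a == k]).
Qed.

End Bracket.

(** * Extending an isomorphism to premutations *)

Section AtVertex.
Variables (K : fieldType) (V : finType) (Q : quiver V) (k : V).
Implicit Types (f : cpalg K Q).
Local Notation br := (@mut_bracket K V Q k).

Lemma from_decomp f : idem K Q k * f = f -> ordge 1 f ->
  \sum_(a : arr_from Q k) arrow_elt K (val a) * lstrip (val a) f = f.
Proof.
move=> fk f1; rewrite [RHS]lstripE1 // (bigID (fun a => src Q a == k)) /=.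
rewrite [X in _ + X]big1 ?addr0 => [|a ak].
  by symmetry; apply: (big_sub [pred a | src Q a == k]).
rewrite -fk lstripM lstrip_constM mul0r add0r coef_idem (negPf ak) scale0r.
by rewrite mulr0.
Qed.

Lemma to_decomp f : f * idem K Q k = f -> ordge 1 f ->
  \sum_(b : arr_to Q k) rstrip (val b) f * arrow_elt K (val b) = f.
Proof.
move=> fk f1; rewrite [RHS]rstripE1 // (bigID (fun a => tgt Q a == k)) /=.
rewrite [X in _ + X]big1 ?addr0 => [|a ak].
  by symmetry; apply: (big_sub [pred a | tgt Q a == k]).
suff -> : rstrip a f = 0 by rewrite mul0r.
apply: coefP => y s; rewrite coef_rstrip coef0; case: ifP => // _.
rewrite -fk coefM_idem /wend map_rcons last_rcons (negPf ak).
by rewrite mul0r.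
Qed.

Lemma ends_off_arrow a : tgt Q a != k -> ends_off k (arrow_elt K a).
Proof. by move=> ak; apply: ends_offE ak; apply: arrow_idem. Qed.

Lemma starts_offE f v : idem K Q v * f = f -> v != k -> starts_off k f.
Proof.
by move=> <- vk; rewrite /starts_off mulrA idemM eq_sym (negPf vk) scale0r mul0r.
Qed.

Lemma starts_off_arrow a : src Q a != k -> starts_off k (arrow_elt K a).
Proof. by move=> ak; apply: starts_offE ak; apply: idem_arrow. Qed.

Lemma starts_offMr f g : starts_off k f -> starts_off k (f * g).
Proof. by rewrite /starts_off mulrA => ->; rewrite mul0r. Qed.

Lemma br_idemMl v f : v != k ->
  br (idem K Q v * f) = idem K (mut_quiver Q k) v * br f.
Proof.
move=> vk; rewrite brM ?br_idem //.
by rewrite /ends_off idemM (negPf vk) scale0r.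
Qed.

Lemma br_idemMr v f : ends_off k f ->
  br (f * idem K Q v) = br f * idem K (mut_quiver Q k) v.
Proof. by move=> fk; rewrite brM ?br_idem. Qed.

Lemma br_ordge1 f : ordge 1 f -> ordge 1 (br f).
Proof. by move=> /ordge1P f1; apply/ordge1P => v; rewrite br_nil. Qed.

Definition mut_cycles : cpalg K (mut_quiver Q k) :=
  \sum_(ba : arr_to Q k * arr_from Q k)
     arrow_elt K (M_comp ba : arr (mut_quiver Q k)) *
     arrow_elt K (M_star ba.2 : arr (mut_quiver Q k)) *
     arrow_elt K (M_costar ba.1 : arr (mut_quiver Q k)).

Lemma mut_cyclesE : mut_cycles =
  \sum_(b : arr_to Q k) \sum_(a : arr_from Q k)
     arrow_elt K (M_comp (b, a) : arr (mut_quiver Q k)) *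
     arrow_elt K (M_star a : arr (mut_quiver Q k)) *
     arrow_elt K (M_costar b : arr (mut_quiver Q k)).
Proof. by rewrite pair_bigA; apply: eq_bigr => -[b a] _. Qed.

End AtVertex.

Lemma mulrA4 (R : pzSemiRingType) (a b c d : R) : a * b * (c * d) = a * (b * c * d).
Proof. by rewrite !mulrA. Qed.

Lemma dd_cycle4 (K : fieldType) (V : finType) (Q : quiver V) c (x p q r : cpalg K Q) :
  dd c (x * p * q * r) = dd c (p * (q * r * x)).
Proof. by rewrite -!mulrA dd_cycle !mulrA. Qed.

Lemma mut_sum (R : nmodType) (V : finType) (Q : quiver V) k
    (F : arr (mut_quiver Q k) -> R) :
  \sum_m F m = ((\sum_(a : arr_away Q k) F (M_away a)) + \sum_ba F (M_comp ba)) +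
    ((\sum_(a : arr_from Q k) F (M_star a)) + \sum_(b : arr_to Q k) F (M_costar b)).
Proof. by rewrite !big_sumType. Qed.

Section Theta.
Variables (K : fieldType) (V V' : finType) (Q : quiver V) (Q' : quiver V').
Variables (k : V) (k' : V') (sigma : V -> V') (tau : V' -> V).
Variables (h : {rmorphism cpalg K Q -> cpalg K Q'}).
Variables (g : {rmorphism cpalg K Q' -> cpalg K Q}).
Local Notation mQ := (mut_quiver Q k).
Local Notation mQ' := (mut_quiver Q' k').
Local Notation br := (@mut_bracket K V Q k).
Local Notation br' := (@mut_bracket K V' Q' k').

Hypotheses (lf : loop_free_at Q k) (lf' : loop_free_at Q' k').
Hypotheses (ch : cont_hom sigma h) (cg : cont_hom tau g).
Hypotheses (gK : cancel g h) (sK : cancel sigma tau) (tK : cancel tau sigma).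
Hypothesis kk : sigma k = k'.

(** If g a' is the sum of the a n_(a,a'), then the matrix n, read through h, is
    inverse to the action of h on the arrows starting at k, so that the sum of
    the a a^* is preserved; likewise for the arrows ending at k. *)
Definition theta_arr (m : arr mQ) : cpalg K mQ' :=
  match m with
  | inl (inl a) => br' (h (arrow_elt K (val a)))
  | inl (inr ba) => br' (h (arrow_elt K (val ba.1) * arrow_elt K (val ba.2)))
  | inr (inl a) => \sum_(a' : arr_from Q' k')
      br' (h (lstrip (val a) (g (arrow_elt K (val a'))))) * arrow_elt K (M_star a' : arr mQ')
  | inr (inr b) => \sum_(b' : arr_to Q' k')
      arrow_elt K (M_costar b' : arr mQ') * br' (h (rstrip (val b) (g (arrow_elt K (val b')))))
  end.

Lemma sigma_neq v : v != k -> sigma v != k'.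
Proof. by move=> vk; rewrite -kk (inj_eq (can_inj sK)). Qed.

Lemma tau_neq v : v != k' -> tau v != k.
Proof. by move=> vk; apply: contra_neq vk => E; rewrite -kk -E tK. Qed.

Lemma h_ends f : ends_off k f -> ends_off k' (h f).
Proof. by rewrite /ends_off -kk -(chI ch) -rmorphM => ->; rewrite rmorph0. Qed.

Lemma h_starts f : starts_off k f -> starts_off k' (h f).
Proof. by rewrite /starts_off -kk -(chI ch) -rmorphM => ->; rewrite rmorph0. Qed.

Lemma lstrip_g_ends (a : arr_from Q k) (a' : arr_from Q' k') :
  lstrip (val a) (g (arrow_elt K (val a'))) * idem K Q (tau (tgt Q' (val a'))) =
  lstrip (val a) (g (arrow_elt K (val a'))).
Proof.
rewrite -[in RHS]arrow_idem [in RHS]rmorphM (chI cg) lstripM lstrip_constM.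
by rewrite scaler0 addr0.
Qed.

Lemma rstrip_g_starts (b : arr_to Q k) (b' : arr_to Q' k') :
  idem K Q (tau (src Q' (val b'))) * rstrip (val b) (g (arrow_elt K (val b'))) =
  rstrip (val b) (g (arrow_elt K (val b'))).
Proof.
by rewrite -[in RHS]idem_arrow [in RHS]rmorphM (chI cg) rstripM //; apply: chJ cg _.
Qed.

Lemma star_ends (a : arr_from Q k) (a' : arr_from Q' k') :
  ends_off k (lstrip (val a) (g (arrow_elt K (val a')))).
Proof. exact: (ends_offE (lstrip_g_ends a a') (tau_neq (from_tgt lf' a'))). Qed.

Lemma star_starts (a : arr_from Q k) (a' : arr_from Q' k') :
  starts_off k (lstrip (val a) (g (arrow_elt K (val a')))).
Proof. exact: starts_off_at (from_tgt lf a). Qed.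

Lemma costar_ends (b : arr_to Q k) (b' : arr_to Q' k') :
  ends_off k (rstrip (val b) (g (arrow_elt K (val b')))).
Proof. exact: (ends_offE (rstrip_idem _ _) (to_src lf b)). Qed.

Lemma costar_starts (b : arr_to Q k) (b' : arr_to Q' k') :
  starts_off k (rstrip (val b) (g (arrow_elt K (val b')))).
Proof. exact: (starts_offE (rstrip_g_starts b b') (tau_neq (to_src lf' b'))). Qed.

Lemma h_idemMl v f : h (idem K Q v * f) = idem K Q' (sigma v) * h f.
Proof. by rewrite rmorphM (chI ch). Qed.

Lemma h_idemMr v f : h (f * idem K Q v) = h f * idem K Q' (sigma v).
Proof. by rewrite rmorphM (chI ch). Qed.

Lemma comp_ends (ba : arr_to Q k * arr_from Q k) :
  ends_off k (arrow_elt K (val ba.1) * arrow_elt K (val ba.2)).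
Proof. by apply/ends_offMl/ends_off_arrow/from_tgt. Qed.

Lemma theta_exists : exists2 T : {rmorphism cpalg K mQ -> cpalg K mQ'},
  cont_hom sigma T & forall m, T (arrow_elt K m) = theta_arr m.
Proof.
apply: hom_exists => [|m|m|m]; first by exists tau.
- case: m => [[a|ba]|[a|b]] /=.
  + by apply/br_ordge1/(chJ ch).
  + by apply/br_ordge1; rewrite rmorphM; apply/ordgeMr/(chJ ch).
  + by apply: ordge_sum => a' _; apply/ordgeMr/ordge_arrow.
  + by apply: ordge_sum => b' _; apply/ordgeMl/ordge_arrow.
- case: m => [[a|ba]|[a|b]] /=.
  + by rewrite -br_idemMl ?sigma_neq ?away_src // -h_idemMl idem_arrow.
  + by rewrite -br_idemMl ?sigma_neq ?to_src // -h_idemMl mulrA idem_arrow.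
  + rewrite mulr_sumr; apply: eq_bigr => a' _; rewrite mulrA.
    by rewrite -br_idemMl ?sigma_neq ?from_tgt // -h_idemMl lstrip_idem.
  rewrite mulr_sumr; apply: eq_bigr => b' _; rewrite mulrA; congr (_ * _).
  rewrite to_tgt kk; have := @idem_arrow K _ mQ' (M_costar b').
  by rewrite [src _ _]/= to_tgt.
case: m => [[a|ba]|[a|b]] /=.
- rewrite -br_idemMr; last by apply/h_ends/ends_off_arrow/away_tgt.
  by rewrite -h_idemMr arrow_idem.
- rewrite -br_idemMr; last by apply/h_ends/comp_ends.
  by rewrite -h_idemMr -mulrA arrow_idem.
- rewrite mulr_suml; apply: eq_bigr => a' _; rewrite -mulrA; congr (_ * _).
  rewrite from_src kk; have := @arrow_idem K _ mQ' (M_star a').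
  by rewrite [tgt _ _]/= from_src.
rewrite mulr_suml; apply: eq_bigr => b' _; rewrite -mulrA.
rewrite -br_idemMr; last exact/h_ends/costar_ends.
by rewrite -h_idemMr rstrip_idem.
Qed.

Variable T : {rmorphism cpalg K mQ -> cpalg K mQ'}.
Hypotheses (cT : cont_hom sigma T) (TE : forall m, T (arrow_elt K m) = theta_arr m).

(** Both sides decompose along off_decomp in the same way. *)
Lemma theta_br f : starts_off k f -> ends_off k f -> T (br f) = br' (h f).
Proof.
move=> fs fe; apply: ordge_eq => n; elim: n f fs fe => [//|n IHn] f fs fe.
rewrite [h f](_ : _ = h (consts f) +
  (\sum_(a : arr_away Q k) h (arrow_elt K (val a)) * h (lstrip (val a) f) +
   \sum_(ba : arr_to Q k * arr_from Q k)
     h (arrow_elt K (val ba.1) * arrow_elt K (val ba.2)) *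
     h (lstrip (val ba.2) (lstrip (val ba.1) f)))); last first.
  rewrite {1}(off_decomp fs fe) !rmorphD !rmorph_sum; congr (_ + (_ + _)).
    by apply: eq_bigr => a _; rewrite rmorphM.
  by apply: eq_bigr => ba _; rewrite mulrA rmorphM.
have hc : br' (h (consts f)) = \sum_v coef (br f) v [::] *: idem K mQ' (sigma v).
  rewrite /consts rmorph_sum br_sum; apply: eq_bigr => v _ /=.
  by rewrite (chZ ch) (chI ch) brZ br_idem br_nil.
rewrite (chE _ cT) !brD hc opprD addrACA subrr add0r !br_sum.
rewrite mut_sum.
rewrite [X in _ + (X + _)]big1 => [|a _]; last first.
  by rewrite br_star rmorph0 mulr0.
rewrite [X in _ + (_ + X)]big1 => [|a _]; last first.
  by rewrite br_costar rmorph0 mulr0.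
rewrite !addr0 opprD addrACA -!sumrB; apply: ordgeD; apply: ordge_sum => i _.
  rewrite TE /= (brM _ (h_ends (ends_off_arrow _ (away_tgt i)))) br_away -mulrBr.
  apply: (@ordgeM _ _ _ 1 n); first exact/br_ordge1/(chJ ch).
  by apply: IHn; [apply/starts_off_at/away_tgt|apply: ends_lstrip].
rewrite TE /= (brM _ (h_ends (comp_ends i))) br_comp -mulrBr.
apply: (@ordgeM _ _ _ 1 n).
  by apply: br_ordge1; rewrite rmorphM; apply/ordgeMr/(chJ ch).
by apply: IHn; [apply/starts_off_at/from_tgt|apply/ends_lstrip/ends_lstrip].
Qed.

Lemma g_from (a' : arr_from Q' k') :
  \sum_(a : arr_from Q k) arrow_elt K (val a) * lstrip (val a) (g (arrow_elt K (val a')))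
  = g (arrow_elt K (val a')).
Proof.
apply: from_decomp; last exact: chJ cg _.
have tk : tau k' = k by rewrite -kk sK.
by rewrite -[in RHS]idem_arrow rmorphM (chI cg) from_src tk.
Qed.

Lemma g_to (b' : arr_to Q' k') :
  \sum_(b : arr_to Q k) rstrip (val b) (g (arrow_elt K (val b'))) * arrow_elt K (val b)
  = g (arrow_elt K (val b')).
Proof.
apply: to_decomp; last exact: chJ cg _.
have tk : tau k' = k by rewrite -kk sK.
by rewrite -[in RHS]arrow_idem rmorphM (chI cg) to_tgt tk.
Qed.

(** In the image of the sum of the [ba]a^* b^* the coefficients of the images of
    [ba] and a^* combine by g_from; those of b^* are brought to the front by a
    rotation, and then combine with [ba] by g_to. *)
Lemma theta_cycles : dd_equiv (T (@mut_cycles K V Q k)) (@mut_cycles K V' Q' k').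
Proof.
have -> : T (@mut_cycles K V Q k) = \sum_(b : arr_to Q k)
   \sum_(a' : arr_from Q' k') \sum_(b' : arr_to Q' k')
    br' (h (arrow_elt K (val b)) * arrow_elt K (val a')) *
     (arrow_elt K (M_star a' : arr mQ') * arrow_elt K (M_costar b' : arr mQ') *
      br' (h (rstrip (val b) (g (arrow_elt K (val b')))))).
  rewrite mut_cyclesE rmorph_sum.
  apply: eq_bigr => b _ /=; rewrite rmorph_sum /=.
  under eq_bigr do rewrite !rmorphM !TE /=.
  rewrite -mulr_suml.
  have -> : \sum_(a : arr_from Q k)
      br' (h (arrow_elt K (val b) * arrow_elt K (val a))) *
      (\sum_(a' : arr_from Q' k')
         br' (h (lstrip (val a) (g (arrow_elt K (val a'))))) *
         arrow_elt K (M_star a' : arr mQ')) =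
    \sum_(a' : arr_from Q' k') br' (h (arrow_elt K (val b)) * arrow_elt K (val a')) *
       arrow_elt K (M_star a' : arr mQ').
    under eq_bigr do rewrite mulr_sumr.
    rewrite exchange_big; apply: eq_bigr => a' _ /=.
    have E : h (arrow_elt K (val b)) * arrow_elt K (val a') =
        h (\sum_(a : arr_from Q k) arrow_elt K (val b) *
             (arrow_elt K (val a) * lstrip (val a) (g (arrow_elt K (val a'))))).
      by rewrite -mulr_sumr g_from rmorphM gK.
    rewrite E rmorph_sum br_sum mulr_suml; apply: eq_bigr => a _ /=.
    by rewrite mulrA -(brM _ (h_ends (comp_ends (b, a)))) -rmorphM -mulrA.
  rewrite big_distrlr /=; apply: eq_bigr => a' _.
  by apply: eq_bigr => b' _; apply: mulrA4.
move=> c; rewrite exchange_big mut_cyclesE [in RHS]exchange_big !dd_sum.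
apply: eq_bigr => a' _ /=; rewrite exchange_big !dd_sum; apply: eq_bigr => b' _ /=.
have E : arrow_elt K (val b') * arrow_elt K (val a') =
    \sum_(b : arr_to Q k) h (rstrip (val b) (g (arrow_elt K (val b')))) *
       (h (arrow_elt K (val b)) * arrow_elt K (val a')).
  under eq_bigr do rewrite mulrA -rmorphM.
  by rewrite -mulr_suml -rmorph_sum /= g_to gK.
rewrite -br_arrow2 E br_sum !mulr_suml !dd_sum; apply: eq_bigr => b _ /=.
rewrite (brM _ (h_ends (costar_ends b b'))); symmetry; apply: dd_cycle4.
Qed.

End Theta.

Section ThetaInverse.
Variables (K : fieldType) (V V' : finType) (Q : quiver V) (Q' : quiver V').
Variables (k : V) (k' : V') (sigma : V -> V') (tau : V' -> V).
Variables (h : {rmorphism cpalg K Q -> cpalg K Q'}).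
Variables (g : {rmorphism cpalg K Q' -> cpalg K Q}).
Local Notation mQ := (mut_quiver Q k).
Local Notation mQ' := (mut_quiver Q' k').
Hypotheses (lf : loop_free_at Q k) (lf' : loop_free_at Q' k').
Hypotheses (ch : cont_hom sigma h) (cg : cont_hom tau g).
Hypotheses (hK : cancel h g) (gK : cancel g h).
Hypotheses (sK : cancel sigma tau) (tK : cancel tau sigma).
Hypothesis kk : sigma k = k'.
Variable T : {rmorphism cpalg K mQ -> cpalg K mQ'}.
Hypotheses (cT : cont_hom sigma T).
Hypothesis TE : forall m, T (arrow_elt K m) = theta_arr h g m.
Variable S : {rmorphism cpalg K mQ' -> cpalg K mQ}.
Hypotheses (cS : cont_hom tau S).
Hypothesis SE : forall m, S (arrow_elt K m) = theta_arr g h m.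

(** On the arrows a^* and b^* the two matrices multiply to the identity, since
    g (h a) = a. *)
Lemma theta_inv : cancel T S.
Proof.
have kk' : tau k' = k by rewrite -kk sK.
have Sbr := theta_br lf' cg kk' cS SE.
have hs := h_starts ch kk; have he := h_ends ch kk.
have ci := @cont_hom_idfun K _ mQ.
have cc : cont_hom id (S \o T : {rmorphism cpalg K mQ -> cpalg K mQ}).
  exact: cont_hom_comp cT cS sK.
move=> f; rewrite -[RHS]/(idfun f); apply: (ch_ext cc ci) => -[[a|ba]|[a|b]] /=.
- rewrite TE /= Sbr ?hK ?br_arrow //.
    by apply/hs/starts_off_arrow/away_src.
  by apply/he/ends_off_arrow/away_tgt.
- rewrite TE /= Sbr ?hK; first by case: ba => b a; rewrite br_arrow2.
    by apply/hs/starts_offMr/starts_off_arrow/to_src.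
  exact/he/comp_ends.
- have inner a2 : \sum_(i : arr_from Q' k') lstrip (val a) (g (arrow_elt K (val i))) *
       g (lstrip (val i) (h (arrow_elt K (val a2)))) =
      (a2 == a)%:R *: idem K Q (tgt Q (val a)).
    transitivity (lstrip (val a) (g (\sum_(i : arr_from Q' k') arrow_elt K (val i) *
          lstrip (val i) (h (arrow_elt K (val a2)))))).
      rewrite rmorph_sum lstrip_sum; apply: eq_bigr => i _ /=.
      have /ordge1P g1 := chJ cg (val i).
      by rewrite rmorphM lstripM g1 scale0r addr0.
    by rewrite (g_from ch tK kk') hK lstrip_arrow (inj_eq val_inj) eq_sym.
  transitivity (\sum_(a2 : arr_from Q k) mut_bracket (\sum_(i : arr_from Q' k')
       lstrip (val a) (g (arrow_elt K (val i))) *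
       g (lstrip (val i) (h (arrow_elt K (val a2))))) *
       arrow_elt K (M_star a2 : arr mQ)).
    rewrite TE /= rmorph_sum /=.
    transitivity (\sum_(i : arr_from Q' k') \sum_(a2 : arr_from Q k) mut_bracket
       (lstrip (val a) (g (arrow_elt K (val i))) *
        g (lstrip (val i) (h (arrow_elt K (val a2))))) *
       arrow_elt K (M_star a2 : arr mQ)).
      apply: eq_bigr => i _; rewrite rmorphM (Sbr _ (hs _ (star_starts g lf a i))); last first.
        exact/he/(star_ends lf' cg tK kk).
      rewrite hK SE /= mulr_sumr; apply: eq_bigr => a2 _.
      by rewrite (brM _ (star_ends lf' cg tK kk a i)); apply: mulrA.
    by rewrite exchange_big; apply: eq_bigr => a2 _ /=; rewrite br_sum mulr_suml.
  under eq_bigr do rewrite inner.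
  rewrite (bigD1 a) //= [X in _ + X]big1 ?addr0 => [|a2 /negPf ->]; last first.
    by rewrite scale0r br0 mul0r.
  by rewrite eqxx scale1r br_idem; exact: (@idem_arrow K _ mQ (M_star a)).
have inner b2 : \sum_(i : arr_to Q' k') g (rstrip (val i) (h (arrow_elt K (val b2)))) *
     rstrip (val b) (g (arrow_elt K (val i))) = (b2 == b)%:R *: idem K Q (src Q (val b)).
  transitivity (rstrip (val b) (g (\sum_(i : arr_to Q' k')
      rstrip (val i) (h (arrow_elt K (val b2))) * arrow_elt K (val i)))).
    rewrite rmorph_sum rstrip_sum; apply: eq_bigr => i _ /=.
    by rewrite rmorphM rstripM //; apply: chJ cg _.
  by rewrite (g_to ch tK kk') hK rstrip_arrow (inj_eq val_inj) eq_sym.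
have ge (i : arr_to Q' k') (b2 : arr_to Q k) :
    ends_off k (g (rstrip (val i) (h (arrow_elt K (val b2))))).
  apply: (h_ends cg kk').
  exact: (ends_offE (rstrip_idem _ _) (to_src lf' i)).
transitivity (\sum_(b2 : arr_to Q k) arrow_elt K (M_costar b2 : arr mQ) *
   mut_bracket (\sum_(i : arr_to Q' k')
     g (rstrip (val i) (h (arrow_elt K (val b2)))) *
     rstrip (val b) (g (arrow_elt K (val i))))).
  rewrite TE /= rmorph_sum /=.
  transitivity (\sum_(i : arr_to Q' k') \sum_(b2 : arr_to Q k)
     arrow_elt K (M_costar b2 : arr mQ) *
     mut_bracket (g (rstrip (val i) (h (arrow_elt K (val b2)))) *
       rstrip (val b) (g (arrow_elt K (val i))))).
    apply: eq_bigr => i _; rewrite rmorphM.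
    rewrite (Sbr _ (hs _ (costar_starts lf' cg tK kk b i))); last exact/he/costar_ends.
    rewrite hK SE /= mulr_suml; apply: eq_bigr => b2 _.
    by rewrite (brM _ (ge i b2)); symmetry; apply: mulrA.
  by rewrite exchange_big; apply: eq_bigr => b2 _ /=; rewrite br_sum mulr_sumr.
under eq_bigr do rewrite inner.
rewrite (bigD1 b) //= [X in _ + X]big1 ?addr0 => [|b2 /negPf ->]; last first.
  by rewrite scale0r br0 mulr0.
by rewrite eqxx scale1r br_idem; exact: (@arrow_idem K _ mQ (M_costar b)).
Qed.

End ThetaInverse.

(** * Brackets and cyclic derivatives *)

Section Unbracket.
Variables (K : fieldType) (V : finType) (Q : quiver V) (k : V).
Hypothesis lf : loop_free_at Q k.
Local Notation mQ := (mut_quiver Q k).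
Local Notation br := (@mut_bracket K V Q k).

(** Removes the brackets; together with br it identifies the star-free paths
    of the premutation with the paths of Q starting and ending outside k. *)
Definition unbr_arr (m : arr mQ) : cpalg K Q :=
  match m with
  | inl (inl a) => arrow_elt K (val a)
  | inl (inr ba) => arrow_elt K (val ba.1) * arrow_elt K (val ba.2)
  | inr _ => 0
  end.

Lemma unbr_exists : exists2 T : {rmorphism cpalg K mQ -> cpalg K Q},
  cont_hom id T & forall m, T (arrow_elt K m) = unbr_arr m.
Proof.
apply: hom_exists => [|m|m|m]; first by exists id.
- case: m => [[a|ba]|m] /=; [exact: ordge_arrow| |exact: ordge_0].
  by apply/ordgeMr/ordge_arrow.
- by case: m => [[a|ba]|m] /=; rewrite ?mulr0 // ?mulrA idem_arrow.
by case: m => [[a|ba]|m] /=; rewrite ?mul0r // -?mulrA arrow_idem.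
Qed.

Variable T : {rmorphism cpalg K mQ -> cpalg K Q}.
Hypotheses (cT : cont_hom id T) (TE : forall m, T (arrow_elt K m) = unbr_arr m).

Lemma unbrE y : T y = consts (T y) +
  (\sum_(a : arr_away Q k) arrow_elt K (val a) * T (lstrip (M_away a : arr mQ) y) +
   \sum_(ba : arr_to Q k * arr_from Q k) arrow_elt K (val ba.1) *
      (arrow_elt K (val ba.2) * T (lstrip (M_comp ba : arr mQ) y))).
Proof.
rewrite {1}(chE _ cT) mut_sum; congr (_ + _).
  by apply: eq_bigr => v _; rewrite (ch_nil _ _ cT).
rewrite [X in _ + X](_ : _ = 0) ?addr0.
  congr (_ + _); apply: eq_bigr => i _; rewrite TE //.
  by symmetry; apply: mulrA.
by rewrite !big1 ?addr0 // => i _; rewrite TE mul0r.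
Qed.

Lemma unbr_br f : starts_off k f -> ends_off k f -> T (br f) = f.
Proof.
move=> fs fe; apply: ordge_eq => n; elim: n f fs fe => [//|n IHn] f fs fe.
rewrite {2}(off_decomp fs fe) unbrE.
have -> : consts (T (br f)) = consts f.
  by apply: eq_bigr => v _; rewrite (ch_nil _ _ cT) br_nil.
rewrite opprD addrACA subrr add0r opprD addrACA -!sumrB.
apply: ordgeD; apply: ordge_sum => i _.
  rewrite br_away -mulrBr; apply: (@ordgeM _ _ _ 1 n); first exact: ordge_arrow.
  by apply: IHn; [apply/starts_off_at/away_tgt|apply: ends_lstrip].
rewrite br_comp -!mulrBr; apply: ordgeMr; apply: (@ordgeM _ _ _ 1 n).
  exact: ordge_arrow.
by apply: IHn; [apply/starts_off_at/from_tgt|apply/ends_lstrip/ends_lstrip].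
Qed.

Lemma lstrip_arrowM a f b : lstrip a (arrow_elt K (b : arr Q) * f) =
  (a == b)%:R *: (idem K Q (tgt Q a) * f).
Proof. by rewrite lstripM coef_arrow andbF scale0r addr0 lstrip_arrow cp_scalerAl. Qed.

Lemma lstrip_comp0 (a : arr_away Q k) (ba : arr_to Q k * arr_from Q k) f :
  lstrip (val a) (arrow_elt K (val ba.1) * f) = 0.
Proof.
rewrite lstrip_arrowM; case: eqP => [E|_]; last by rewrite scale0r.
by have := away_tgt a; rewrite E to_tgt eqxx.
Qed.

Lemma unbr_away (a : arr_away Q k) y :
  lstrip (val a) (T y) = T (lstrip (M_away a : arr mQ) y).
Proof.
rewrite unbrE !lstripD [X in _ + (_ + X)]lstrip_sum [X in _ + (_ + X)]big1 => [|ba _].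
  rewrite addr0 /consts !lstrip_sum big1 => [|v _]; last by rewrite lstripZ lstrip_constM scaler0.
  rewrite add0r (bigD1 a) //= lstrip_arrowM eqxx scale1r big1 ?addr0 => [|c ca].
    have := congr1 T (@lstrip_idem _ _ _ (M_away a : arr mQ) y).
    by rewrite rmorphM (chI cT).
  have /negPf ac : val a != val c by rewrite (inj_eq val_inj) eq_sym.
  by rewrite lstrip_arrowM ac scale0r.
exact: lstrip_comp0.
Qed.

Lemma unbr_comp (ba : arr_to Q k * arr_from Q k) y :
  lstrip (val ba.2) (lstrip (val ba.1) (T y)) = T (lstrip (M_comp ba : arr mQ) y).
Proof.
have -> : lstrip (val ba.1) (T y) = \sum_(dc : arr_to Q k * arr_from Q k)
    lstrip (val ba.1) (arrow_elt K (val dc.1) *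
      (arrow_elt K (val dc.2) * T (lstrip (M_comp dc : arr mQ) y))).
  rewrite unbrE !lstripD !lstrip_sum big1 => [|v _].
    rewrite add0r big1 ?add0r // => a _; rewrite lstrip_arrowM.
    case: eqP => [E|_]; last by rewrite scale0r.
    by have := away_tgt a; rewrite -E to_tgt eqxx.
  by rewrite lstripZ lstrip_constM scaler0.
rewrite lstrip_sum (bigD1 ba) //= big1 ?addr0 => [|dc dcba].
  rewrite lstrip_arrowM eqxx scale1r mulrA.
  have -> : idem K Q (tgt Q (val ba.1)) * arrow_elt K (val ba.2) = arrow_elt K (val ba.2).
    by have := @idem_arrow K _ _ (val ba.2); rewrite from_src to_tgt.
  rewrite lstrip_arrowM eqxx scale1r.
  have := congr1 T (@lstrip_idem _ _ _ (M_comp ba : arr mQ) y).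
  by rewrite rmorphM (chI cT).
rewrite lstrip_arrowM lstripZ mulrA.
have -> : idem K Q (tgt Q (val ba.1)) * arrow_elt K (val dc.2) = arrow_elt K (val dc.2).
  by have := @idem_arrow K _ _ (val dc.2); rewrite from_src to_tgt.
have /negPf E : ~~ ((val ba.1 == val dc.1) && (val ba.2 == val dc.2)).
  rewrite !(inj_eq val_inj); apply: contra dcba => /andP[/eqP E1 /eqP E2].
  by rewrite [dc]surjective_pairing -E1 -E2 -surjective_pairing.
by rewrite lstrip_arrowM scalerA -natrM mulnb E scale0r.
Qed.

Definition starless (y : cpalg K mQ) :=
  (forall a, avoids (M_star a : arr mQ) y) /\ (forall b, avoids (M_costar b : arr mQ) y).

Lemma avoids_lstrip (Q0 : quiver V) a c (y : cpalg K Q0) : avoids c y -> avoids c (lstrip a y).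
Proof.
by move=> yc v u t; rewrite coef_lstrip; case: ifP => // _; apply: (yc _ (a :: u)).
Qed.

Lemma avoids_lstrip0 (Q0 : quiver V) c (y : cpalg K Q0) : avoids c y -> lstrip c y = 0.
Proof.
move=> yc; apply: coefP => v s; rewrite coef_lstrip coef0; case: ifP => // _.
exact: (yc _ [::]).
Qed.

Lemma br_unbr y : starless y -> br (T y) = y.
Proof.
move=> ys; apply: ordge_eq => n; elim: n y ys => [//|n IHn] y ys.
apply: ordgeS => [|m].
  by apply/ordge1P => v; rewrite coefB br_nil (ch_nil _ _ cT) subrr.
have ys' : starless (lstrip m y).
  by split=> c; apply: avoids_lstrip; [apply: ys.1|apply: ys.2].
rewrite lstripD -scaleN1r lstripZ scaleN1r; case: m ys' => [[a|ba]|[a|b]] ys'.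
- by rewrite br_away unbr_away; apply: IHn.
- by rewrite br_comp unbr_comp; apply: IHn.
- by rewrite br_star (avoids_lstrip0 (ys.1 a)) subrr; apply: ordge_0.
by rewrite br_costar (avoids_lstrip0 (ys.2 b)) subrr; apply: ordge_0.
Qed.

Lemma br_starless f : starless (br f).
Proof.
by split=> c v u t; rewrite coef_br all_cat /= andbF if_same.
Qed.

(** By the chain rule for T, the derivative of f = T (br f) at an arrow a away
    from k is T (dd a (br f)), and its derivative at b ending at k is the sum of the
    a T (dd [ba] (br f)). Hence all T (dd m (br f)) vanish, and T is injective on
    star-free elements. *)
Lemma br_dd0 f : starts_off k f -> ends_off k f -> (forall a, dd a f = 0) ->
  forall m : arr mQ, dd m (br f) = 0.
Proof.
move=> fs fe f0 m.
have ds c : starless (dd c (br f)).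
  by have [s1 s2] := br_starless f; split=> d; apply: cD_eq0_avoids.
suff H : T (dd m (br f)) = 0 by rewrite -(br_unbr (ds m)) H br0.
have T0 c : \sum_m cD c (T (arrow_elt K m)) (T (dd m (br f))) = 0.
  by rewrite -(chain_rule_dd cT) unbr_br.
have dT c : T (dd c (br f)) =
    idem K Q (tgt mQ c) * T (dd c (br f)) * idem K Q (src mQ c).
  by rewrite -[dd c _ in LHS](cD_sandwich c (br f) 1) !rmorphM !(chI cT).
case: m => [[a|ba]|[a|b]].
- have := T0 (val a); rewrite mut_sum [X in _ + X](_ : _ = 0) ?addr0; last first.
    by rewrite !big1 ?addr0 // => i _; rewrite TE cD0l.
  rewrite [X in _ + X](_ : _ = 0) ?addr0; last first.
    rewrite big1 // => ba _; rewrite TE /= cDM !cD_arrow.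
    have -> : (val ba.1 == val a) = false.
      by apply/eqP => E; have := away_tgt a; rewrite -E to_tgt eqxx.
    have -> : (val ba.2 == val a) = false.
      by apply/eqP => E; have := away_src a; rewrite -E from_src eqxx.
    by rewrite !scale0r addr0.
  rewrite (bigD1 a) //= big1 => [|c ca].
    by rewrite TE /= cD_arrow eqxx scale1r addr0 => E; rewrite dT; apply: E.
  have /negPf ac : val c != val a by rewrite (inj_eq val_inj).
  by rewrite TE /= cD_arrow ac scale0r.
- have := congr1 (lstrip (val ba.2)) (T0 (val ba.1)).
  rewrite lstrip0 mut_sum [X in _ + X](_ : _ = 0) ?addr0; last first.
    by rewrite !big1 ?addr0 // => i _; rewrite TE cD0l.
  rewrite [X in X + _](_ : _ = 0) ?add0r; last first.
    rewrite big1 // => a _; rewrite TE /= cD_arrow.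
    have -> : (val a == val ba.1) = false.
      by apply/eqP => E; have := away_tgt a; rewrite E to_tgt eqxx.
    by rewrite scale0r.
  rewrite lstrip_sum (bigD1 ba) //= big1 ?addr0 => [|dc dcba].
    rewrite TE /= cDM !cD_arrow eqxx scale1r.
    have -> : (val ba.2 == val ba.1) = false.
      apply/eqP => E; case: (lf (a := val ba.1)); rewrite to_tgt -{1}E from_src.
      by split.
    rewrite scale0r addr0 => E.
    rewrite dT /=; move: E.
    have -> : idem K Q (tgt Q (val ba.1)) = idem K Q (src Q (val ba.2)).
      by rewrite to_tgt from_src.
    rewrite mulrA idem_arrow -mulrA lstrip_arrowM eqxx scale1r mulrA.
    by [].
  rewrite TE /= cDM !cD_arrow.
  have -> : (val dc.2 == val ba.1) = false.
    apply/eqP => E; case: (lf (a := val ba.1)); rewrite to_tgt -{1}E from_src.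
    by split.
  rewrite scale0r addr0 lstripZ.
  have -> : idem K Q (tgt Q (val ba.1)) = idem K Q (src Q (val dc.2)).
    by rewrite to_tgt from_src.
  have /negPf E : ~~ ((val dc.1 == val ba.1) && (val ba.2 == val dc.2)).
    rewrite !(inj_eq val_inj); apply: contra dcba => /andP[/eqP E1 /eqP E2].
    by rewrite [dc]surjective_pairing E1 -E2 -surjective_pairing.
  by rewrite mulrA idem_arrow -mulrA lstrip_arrowM scalerA -natrM mulnb E scale0r.
- by rewrite /dd cD_avoids ?rmorph0 //; apply: (br_starless f).1.
by rewrite /dd cD_avoids ?rmorph0 //; apply: (br_starless f).2.
Qed.

End Unbracket.

(** Cyclically equivalent representatives of a potential that avoid starting at
    k thus have premutations with the same Jacobian ideal. *)
Lemma br_dd_equiv (K : fieldType) (V : finType) (Q : quiver V) (k : V) (f g : cpalg K Q) :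
  loop_free_at Q k -> starts_off k f -> ends_off k f -> starts_off k g -> ends_off k g ->
  dd_equiv f g -> dd_equiv (mut_bracket (k := k) f) (mut_bracket (k := k) g).
Proof.
move=> lf fs fe gs ge fg m; apply/eqP; rewrite -subr_eq0 -ddB -brB; apply/eqP.
have [T cT TE] := unbr_exists K Q k.
apply: (br_dd0 lf cT TE) => [||a].
- by rewrite /starts_off mulrBr fs gs subrr.
- by rewrite /ends_off mulrBl fe ge subrr.
by rewrite ddB fg subrr.
Qed.

(** * Premutations of right-equivalent potentials *)

Section Premutation.
Variable K : fieldType.

Lemma cyclic_eltD (V : finType) (Q : quiver V) (f g : cpalg K Q) :
  cyclic_elt f -> cyclic_elt g -> cyclic_elt (f + g).
Proof.
move=> fc gc x s nz; have [f0|f0] := eqVneq (coef f x s) 0; last exact: fc.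
by apply: gc; rewrite coefD f0 add0r in nz.
Qed.

Lemma cyclic_elt_sum (V : finType) (Q : quiver V) I (r : seq I) (P : pred I)
    (F : I -> cpalg K Q) :
  (forall i, P i -> cyclic_elt (F i)) -> cyclic_elt (\sum_(i <- r | P i) F i).
Proof.
move=> Fc; elim/big_ind: _ => //; last exact: cyclic_eltD.
by move=> x s; rewrite coef0 eqxx.
Qed.

Lemma cyclic_sandwich (V : finType) (Q : quiver V) v (f : cpalg K Q) :
  idem K Q v * f * idem K Q v = f -> cyclic_elt f.
Proof.
move=> <- x s; rewrite coefM_idem coef_idemM.
case: (eqVneq (wend x s) v) => [->|_]; last by rewrite mul0r eqxx.
by case: (eqVneq x v) => [->//|_]; rewrite mul0r mulr0 eqxx.
Qed.

Lemma triangle_cyclic (V : finType) (Q : quiver V) (a b c : arr Q) :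
  tgt Q c = src Q a -> cyclic_elt (arrow_elt K a * arrow_elt K b * arrow_elt K c).
Proof.
move=> ca; apply: (@cyclic_sandwich _ _ (src Q a)).
by rewrite !mulrA idem_arrow -mulrA -ca arrow_idem.
Qed.

Lemma cyclicE (V : finType) (Q : quiver V) (f : cpalg K Q) : cyclic_elt f ->
  f = \sum_v idem K Q v * f * idem K Q v.
Proof.
move=> fc; apply: coefP => x s; rewrite coef_sum (bigD1 x) //= big1 => [|v vx].
  rewrite addr0 coefM_idem coef_idemM eqxx mul1r.
  have [->|/fc ->] := eqVneq (coef f x s) 0; first by rewrite mulr0.
  by rewrite eqxx mul1r.
by rewrite coefM_idem coef_idemM (eq_sym x) (negPf vx) mul0r mulr0.
Qed.

Lemma premutE (V : finType) (Q : quiver V) (k : V) (W : cpalg K Q) :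
  @premut K V Q k W = mut_bracket (k := k) W + @mut_cycles K V Q k.
Proof. by []. Qed.

Lemma mut_potential_off (V : finType) (Q : quiver V) (k : V) (W : cpalg K Q) :
  is_QP W -> (forall p, W p != 0 -> pstart p != k) -> starts_off k W /\ ends_off k W.
Proof.
move=> /cyclic_potential cW Wk.
have H s : coef W k s = 0.
  apply/eqP/negPn/negP => nz; have w : walk k s by apply: contraNT nz => /coef_notwalk ->.
  by have := Wk (exist _ (k, s) w); rewrite coefE /= => /(_ nz); rewrite /pstart eqxx.
split; apply: coefP => x s; rewrite coef0 ?coef_idemM ?coefM_idem.
  by case: eqP => [->|_]; rewrite ?H ?mulr0 ?mul0r.
have [->|nz] := eqVneq (coef W x s) 0; first by rewrite mulr0.
rewrite (cW _ _ nz); case: eqP => [xk|_]; last by rewrite mul0r.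
by rewrite xk H mulr0.
Qed.

Lemma premut_cyclic (V : finType) (Q : quiver V) (k : V) (W : cpalg K Q) :
  cyclic_elt W -> starts_off k W -> ends_off k W -> cyclic_elt (@premut K V Q k W).
Proof.
move=> cW ws we; rewrite premutE; apply: cyclic_eltD.
  rewrite (cyclicE cW) br_sum; apply: cyclic_elt_sum => v _.
  have [->|vk] := eqVneq v k.
    by rewrite ws mul0r br0 => x s; rewrite coef0 eqxx.
  apply: (@cyclic_sandwich _ _ v).
  rewrite -br_idemMl // -br_idemMr; last by rewrite mulrA; apply: ends_off_idem.
  by rewrite !mulrA idem_mul -mulrA idem_mul.
apply: cyclic_elt_sum => ba _.
exact: (@triangle_cyclic _ (mut_quiver Q k) (M_comp ba) (M_star ba.2) (M_costar ba.1)).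
Qed.

Variables (V V' : finType) (Q : quiver V) (Q' : quiver V').
Variables (k : V) (k' : V') (sigma : V -> V') (tau : V' -> V).
Variables (h : {rmorphism cpalg K Q -> cpalg K Q'}).
Variables (g : {rmorphism cpalg K Q' -> cpalg K Q}).
Hypotheses (ch : cont_hom sigma h) (cg : cont_hom tau g).
Hypotheses (hK : cancel h g) (gK : cancel g h).
Hypotheses (sK : cancel sigma tau) (tK : cancel tau sigma).
Hypothesis kk : sigma k = k'.

(** The map theta takes the bracket of W to that of h W, which may be replaced
    by that of W', and it preserves the cycles [ba]a^* b^* up to rotation. *)
Lemma premut_jac W W' : loop_free_at Q k -> loop_free_at Q' k' ->
  cyclic_elt W -> starts_off k W -> ends_off k W ->
  cyclic_elt W' -> starts_off k' W' -> ends_off k' W' ->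
  dd_equiv (h W) W' -> isomorphic (jacobian (@premut K V Q k W)) (jacobian (@premut K V' Q' k' W')).
Proof.
move=> lf lf' cW ws we cW' ws' we' hW.
have kk' : tau k' = k by rewrite -kk sK.
have [T cT TE] := theta_exists g lf ch sK tK kk.
have [S cS SE] := theta_exists h lf' cg tK sK kk'.
have TK := theta_inv lf lf' ch cg hK sK tK kk cT TE cS SE.
have SK := theta_inv lf' lf cg ch gK tK sK kk' cS SE cT TE.
apply: (jac_iso cT cS TK SK); [|exact: premut_cyclic|exact: premut_cyclic].
move=> m; rewrite !premutE rmorphD !ddD.
rewrite (theta_cycles lf ch cg gK sK kk TE); congr (_ + _).
rewrite (theta_br lf ch kk cT TE ws we); apply: br_dd_equiv => //.
  exact: (h_starts ch kk).
exact: (h_ends ch kk).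
Qed.

End Premutation.

(** * Lifting isomorphisms of truncated algebras *)

Section Unipotent.
Variables (K : fieldType) (V : finType) (Q : quiver V).
Variable h : {rmorphism cpalg K Q -> cpalg K Q}.
Hypotheses (ch : cont_hom id h).
Hypothesis h1 : forall a, ordge 2 (h (arrow_elt K a) - arrow_elt K a).

Lemma unipotent_ord n x : ordge n x -> ordge n.+1 (h x - x).
Proof.
elim: n x => [|n IHn] x xn.
  by apply/ordge1P => v; rewrite coefB (ch_nil _ _ ch) subrr.
rewrite [x]lstripE1; last exact: ordge_le xn.
rewrite rmorph_sum -sumrB; apply: ordge_sum => a _ /=; rewrite rmorphM.
have -> : h (arrow_elt K a) * h (lstrip a x) - arrow_elt K a * lstrip a x =
   (h (arrow_elt K a) - arrow_elt K a) * h (lstrip a x) +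
   arrow_elt K a * (h (lstrip a x) - lstrip a x).
  by rewrite mulrBl mulrBr addrA subrK.
apply: ordgeD.
  by apply: (@ordgeM _ _ _ 2 n) => //; apply: (ch_ord ch); apply: ordge_lstrip.
apply: (@ordgeM _ _ _ 1 n.+1); first exact: ordge_arrow.
by apply: IHn; apply: ordge_lstrip.
Qed.

Lemma unipotent_inj : injective h.
Proof.
move=> x y hxy; apply: ordge_eq => n; elim: n => [//|n IHn].
have := unipotent_ord IHn; rewrite rmorphB hxy subrr sub0r => /ordgeN.
by rewrite opprK.
Qed.

(** Successive approximation: correcting x by the defect y - h x raises the
    order of the defect. *)
Lemma unipotent_surj y : exists x, h x = y.
Proof.
pose u n := iter n (fun x => x + (y - h x)) (0 : cpalg K Q).
have uy n : ordge n (y - h (u n)).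
  elim: n => [//|n IHn]; rewrite /u iterS -/(u n) rmorphD opprD addrA.
  by apply: ordge_sym; apply: unipotent_ord IHn.
exists (lim u); apply: ordge_eq => n; apply: ordge_sym.
apply: (ordge_trans (uy n)); rewrite -rmorphB; apply: (ch_ord ch).
apply: ordge_sym; apply: limP => m; rewrite /u iterS addrAC subrr add0r.
exact: uy.
Qed.

End Unipotent.

Lemma inj_surj_bij (T T' : Type) (f : T -> T') :
  injective f -> (forall y, exists x, f x = y) -> bijective f.
Proof.
move=> fi fs; have [g gK] := choice fs; exists g => // x.
by apply: fi; rewrite gK.
Qed.

Section QuotientVertices.
Variables (K : fieldType) (V V' : finType) (R : quiver V) (R' : quiver V').
Variables (I : ideal (cp_kalg K R)) (I' : ideal (cp_kalg K R')).
Hypothesis I'1 : forall x, I' x -> ordge 1 x.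
Variable phi : {rmorphism quot_kalg I -> quot_kalg I'}.
Hypothesis phik : forall c, phi (kalg_str (quot_kalg I) c) = kalg_str (quot_kalg I') c.

Lemma quot_piZ (U : finType) (S : quiver U) (J : ideal (cp_kalg K S)) c (x : cpalg K S) :
  quot_pi J (c *: x) = kalg_str (quot_kalg J) c * quot_pi J x.
Proof.
have -> : c *: x = (@cp_str K U S c : cp_kalg K S) * (x : cp_kalg K S).
  by rewrite -[in LHS](mul1r x); apply: cp_scaleAl.
by rewrite (rmorphM (quot_pi J)).
Qed.

Lemma phiB (x y : cpalg K R) (x' y' : cpalg K R') :
  phi (quot_pi I x) = quot_pi I' x' -> phi (quot_pi I y) = quot_pi I' y' ->
  phi (quot_pi I (x - y)) = quot_pi I' (x' - y').
Proof. by move=> Ex Ey; rewrite (rmorphB (quot_pi I)) rmorphB Ex Ey -rmorphB. Qed.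

Lemma phiD (x y : cpalg K R) (x' y' : cpalg K R') :
  phi (quot_pi I x) = quot_pi I' x' -> phi (quot_pi I y) = quot_pi I' y' ->
  phi (quot_pi I (x + y)) = quot_pi I' (x' + y').
Proof. by move=> Ex Ey; rewrite (rmorphD (quot_pi I)) rmorphD Ex Ey -rmorphD. Qed.

Lemma phi_sum T (F : T -> cpalg K R) (F' : T -> cpalg K R') (r : seq T) :
  (forall i, phi (quot_pi I (F i)) = quot_pi I' (F' i)) ->
  phi (quot_pi I (\sum_(i <- r) F i)) = quot_pi I' (\sum_(i <- r) F' i).
Proof.
move=> E; elim: r => [|i r IHr]; first by rewrite !big_nil !rmorph0.
by rewrite !big_cons; apply: phiD.
Qed.

Lemma phiM (x y : cpalg K R) (x' y' : cpalg K R') :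
  phi (quot_pi I x) = quot_pi I' x' -> phi (quot_pi I y) = quot_pi I' y' ->
  phi (quot_pi I (x * y)) = quot_pi I' (x' * y').
Proof. by move=> Ex Ey; rewrite (rmorphM (quot_pi I)) rmorphM Ex Ey -rmorphM. Qed.

Lemma phiZ c (x : cpalg K R) (x' : cpalg K R') :
  phi (quot_pi I x) = quot_pi I' x' -> phi (quot_pi I (c *: x)) = quot_pi I' (c *: x').
Proof. by move=> E; rewrite !quot_piZ rmorphM phik E. Qed.

(** For a vertex v of R', taking the coefficient at v of a lift of phi x is a
    character of KR, which is a vertex of R by character_vertex. *)
Lemma vertex_map : exists tau : V' -> V, forall (x : cpalg K R) (x' : cpalg K R'),
  phi (quot_pi I x) = quot_pi I' x' -> forall v, coef x' v [::] = coef x (tau v) [::].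
Proof.
pose L (x : cpalg K R) : cpalg K R' := quot_repr (phi (quot_pi I x)).
have LE x : phi (quot_pi I x) = quot_pi I' (L x) by rewrite quot_reprK.
have Lu x x' v : phi (quot_pi I x) = quot_pi I' x' -> coef (L x) v [::] = coef x' v [::].
  rewrite LE => /quot_pi_eq/I'1/ordge1P/(_ v) /=; rewrite coefB => /eqP.
  by rewrite subr_eq0 => /eqP.
have tE v : exists w, forall x, coef (L x) v [::] = coef x w [::].
  have [chi chiE] : exists chi : {rmorphism cpalg K R -> K},
      chi =1 fun x => coef (L x) v [::].
    apply: rmorphism_of => [x y|].
      by rewrite -coefB; apply: Lu; apply: phiB.
    split=> [|x y].
      by rewrite (@Lu _ 1) ?coef_1 // !rmorph1.
    by rewrite -coefM_nil; apply: Lu; apply: phiM.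
  have [|w chiw] := @character_vertex _ _ _ chi.
    by move=> k x; rewrite !chiE -coefZ; apply/Lu/phiZ.
  by exists w => x; rewrite -chiE chiw.
have [tau tauE] := choice tE.
by exists tau => x x' E v; rewrite -tauE; symmetry; apply: Lu.
Qed.

Variable sigma : V -> V'.
Hypotheses (sbij : bijective sigma) (cI' : is_closed I').
Hypothesis phie : forall v,
  phi (quot_pi I (idem K R v)) = quot_pi I' (idem K R' (sigma v)).

(** Arrows are lifted arbitrarily between the right idempotents; by vertex_map
    the lifts have no constant part. The resulting homomorphism lifts phi up to
    the ideal plus any power of the radical, hence up to the closed ideal. *)
Lemma lift_hom : exists2 F : {rmorphism cpalg K R -> cpalg K R'},
  cont_hom sigma F & forall f, phi (quot_pi I f) = quot_pi I' (F f).
Proof.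
have [tau tauE] := vertex_map.
pose y a : cpalg K R' := idem K R' (sigma (src R a)) *
  quot_repr (phi (quot_pi I (arrow_elt K a))) * idem K R' (sigma (tgt R a)).
have yE a : phi (quot_pi I (arrow_elt K a)) = quot_pi I' (y a).
  have E : arrow_elt K a = idem K R (src R a) * arrow_elt K a * idem K R (tgt R a).
    by rewrite idem_arrow arrow_idem.
  rewrite {1}E; apply: phiM; last exact: phie.
  by apply: phiM; [exact: phie|rewrite quot_reprK].
have [//|a|a|a|F cF FE] := @hom_exists _ _ _ R R' sigma y.
- by apply/ordge1P => v; rewrite (tauE _ _ (yE a)) coef_arrow andbF.
- by rewrite /y !mulrA idem_mul.
- by rewrite /y -!mulrA idem_mul.
exists F => // f.
have P n g : exists2 z : cpalg K R', ordge n z &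
    phi (quot_pi I g) = quot_pi I' (F g + z).
  elim: n g => [|n IHn] g.
    exists (quot_repr (phi (quot_pi I g)) - F g) => //.
    by rewrite addrC subrK quot_reprK.
  have zE a : exists z : cpalg K R', ordge n z /\
      phi (quot_pi I (lstrip a g)) = quot_pi I' (F (lstrip a g) + z).
    by have [z] := IHn (lstrip a g); exists z.
  have [z zP] := choice zE.
  exists (\sum_a y a * z a).
    apply: ordge_sum => a _; apply: (@ordgeM _ _ _ 1 n); last by have [] := zP a.
    by rewrite -FE; apply: chJ cF _.
  have -> : F g + \sum_a y a * z a = \sum_v coef g v [::] *: idem K R' (sigma v) +
      \sum_a y a * (F (lstrip a g) + z a).
    rewrite (chE _ cF) -addrA -big_split; congr (_ + _).
    by apply: eq_bigr => a _; rewrite /= FE mulrDr.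
  rewrite {1}[g]lstripE; apply: phiD.
    by apply: phi_sum => v; apply: phiZ.
  apply: phi_sum => a.
  by apply: phiM => //; have [] := zP a.
rewrite -[phi _]quot_reprK; apply/quot_pi_eq; apply: (ciC cI') => n.
have [z zn zE] := P n f.
exists (quot_repr (phi (quot_pi I f)) - (F f + z)).
  by apply/quot_pi_eq; rewrite quot_reprK zE.
set u := quot_repr _; have -> : u - F f - (u - (F f + z)) = z; last exact: zn.
by rewrite opprB addrC subrKA addrC addKr.
Qed.

End QuotientVertices.

Lemma conj_rmorphism (A B : pzRingType) (f : {rmorphism A -> B}) (u w : B) :
  u * w = 1 -> w * u = 1 -> exists g : {rmorphism A -> B}, forall x, g x = u * f x * w.
Proof.
move=> uw wu; apply: rmorphism_of => [x y|]; first by rewrite rmorphB mulrBr mulrBl.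
split=> [|x y]; first by rewrite rmorph1 mulr1.
by rewrite rmorphM !mulrA -[u * f x * w * u]mulrA wu mulr1.
Qed.

Lemma qpiM (K : fieldType) (U : finType) (S : quiver U) (J : ideal (cp_kalg K S))
    (x y : cpalg K S) :
  quot_pi J (x * y : cpalg K S) = quot_pi J x * quot_pi J y.
Proof. exact: rmorphM (quot_pi J) _ _. Qed.

Section VertexBijection.
Variables (K : fieldType) (V V' : finType) (R : quiver V) (R' : quiver V').
Variables (I : ideal (cp_kalg K R)) (I' : ideal (cp_kalg K R')).
Hypothesis I1 : forall x, I x -> ordge 1 x.
Hypothesis I'1 : forall x, I' x -> ordge 1 x.
Variable phi : {rmorphism quot_kalg I -> quot_kalg I'}.
Hypothesis phii : alg_iso phi.

Lemma vertex_bij : exists (sigma : V -> V') (tau : V' -> V),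
  [/\ cancel sigma tau, cancel tau sigma
    & forall (x : cpalg K R) (x' : cpalg K R'),
      phi (quot_pi I x) = quot_pi I' x' ->
      forall v, coef x' v [::] = coef x (tau v) [::]].
Proof.
have [psi [psii phiK psiK]] := alg_iso_inv phii.
have [tau tauE] := vertex_map I'1 phii.1.
have [sigma sigmaE] := vertex_map I1 psii.1.
have idem_eq (U : finType) (S : quiver U) (v w : U) :
    coef (idem K S v) w [::] = coef (idem K S v) v [::] -> w = v.
  rewrite !coef_idem eqxx andbT; case: eqP => // _ /eqP.
  by rewrite eq_sym oner_eq0.
exists sigma, tau; split=> // v.
  have [x' E] := quot_piP (phi (quot_pi I (idem K R v))).
  apply: (@idem_eq _ R); rewrite -(tauE _ _ E); symmetry.
  by apply: (sigmaE x'); rewrite -E phiK.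
have [x E] := quot_piP (psi (quot_pi I' (idem K R' v))).
apply: (@idem_eq _ R'); rewrite -(sigmaE _ _ E); symmetry.
by apply: tauE; rewrite -E psiK.
Qed.

Variables (sigma : V -> V') (tau : V' -> V).
Hypotheses (sK : cancel sigma tau) (tK : cancel tau sigma).
Hypothesis tauE : forall (x : cpalg K R) (x' : cpalg K R'),
  phi (quot_pi I x) = quot_pi I' x' -> forall v, coef x' v [::] = coef x (tau v) [::].

(** The unit u = sum of the e_(sigma v) phi(e_v), which is 1 modulo the radical,
    conjugates one complete family of orthogonal idempotents into the other. *)
Lemma normalize_idem : exists2 phi2 : {rmorphism quot_kalg I -> quot_kalg I'},
  alg_iso phi2 &
  forall v, phi2 (quot_pi I (idem K R v)) = quot_pi I' (idem K R' (sigma v)).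
Proof.
pose E v : cpalg K R' := quot_repr (phi (quot_pi I (idem K R v))).
have EE v : phi (quot_pi I (idem K R v)) = quot_pi I' (E v) by rewrite quot_reprK.
pose u := \sum_v idem K R' (sigma v) * E v.
(* The constant part of u is 1, as E v has constant part idem (sigma v). *)
have [v|w [wu uw]] := @unit_of _ _ _ u.
  rewrite coef_sum (bigD1 (tau v)) //= coefM_nil coef_idem tK eqxx mul1r.
  rewrite (tauE (EE _)) coef_idem eqxx big1 ?addr0 // => x xv.
  rewrite coefM_nil coef_idem andbT -[v]tK (inj_eq (can_inj sK)) eq_sym.
  by rewrite (negPf xv) mul0r.
have uw' : quot_pi I' u * quot_pi I' w = 1 by rewrite -rmorphM uw rmorph1.
have wu' : quot_pi I' w * quot_pi I' u = 1 by rewrite -rmorphM wu rmorph1.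
have [phi2 phi2E] := conj_rmorphism phi uw' wu'.
have EM x v : quot_pi I' (E x * E v : cpalg K R') = quot_pi I' ((x == v)%:R *: E v).
  rewrite -(phiM (EE x) (EE v)) idemM (phiZ phii.1 _ (EE x)).
  by case: eqP => [->|_]; rewrite ?scale0r.
have uE v : quot_pi I' u * quot_pi I' (E v) = quot_pi I' (idem K R' (sigma v) * E v).
  rewrite -qpiM /u mulr_suml.
  transitivity (quot_pi I' (\sum_(x : V) (x == v)%:R *: (idem K R' (sigma v) * E v))).
    rewrite !(rmorph_sum (quot_pi I')); apply: eq_bigr => x _ /=.
    rewrite -mulrA qpiM EM -qpiM cp_scalerAr.
    by case: eqP => [->|_]; rewrite ?scale1r // !scale0r.
  congr (quot_pi _ _); rewrite (bigD1 v) //= eqxx scale1r big1 ?addr0 // => x /negPf ->.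
  by rewrite scale0r.
have eu v : quot_pi I' (idem K R' (sigma v)) * quot_pi I' u =
    quot_pi I' (idem K R' (sigma v) * E v).
  rewrite -qpiM; congr (quot_pi _ _).
  rewrite /u mulr_sumr (bigD1 v) //= mulrA idem_mul big1 ?addr0 // => x xv.
  by rewrite mulrA idemM (inj_eq (can_inj sK)) eq_sym (negPf xv) scale0r mul0r.
exists phi2 => [|v].
  have [phik [psi phiK psiK]] := phii.
  split=> [c|].
    rewrite phi2E phik.
    transitivity (quot_pi I' u * quot_pi I' w * kalg_str (quot_kalg I') c).
      by rewrite -!mulrA; congr (_ * _); apply: (@kalg_central _ (quot_kalg I')).
    by rewrite uw' mul1r.
  exists (fun y => psi (quot_pi I' w * y * quot_pi I' u)) => y.
    rewrite phi2E -!mulrA wu' mulr1 mulrA wu' mul1r; exact: phiK.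
  rewrite phi2E psiK -!mulrA uw' mulr1 mulrA uw' mul1r.
  by [].
by rewrite phi2E EE uE -eu -mulrA uw' mulr1.
Qed.

End VertexBijection.

Section LiftIso.
Variables (K : fieldType) (V V' : finType) (R : quiver V) (R' : quiver V').
Variables (I : ideal (cp_kalg K R)) (I' : ideal (cp_kalg K R')).
Hypotheses (cI : is_closed I) (cI' : is_closed I').
Hypothesis I2 : forall x, I x -> ordge 2 x.
Hypothesis I'2 : forall x, I' x -> ordge 2 x.
Variable phi : {rmorphism quot_kalg I -> quot_kalg I'}.
Hypothesis phii : alg_iso phi.

(** The composite is the identity modulo J, in particular modulo the square of
    the radical. *)
Lemma comp_unipotent (U U' : finType) (S : quiver U) (S' : quiver U')
    (J : ideal (cp_kalg K S)) s t (F : {rmorphism cpalg K S -> cpalg K S'})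
    (G : {rmorphism cpalg K S' -> cpalg K S}) :
  (forall x, J x -> ordge 2 x) -> cancel s t -> cont_hom s F -> cont_hom t G ->
  (forall x, quot_pi J (G (F x)) = quot_pi J x) ->
  injective F /\ (forall y, exists x, G x = y).
Proof.
move=> J2 sK cF cG GF.
have cc : cont_hom id (G \o F : {rmorphism cpalg K S -> cpalg K S}).
  exact: cont_hom_comp cF cG sK.
have c2 a : ordge 2 ((G \o F : {rmorphism cpalg K S -> cpalg K S}) (arrow_elt K a)
    - arrow_elt K a).
  by apply/J2/quot_pi_eq; apply: GF.
split=> [x y xy|y].
  by apply: (unipotent_inj cc c2); rewrite /= xy.
by have [x xy] := unipotent_surj cc c2 y; exists (F x).
Qed.

(** The lift G of the inverse need not be inverse to F; it only shows that F is
    bijective, and is then replaced by the inverse of F. *)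
Lemma lift_iso : exists (sigma : V -> V') (tau : V' -> V)
    (F : {rmorphism cpalg K R -> cpalg K R'}) (G : {rmorphism cpalg K R' -> cpalg K R}),
  [/\ cancel sigma tau /\ cancel tau sigma, cont_hom sigma F /\ cont_hom tau G,
      cancel F G /\ cancel G F, forall x, I x <-> I' (F x)
    & forall (x : cpalg K R) (x' : cpalg K R'), phi (quot_pi I x) = quot_pi I' x' ->
      forall v, coef x' v [::] = coef x (tau v) [::]].
Proof.
have I1 x : I x -> ordge 1 x by move=> /I2; apply: ordge_le.
have I'1 x : I' x -> ordge 1 x by move=> /I'2; apply: ordge_le.
have [sigma [tau [sK tK tauE]]] := vertex_bij I1 I'1 phii.
have [ph [phk phb] phe] := normalize_idem phii sK tK tauE.
have [ps [[psk _] phK psK]] := alg_iso_inv (conj phk phb : alg_iso ph).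
have pse v : ps (quot_pi I' (idem K R' v)) = quot_pi I (idem K R (tau v)).
  by rewrite -[v in LHS]tK -phe phK.
have [|F cF FE] := lift_hom I'1 phk _ cI' phe; first by exists tau.
have [|G cG GE] := lift_hom I1 psk _ cI pse; first by exists sigma.
have [Fi Gs] : injective F /\ (forall y, exists x, G x = y).
  by apply: (comp_unipotent I2 sK cF cG) => x; rewrite -GE -FE phK.
have [Gi Fs] : injective G /\ (forall y, exists x, F x = y).
  by apply: (comp_unipotent I'2 tK cG cF) => x; rewrite -FE -GE psK.
have Fb := inj_surj_bij Fi Fs.
have Fa : @alg_iso K (cp_kalg K R) (cp_kalg K R') F.
  by split=> // c; rewrite /= /cp_str (chZ cF) rmorph1.
have [H [cH FK HK]] := alg_iso_cont_inv Fa (chI cF) tK.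
exists sigma, tau, F, H; split=> // x; rewrite -!quot_pi0 -FE.
split=> [->|]; first by rewrite rmorph0.
by move=> E; rewrite -[quot_pi I x]phK E rmorph0.
Qed.

End LiftIso.

(** * Cuts *)

Section Cut.
Variables (K : fieldType) (V : finType) (Q : quiver V) (C : {set arr Q}).
Local Notation Qc := (cut_quiver C).

Definition cut_inc (a : arr Qc) : arr Q := val a.
Definition cut_part (b : arr Q) : option (seq (arr Qc)) :=
  omap (fun a => [:: a]) (insub b).

Lemma cut_embedding : embedding cut_inc cut_part.
Proof.
split=> // [a|b bN]; first by rewrite /cut_part valK.
rewrite /cut_part; case: insubP => // a _ ab; case: (bN a).
by rewrite -ab.
Qed.

Definition cdeg n (f : cpalg K Q) :=
  forall x s, coef f x s != 0 -> count (mem C) s = n.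

Lemma cdegD n f g : cdeg n f -> cdeg n g -> cdeg n (f + g).
Proof.
move=> fn gn x s; rewrite coefD => nz.
have [f0|] := eqVneq (coef f x s) 0; last exact: fn.
by apply: (gn x); rewrite f0 add0r in nz.
Qed.

Lemma cdeg0 n : cdeg n 0.
Proof. by move=> x s; rewrite coef0 eqxx. Qed.

Lemma cdeg_sum n I (r : seq I) (P : pred I) (F : I -> cpalg K Q) :
  (forall i, P i -> cdeg n (F i)) -> cdeg n (\sum_(i <- r | P i) F i).
Proof. by move=> Fn; elim/big_ind: _ => //; [exact: cdeg0|exact: cdegD]. Qed.

Lemma cdegM m n f g : cdeg m f -> cdeg n g -> cdeg (m + n) (f * g).
Proof.
move=> fm gn x s; rewrite coefM => nz.
have [i nzi] : exists i : 'I_(size s).+1,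
    coef f x (take i s) * coef g (wend x (take i s)) (drop i s) != 0.
  apply: contrapT => /forallNP N; case/eqP: nz; apply: big1 => i _.
  by apply/eqP/negPn/negP/N.
have f0 : coef f x (take i s) != 0 by apply: contra_neq nzi => ->; rewrite mul0r.
have g0 : coef g (wend x (take i s)) (drop i s) != 0.
  by apply: contra_neq nzi => ->; rewrite mulr0.
by rewrite -(cat_take_drop i s) count_cat (fm _ _ f0) (gn _ _ g0).
Qed.

Lemma cdeg_idem v : cdeg 0 (idem K Q v).
Proof.
by move=> x [|a s]; rewrite coef_idem ?andbF ?eqxx.
Qed.

Lemma cdeg_arrow a : cdeg (a \in C) (arrow_elt K a).
Proof.
move=> x s; rewrite coef_arrow; case: (eqVneq s [:: a]) => [-> _|_].
  by rewrite /= addn0.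
by rewrite andbF eqxx.
Qed.

Lemma cdeg_ordge1 n f : cdeg n.+1 f -> ordge 1 f.
Proof.
move=> fn; apply/ordge1P => v; apply/eqP/negPn/negP => /fn.
by [].
Qed.

Lemma cdeg_lstrip n a f : cdeg n f -> cdeg (n - (a \in C)) (lstrip a f).
Proof.
move=> fn x s; rewrite coef_lstrip; case: ifP => [_ /fn <-|]; last by rewrite eqxx.
by rewrite /= addKn.
Qed.

Lemma cdeg_lstrip0 a f : a \in C -> cdeg 0 f -> lstrip a f = 0.
Proof.
move=> aC f0; apply: coefP => x s; rewrite coef0 coef_lstrip; case: ifP => // _.
by apply/eqP/negPn/negP => /f0; rewrite /= aC.
Qed.

Lemma cdeg_avoids c f : c \in C -> cdeg 0 f -> avoids c f.
Proof.
move=> cC f0 v u t; apply/eqP/negPn/negP => /f0.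
by rewrite count_cat /= cC addnCA.
Qed.

Variables (io : {rmorphism cpalg K Qc -> cpalg K Q}).
Hypotheses (cio : cont_hom id io)
  (ioE : forall a, io (arrow_elt K a) = arrow_elt K (cut_inc a)).

Lemma cdeg_io f : cdeg 0 (io f).
Proof.
move=> x s nz; apply/eqP; rewrite -leqn0 leqNgt -has_count; apply/hasP => -[c cs cC].
have ca a : c <> cut_inc a.
  by move=> ca; have := valP a; rewrite -/(cut_inc a) -ca => /negP; apply.
have /avoidsP H := embed_avoids cut_embedding f cio ioE ca.
by case/eqP: nz; apply: H.
Qed.

Definition cut_restrict (f : cpalg K Q) : cpalg K Qc :=
  pull (Q' := Qc) (fun a => Some [:: val a]) f.

Lemma walk_cut x s : walk (Q := Qc) x s = walk x (map val s).
Proof. by elim: s x => //= a s IHs x; rewrite IHs. Qed.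

Lemma coef_restrict f x s : coef (cut_restrict f) x s = coef f x (map val s).
Proof.
rewrite coef_of walk_cut.
have -> : all (isSome \o (fun a : arr Qc => Some [:: val a])) s by apply/allP.
have -> : flatten (pmap (fun a : arr Qc => Some [:: val a]) s) = map val s.
  by elim: s => //= a s ->.
by case: ifPn => // /coef_notwalk ->.
Qed.

(** Restricting to the paths without arrows of the cut loses nothing of f. *)
Lemma io_restrict f : cdeg 0 f -> io (cut_restrict f) = f.
Proof.
move=> f0; apply: ordge_eq => n; elim: n f f0 => [//|n IHn] f f0.
rewrite (chE _ cio) {3}[f]lstripE opprD addrACA.
rewrite [X in X + _](_ : _ = 0) ?add0r; last first.
  apply/eqP; rewrite subr_eq0; apply/eqP; apply: eq_bigr => v _.
  by rewrite coef_restrict.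
rewrite [X in _ - X](bigID (fun a => a \notin C)) /= [X in _ - (_ + X)]big1 ?addr0; last first.
  by move=> a; rewrite negbK => aC; rewrite cdeg_lstrip0 // mulr0.
rewrite (big_sub [pred a | a \notin C]) /= -sumrB; apply: ordge_sum => a _.
rewrite ioE -mulrBr; apply: (@ordgeM _ _ _ 1 n); first exact: ordge_arrow.
have -> : lstrip (a : arr Qc) (cut_restrict f) = cut_restrict (lstrip (val a) f).
  by apply: coefP => y s; rewrite coef_lstrip !coef_restrict coef_lstrip.
by apply: IHn; have := @cdeg_lstrip 0 (val a) _ f0; rewrite sub0n.
Qed.

Variable W : cpalg K Q.
Hypotheses (cW : cyclic_elt W) (cutW : is_cut W C).

Lemma cut_cdeg : cdeg 1 W.
Proof.
move=> x s nz; have w : walk x s by apply: contraNT nz => /coef_notwalk ->.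
by have := cutW (p := exist _ (x, s) w); rewrite coefE /=; apply.
Qed.

Lemma dd_cdeg w c : cdeg 1 w -> c \in C -> cdeg 0 (dd c w).
Proof.
move=> w1 cC x s; rewrite coef_cD; case: ifP => [_|]; last by rewrite eqxx.
move=> nz; have [i nzi] : exists i : 'I_(size s).+1,
    coef (1 * rsuffix (c :: take i s) w) (wend x (take i s)) (drop i s) != 0.
  apply: contrapT => /forallNP N; case/eqP: nz; apply: big1 => i _.
  by apply/eqP/negPn/negP/N.
move: nzi; rewrite mul1r coef_rsuffix => /w1; rewrite count_cat /= cC addnCA add1n => -[].
by rewrite addnC -count_cat cat_take_drop.
Qed.

Lemma io_cut_deriv c : c \in C -> io (@cut_deriv K V Q W C c) = dd c W.
Proof.
move=> cC; rewrite /cut_deriv dd_cderiv //.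
by apply: io_restrict; apply: dd_cdeg cC; apply: cut_cdeg.
Qed.

(** Each path of w contains exactly one arrow c of the cut, so w z can be
    rotated to begin with c. Stripping arrows one at a time: an arrow outside of
    the cut moves to z, and an arrow of the cut is already in front. *)
Lemma cut_euler b w z : cdeg 1 w ->
  dd b (\sum_(c in C) arrow_elt K c * cD c w z) = dd b (w * z).
Proof.
move=> w1; apply/eqP; rewrite -subr_eq0; apply/eqP; apply: ordge_eq => n.
rewrite subr0.
suff H m u y : cdeg 1 u -> ordge m y -> ordge (n + m)
    (dd b (\sum_(c in C) arrow_elt K c * cD c u y) - dd b (u * y)).
  by have := H 0%N w z w1 (@ordge0 _ _ _ z); rewrite addn0.
elim: n m {w w1 z} u y => [|n IHn] m w z w1 zm.
  rewrite -ddB; apply: ordge_dd; apply: ordgeB.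
    apply: ordge_sum => c _; apply: (@ordgeM _ _ _ 1 m); first exact: ordge_arrow.
    exact: ordge_cDr.
  by apply: (@ordgeM _ _ _ 1 m) => //; apply: cdeg_ordge1 w1.
have wE := lstripE1 (cdeg_ordge1 w1).
have -> : dd b (\sum_(c in C) arrow_elt K c * cD c w z) - dd b (w * z) =
   \sum_a (dd b (\sum_(c in C) arrow_elt K c * cD c (arrow_elt K a * lstrip a w) z)
     - dd b (arrow_elt K a * lstrip a w * z)).
  rewrite sumrB -!dd_sum -mulr_suml -wE exchange_big /=; congr (dd b _ - _).
  by apply: eq_bigr => c _; rewrite -mulr_sumr -cD_suml -wE.
apply: ordge_sum => a _; have [aC|aC] := boolP (a \in C).
  have l0 : cdeg 0 (lstrip a w) by have := @cdeg_lstrip 1 a _ w1; rewrite aC subnn.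
  rewrite (bigD1 a) //= big1 ?addr0 => [|c /andP[cC ca]].
    rewrite cDM cD_arrow eqxx scale1r (cD_avoids _ (cdeg_avoids aC l0)) addr0.
    rewrite !mulrA arrow_idem dd_cycle !mulrA idem_arrow subrr.
    exact: ordge_0.
  by rewrite cDM cD_arrow eq_sym (negPf ca) scale0r add0r
     (cD_avoids _ (cdeg_avoids cC l0)) mulr0.
have l1 : cdeg 1 (lstrip a w) by have := @cdeg_lstrip 1 a _ w1; rewrite (negPf aC).
rewrite -mulrA [dd b (arrow_elt K a * _)]dd_cycle -mulrA addSnnS.
rewrite (eq_bigr (fun c => arrow_elt K c * cD c (lstrip a w) (z * arrow_elt K a))).
  by apply: IHn => //; apply: ordge_arrowM.
move=> c cC; rewrite cDM cD_arrow; case: eqP => [ac|_]; last by rewrite scale0r add0r.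
by rewrite ac cC in aC.
Qed.

Lemma cut_potential : dd_equiv (\sum_(c in C) arrow_elt K c * dd c W) W.
Proof. by move=> b; rewrite (cut_euler b 1 cut_cdeg) mulr1. Qed.

Hypothesis minW : forall c, c \in C ->
  ~ closed_ideal [set f | exists2 c', (c' \in C) && (c' != c)
                        & f = @cut_deriv K V Q W C c'] (@cut_deriv K V Q W C c).

(** Minimality is given in the path algebra of Q_C; the retraction killing C
    brings a relation between derivatives back to it. *)
Lemma cut_minimal c0 : c0 \in C ->
  ~ closed_ideal [set f | exists2 c', (c' \in C) && (c' != c0) & f = dd c' W] (dd c0 W).
Proof.
move=> c0C; have [r cr [rio _]] := retract_exists K cut_embedding.
have rK := retract_embed cio cr ioE rio.
move=> /(closed_ideal_min (ch_closed cr (closed_ideal_closed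
   [set f | exists2 c', (c' \in C) && (c' != c0) & f = @cut_deriv K V Q W C c']))) H.
apply: (minW c0C); rewrite -[@cut_deriv K V Q W C c0]rK (io_cut_deriv c0C).
apply: H => _ [c /andP[cC cc0] ->]; rewrite -(io_cut_deriv cC) rK.
by apply: closed_ideal_gen; exists c => //; rewrite cC.
Qed.

(** The operation cD b f loses one in order only on the linear part of f. *)
Lemma ordge_cD_lin b (f y : cpalg K Q) m : ordge 1 f -> coef f (src Q b) [:: b] = 0 ->
  ordge m y -> ordge m.+1 (cD b f y).
Proof.
move=> f1 fb ym; rewrite cD_lstrip; apply: ordgeD.
  apply: ordgeMl; apply: ordgeMr; apply: (@ordgeM _ _ _ 1 m) => //.
  by apply/ordge1P => v; rewrite coef_lstrip fb if_same.
by apply: ordge_sum => a _; apply/ordge_cDr/ordge_arrowM.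
Qed.

(** If the matrix of the linear parts of the eta c on the arrows of C were not
    the identity, say at (c2, c0), the equation for c2 would express a nonzero
    multiple of dd c0 W by the other derivatives and by terms of the form u (dd c0
    W) v of higher order. Iterating, dd c0 W would lie in the closed ideal generated
    by the others. *)
Lemma cut_unipotent (eta : arr Q -> cpalg K Q) :
  (forall c, c \in C -> cdeg 1 (eta c)) ->
  (forall c, c \in C -> idem K Q (src Q c) * eta c * idem K Q (tgt Q c) = eta c) ->
  (forall c2, c2 \in C -> \sum_(c in C) cD c2 (eta c) (dd c W) = dd c2 W) ->
  forall c, c \in C -> ordge 2 (eta c - arrow_elt K c).
Proof.
move=> eta1 etae etaW c0 c0C.
have lin c2 : c2 \in C -> coef (eta c0) (src Q c2) [:: c2] = (c0 == c2)%:R.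
  move=> c2C; set mu := coef _ _ _.
  apply/eqP/negPn/negP => numu.
  have nu0 : (c0 == c2)%:R - mu != 0 by rewrite subr_eq0 eq_sym.
  set nu := _ - mu in nu0.
  pose S := [set f | exists2 c', (c' \in C) && (c' != c0) & f = dd c' W].
  have cI := closed_ideal_closed S.
  set I : cpalg K Q -> Prop := closed_ideal S in cI.
  apply: (cut_minimal c0C); rewrite -/S -[closed_ideal S _]/(I (dd c0 W)).
  have IR c : c \in C -> c != c0 -> I (dd c W).
    by move=> cC cc; apply: closed_ideal_gen; exists c => //; rewrite cC.
  pose th := eta c0 - mu *: arrow_elt K c2.
  have thy y m : ordge m y -> ordge m.+1 (cD c2 th y).
    apply: ordge_cD_lin.
      by apply: ordgeB; [exact: cdeg_ordge1 (eta1 _ c0C)|apply/ordgeZ/ordge_arrow].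
    by rewrite coefB coefZ coef_arrow !eqxx mulr1 subrr.
  have E1 : I (dd c2 W - (mu *: (idem K Q (tgt Q c2) * dd c0 W * idem K Q (src Q c2))
      + cD c2 th (dd c0 W))).
    rewrite -{1}(etaW _ c2C) (bigD1 c0) //=.
    have -> : eta c0 = mu *: arrow_elt K c2 + th by rewrite addrC subrK.
    rewrite cDDl cDZl cD_arrow eqxx scale1r addrAC subrr add0r.
    apply: (@ci_sum _ _ _ I _ _ _ _ cI) => c /andP[cC cc].
    by apply: (cD_closed _ _ cI (IR _ cC cc)).
  (* If mu is nonzero, eta c0 contains the arrow c2, so c0 and c2 are parallel. *)
  have E2 : I (nu *: dd c0 W - cD c2 th (dd c0 W)).
    move: E1; case: (eqVneq c0 c2) => [c02|c02] E1.
      have -> : nu = 1 - mu by rewrite /nu c02 eqxx.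
      move: E1; rewrite -c02 /dd cD_sandwich => E1.
      by rewrite scalerBl scale1r -addrA -opprD.
    have numu' : nu = - mu by rewrite /nu (negPf c02) sub0r.
    have mu0 : mu != 0 by move: nu0; rewrite numu' oppr_eq0.
    have [cs ct] : src Q c2 = src Q c0 /\ tgt Q c2 = tgt Q c0.
      split; apply/eqP; apply: contraNT mu0 => /negPf ne;
        by rewrite /mu -(etae _ c0C) coefM_idem coef_idemM /wend /= ne ?mul0r ?mulr0.
    have := ciB cI E1 (IR _ c2C _); rewrite eq_sym c02 => /(_ isT).
    rewrite addrAC subrr add0r opprD cs ct /dd cD_sandwich numu' scaleNr.
    by [].
  apply: (ciC cI); elim=> [|n [g Ig gn]].
    by exists 0; [exact: (ci0 cI)|].
  exists (nu^-1 *: (nu *: dd c0 W - cD c2 th (dd c0 W)) + nu^-1 *: cD c2 th g).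
    by apply: (ciD cI); apply: (ciZ _ cI) => //; apply: (cD_closed _ _ cI).
  rewrite scalerBr scalerA mulVf // scale1r -addrA opprD addrA subrr sub0r.
  rewrite opprD opprK -scalerN -scalerDr; apply: ordgeZ.
  by rewrite -cDNr -cDDr; apply: thy.
move=> x s; case: s => [|a [|//]] _; rewrite coefB coef_arrow.
  by rewrite andbF subr0; apply: (cdeg_ordge1 (eta1 _ c0C)).
have [aC|aC] := boolP (a \in C); last first.
  rewrite (_ : coef _ _ _ = 0); last first.
    by apply/eqP/negPn/negP => /(eta1 _ c0C) /=; rewrite (negPf aC).
  have /negPf ac : a != c0 by apply: contraNneq aC => ->.
  by rewrite eqseq_cons ac andbF subrr.
rewrite eqseq_cons andbT.
have [xa|xa] := eqVneq x (src Q a); last first.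
  rewrite coef_notwalk /=; last by rewrite eq_sym (negPf xa).
  by case: (eqVneq a c0) xa => [->|_]; [move=> /negPf -> | rewrite andbF]; rewrite subrr.
rewrite xa (lin _ aC) (eq_sym c0); case: (eqVneq a c0) => [->|_].
  by rewrite eqxx subrr.
by rewrite andbF subrr.
Qed.

End Cut.

(** * Expanding relations *)

Section Nilpotent.
Variables (K : fieldType) (V : finType) (R : quiver V) (I : ideal (cp_kalg K R)).
Hypotheses (cI : is_closed I) (fI : finite_dim (quot_kalg I)).

Lemma qpi_sum T (r : seq T) (F : T -> cpalg K R) :
  quot_pi I (\sum_(i <- r) F i) = \sum_(i <- r) quot_pi I (F i).
Proof. exact: (rmorph_sum (quot_pi I)). Qed.

Lemma finite_span : exists n (w : 'I_n -> cpalg K R), forall f, exists l : 'I_n -> K,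
  I (f - \sum_(i < n) l i *: w i).
Proof.
have [n [v vE]] := fI; exists n, (fun i => quot_repr (v i)) => f.
have [l lE] := vE (quot_pi I f); exists l; apply/quot_pi_eq.
rewrite lE qpi_sum; apply: eq_bigr => i _.
by rewrite quot_piZ quot_reprK.
Qed.

(** Otherwise there is for each k an element X k of order k that is not of order
    k.+1 modulo I. In a quotient spanned by n elements X 0, ..., X n satisfy a
    linear relation, and its first nonzero coefficient la 0 k gives X k order k.+1
    modulo I. *)
Lemma radical_stable : exists k, forall x, ordge k x ->
  exists2 y, ordge k.+1 y & I (x - y).
Proof.
have [n [w wE]] := finite_span.
apply: contrapT => /forallNP N.
have XE k : exists x, ordge k x /\ forall y, ordge k.+1 y -> ~ I (x - y).
  apply: contrapT => /forallNP Nx; apply: (N k) => x xk.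
  apply: contrapT => Ny; apply: (Nx x); split=> // y yk Ixy.
  by apply: Ny; exists y.
(* A row of coefficients annihilating n.+1 vectors of length n. *)
have [X XP] := choice XE; have [L LP] := choice (fun k => wE (X k)).
pose M := \matrix_(k < n.+1, i < n) L k i.
have kM0 : kermx M != 0.
  rewrite -mxrank_eq0 mxrank_ker subn_eq0 -ltnNge ltnS.
  exact: rank_leq_col.
pose la := nz_row (kermx M).
have la0 : la != 0 by rewrite nz_row_eq0.
have laM : la *m M = 0.
  have /submxP[D ->] : (la <= kermx M)%MS by apply: nz_row_sub.
  by rewrite -mulmxA mulmx_ker mulmx0.
have IlX : I (\sum_(k < n.+1) la 0 k *: X k).
  have : I (\sum_(k < n.+1) la 0 k *: (X k - \sum_(i < n) L k i *: w i)).
    by apply: (@ci_sum _ _ _ I _ _ _ _ cI) => k _; apply: (ciZ _ cI (LP k)).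
  under eq_bigr do rewrite scalerBr scaler_sumr.
  rewrite sumrB exchange_big [X in _ - X]big1 ?subr0 // => i _.
  under eq_bigr do rewrite scalerA.
  rewrite -scaler_suml (_ : \sum_(k < n.+1) _ = 0) ?scale0r //.
  have := congr1 (fun A : 'rV_n => A 0 i) laM; rewrite !mxE => E; rewrite -[RHS]E.
  by apply: eq_bigr => k _; rewrite mxE.
have [k0 lk0] : exists k, la 0 k != 0.
  apply: contrapT => /forallNP Z; case/eqP: la0; apply/rowP => k; rewrite mxE.
  by apply/eqP/negPn/negP/Z.
case: (@arg_minnP _ k0 (fun k => la 0 k != 0) (@nat_of_ord _) lk0) => k lk kmin.
have [_ /(_ (- ((la 0 k)^-1 *: \sum_(j < n.+1 | j != k) la 0 j *: X j)))] := XP k.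
apply.
  apply/ordgeN/ordgeZ/ordge_sum => j jk.
  have [->|lj] := eqVneq (la 0 j) 0; first by rewrite scale0r; apply: ordge_0.
  apply: ordgeZ; apply: (@ordge_le _ _ _ k.+1 j); last by have [] := XP j.
  by rewrite ltn_neqAle kmin // andbT eq_sym.
have := ciZ (la 0 k)^-1 cI IlX; rewrite (bigD1 k) //= scalerDr scalerA mulVf //.
by rewrite scale1r opprK.
Qed.

(** A stationary descending chain of powers is contained in I + J^n for all n,
    hence in the closed ideal I. *)
Lemma radical_nilpotent : exists N, forall x, ordge N x -> I x.
Proof.
have [k kP] := radical_stable; exists k.
have step d x : ordge (d + k) x -> exists2 y, ordge (d + k).+1 y & I (x - y).
  elim: d x => [|d IHd] x xd; first exact: kP.
  have yE a : exists y, ordge (d + k).+1 y /\ I (lstrip a x - y).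
    by have [|y] := IHd (lstrip a x); [exact: ordge_lstrip|exists y].
  have [y yP] := choice yE; exists (\sum_a arrow_elt K a * y a).
    apply: ordge_sum => a _; apply: (@ordgeM _ _ _ 1 (d + k).+1).
      exact: ordge_arrow.
    by have [] := yP a.
  rewrite {1}[x]lstripE1; last exact: ordge_le xd.
  rewrite -sumrB; apply: (@ci_sum _ _ _ I _ _ _ _ cI) => a _; rewrite -mulrBr; apply: (ciMl cI).
  by have [] := yP a.
have many n x : ordge k x -> exists2 y, ordge (n + k) y & I (x - y).
  move=> xk; elim: n => [|n [y yn Ixy]].
    by exists x => //; rewrite subrr; apply: (ci0 cI).
  have [z zn Iyz] := step n y yn; exists z => //.
  by rewrite -[x](subrK y) -addrA; apply: (ciD cI).
move=> x xk; apply: (ciC cI) => n; have [y yn Ixy] := many n x xk.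
exists (x - y) => //; rewrite subKr.
by apply: ordge_le yn; apply: leq_addr.
Qed.

End Nilpotent.

Section LeftSpan.
Variables (K : fieldType) (V : finType) (R : quiver V) (S : set (cpalg K R)).

Inductive lspan (n : nat) : cpalg K R -> Prop :=
| lspan0 : lspan n 0
| lspanD f u s v : lspan n f -> S s -> ordge n u -> lspan n (f + u * s * v).

Lemma lspan_add n f g : lspan n f -> lspan n g -> lspan n (f + g).
Proof.
move=> fn; elim=> [|h u s v _ IHh Ss un]; first by rewrite addr0.
by rewrite addrA; apply: lspanD.
Qed.

Lemma lspan_arrow n a f : lspan n f -> lspan n.+1 (arrow_elt K a * f).
Proof.
elim=> [|h u s v _ IHh Ss un]; first by rewrite mulr0; apply: lspan0.
rewrite mulrDr !mulrA; apply: lspanD => //.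
by apply: (@ordgeM _ _ _ 1 n) => //; apply: ordge_arrow.
Qed.

Lemma lspan_sum n (T : finType) (F : T -> cpalg K R) :
  (forall i, lspan n (F i)) -> lspan n (\sum_i F i).
Proof.
by move=> Fn; elim/big_ind: _ => //; [exact: lspan0|exact: lspan_add].
Qed.

Lemma lspan_ideal_span f : ideal_span S f -> lspan 0 f.
Proof.
move=> [n [u [s [v [Ss ->]]]]]; elim: n u s v Ss => [|n IHn] u s v Ss.
  by rewrite big_ord0; apply: lspan0.
rewrite big_ord_recr /=; apply: lspanD => //.
by apply: IHn => i; apply: Ss.
Qed.

Variable N : nat.
Hypothesis SN : forall f, ordge N f -> closed_ideal S f.

(** An element of order N + n is a combination of paths p of length n times
    elements of order N; these lie in the closed ideal, and p joins the left
    factors u. *)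
Lemma lspan_approx n f : ordge (N + n) f ->
  exists2 g, lspan n g & ordge (N + n).+1 (f - g).
Proof.
elim: n f => [|n IHn] f fn.
  rewrite addn0 in fn *; have /adicP/(_ N.+1)[g Sg fg] := SN fn.
  by exists g => //; apply: lspan_ideal_span.
have gE a : exists g, lspan n g /\ ordge (N + n).+1 (lstrip a f - g).
  have [|g] := IHn (lstrip a f); last by exists g.
  by apply: ordge_lstrip; rewrite addnS in fn.
have [g gP] := choice gE; exists (\sum_a arrow_elt K a * g a).
  by apply: lspan_sum => a; apply: lspan_arrow; have [] := gP a.
rewrite {1}[f]lstripE1; last by apply: ordge_le fn; rewrite addnS.
rewrite -sumrB; apply: ordge_sum => a _; rewrite -mulrBr addnS.
by apply: (@ordgeM _ _ _ 1 (N + n).+1); [exact: ordge_arrow|have [] := gP a].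
Qed.

End LeftSpan.

Section Expansion.
Variables (K : fieldType) (V : finType) (Q : quiver V) (C : {set arr Q}).
Local Notation Qc := (cut_quiver C).
Variables (io : {rmorphism cpalg K Qc -> cpalg K Q}).
Hypotheses (cio : cont_hom id io)
  (ioE : forall a : arr Qc, io (arrow_elt K a) = arrow_elt K (cut_inc a)).
Variables (T : finType) (D : {set T}) (s : T -> cpalg K Qc) (N : nat).
Let S := [set f | exists2 t, t \in D & f = s t].
Hypothesis SN : forall f, ordge N f -> closed_ideal S f.

Definition clin c (f : cpalg K Q) :=
  forall x u, coef f x u != 0 -> filter (mem C) u = [:: c].

Lemma clin0 c : clin c 0.
Proof. by move=> x u; rewrite coef0 eqxx. Qed.

Lemma clinD c f g : clin c f -> clin c g -> clin c (f + g).
Proof.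
move=> fn gn x u; rewrite coefD => nz.
have [f0|] := eqVneq (coef f x u) 0; last exact: fn.
by apply: (gn x); rewrite f0 add0r in nz.
Qed.

Lemma clin_cdeg c f : clin c f -> cdeg C 1 f.
Proof. by move=> fc x u /fc E; rewrite -size_filter E. Qed.

Lemma clin_avoids c c2 f : c2 \in C -> c2 != c -> clin c f -> avoids c2 f.
Proof.
move=> cC cc fc v u t; apply/eqP/negPn/negP => /fc /(congr1 (fun r => c2 \in r)).
by rewrite mem_filter mem_cat !inE eqxx orbT (negPf cc) /= cC.
Qed.

Lemma clin_mid c f g : c \in C -> clin c (io f * arrow_elt K c * io g).
Proof.
move=> cC x u nz.
have c1 : cdeg C 1 (io f * arrow_elt K c * io g).
  rewrite -[1%N]addn0; apply: cdegM; last exact: cdeg_io.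
  rewrite -[1%N]add0n; apply: cdegM; first exact: cdeg_io.
  by have := @cdeg_arrow K _ _ C c; rewrite cC.
have sz : size (filter (mem C) u) = 1%N by rewrite size_filter (c1 x).
have cu : c \in u.
  apply: contraNT nz => cu; apply/eqP; rewrite coefM big1 // => i _.
  rewrite coefM big1 ?mul0r // => j _; rewrite coef_arrow.
  case: (eqVneq (drop j (take i u)) [:: c]) => [E|_]; last by rewrite andbF mulr0.
  by case/negP: cu; apply: (mem_take (n0 := i)); apply: (mem_drop (n0 := j)); rewrite E inE.
have : c \in filter (mem C) u by rewrite mem_filter cu andbT.
by case: (filter _ _) sz => [|d [|]] //= _; rewrite inE => /eqP ->.
Qed.

Lemma cD_mid c f g y : c \in C -> cD c (io f * arrow_elt K c * io g) y =
  idem K Q (tgt Q c) * (io g * y * io f) * idem K Q (src Q c).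
Proof.
move=> cC; have av h : avoids c (io h) by apply: cdeg_avoids cC _; apply: cdeg_io.
rewrite cDM cDM (cD_avoids _ (av f)) (cD_avoids _ (av g)) add0r addr0.
by rewrite cD_arrow eqxx scale1r.
Qed.

Variable c : arr Q.
Hypothesis cC : c \in C.

(** A sum of terms u (s t) v is encoded by the sum z t of the elements v c u:
    then cD c puts s t in the place of c, and the infinite sums needed are elements
    of the complete path algebra. *)
Definition expand (z : T -> cpalg K Q) := \sum_(t in D) cD c (z t) (io (s t)).
Local Notation trim f := (idem K Q (tgt Q c) * f * idem K Q (src Q c)).

Lemma lspan_expand n g : lspan S n g -> exists z : T -> cpalg K Q,
  [/\ forall t, clin c (z t), forall t, ordge n (z t) & expand z = trim (io g)].
Proof.
elim=> [|f u y v _ [z [zc zn zE]] [t tD ->] un].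
  exists (fun=> 0); split=> [t|t|]; [exact: clin0|exact: ordge_0|].
  by rewrite rmorph0 mulr0 mul0r /expand big1 // => t _; rewrite cD0l.
pose m := io v * arrow_elt K c * io u.
exists (fun t' => z t' + (t' == t)%:R *: m); split=> [t'|t'|].
- apply: clinD => //; case: eqP => _; rewrite ?scale1r ?scale0r.
    exact: clin_mid.
  exact: clin0.
- apply: ordgeD => //; apply/ordgeZ/ordgeMr.
  exact: (ch_ord cio).
rewrite /expand; under eq_bigr do rewrite cDDl.
rewrite big_split /= -/(expand z) zE (bigD1 t) //= eqxx scale1r big1 ?addr0.
  by rewrite cD_mid // rmorphD !rmorphM mulrDr mulrDl.
by move=> t' /andP[_ /negPf ->]; rewrite scale0r cD0l.
Qed.

Lemma expandD z z' : expand (fun t => z t + z' t) = expand z + expand z'.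
Proof. by rewrite /expand -big_split; apply: eq_bigr => t _; rewrite /= cDDl. Qed.

Lemma expandB z z' : expand (fun t => z t - z' t) = expand z - expand z'.
Proof.
by rewrite /expand -sumrB; apply: eq_bigr => t _; rewrite cDDl cDNl.
Qed.

Lemma ordge_expand n z : (forall t, ordge n.+1 (z t)) -> ordge n (expand z).
Proof.
move=> zn; apply: ordge_sum => t _; rewrite -[n]addn0; exact: ordge_cD.
Qed.

(** The solution z is a convergent series: f is approximated by lspan_approx,
    with left factors of order n at stage n, and the error goes to zero. *)
Lemma expand_solve_rad f : ordge N f -> exists z : T -> cpalg K Q,
  (forall t, clin c (z t)) /\ expand z = trim (io f).
Proof.
move=> fN.
have stepE (p : nat * cpalg K Qc) : exists r : cpalg K Qc * (T -> cpalg K Q),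
    ordge (N + p.1) p.2 ->
    [/\ ordge (N + p.1).+1 (p.2 - r.1), forall t, clin c (r.2 t),
        forall t, ordge p.1 (r.2 t) & expand r.2 = trim (io r.1)].
  have [H|H] := pselect (ordge (N + p.1) p.2); last by exists (0, fun=> 0).
  have [g /lspan_expand[z [zc zn zE]] gN] := lspan_approx SN H.
  by exists (g, z).
have [step stepP] := choice stepE.
(* F n is the error after n steps, and Z n the sum of the corrections. *)
pose F := fix F n := if n is m.+1 then F m - (step (m, F m)).1 else f.
have FN n : ordge (N + n) (F n).
  elim: n => [|n IHn]; first by rewrite addn0.
  by have [] := stepP (n, F n) IHn; rewrite addnS.
pose Z := fix Z n t := if n is m.+1 then Z m t + (step (m, F m)).2 t else 0.
have Zc n t : clin c (Z n t).
  elim: n => [|n IHn]; first exact: clin0.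
  by apply: clinD => //; have [] := stepP (n, F n) (FN n).
have ZE n : expand (Z n) = trim (io (f - F n)).
  elim: n => [|n IHn].
    by rewrite subrr rmorph0 mulr0 mul0r /expand big1 // => t _; rewrite cD0l.
  rewrite expandD IHn; have [_ _ _ ->] := stepP (n, F n) (FN n).
  by rewrite /= opprB addrA -mulrDl -mulrDr -rmorphD addrAC.
have Zcauchy t n : ordge n (Z n.+1 t - Z n t).
  by rewrite /= addrAC subrr add0r; have [] := stepP (n, F n) (FN n).
exists (fun t => lim (fun n => Z n t)); split=> [t x u|].
  by rewrite coef_of; case: ifP => _ //; [apply: Zc|rewrite eqxx].
apply: ordge_eq => n; apply: (@ordge_trans _ _ _ n _ (expand (Z n.+1))).
  by rewrite -expandB; apply: ordge_expand => t; apply: limP (Zcauchy t) _.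
rewrite ZE -mulrBl -mulrBr -rmorphB; apply: ordgeMl; apply: ordgeMr.
apply: (ch_ord cio); rewrite addrAC subrr sub0r; apply: ordgeN.
by apply: ordge_le (FN n.+1); rewrite addnS leqW // leq_addl.
Qed.

Lemma expand_solve f : closed_ideal S f -> exists z : T -> cpalg K Q,
  (forall t, clin c (z t)) /\ expand z = trim (io f).
Proof.
move=> /adicP/(_ N)[g /lspan_ideal_span/lspan_expand[z [zc _ zE]]].
move=> /expand_solve_rad[z' [z'c z'E]].
exists (fun t => z t + z' t); split=> [t|]; first exact: clinD.
by rewrite expandD zE z'E -mulrDl -mulrDr -rmorphD addrC subrK.
Qed.

End Expansion.

(** * From truncated algebras to right-equivalences *)

Section CutDerivatives.
Variables (K : fieldType) (V : finType) (Q : quiver V) (C : {set arr Q}) (W : cpalg K Q).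
Hypotheses (cW : cyclic_elt W) (cutW : is_cut W C).
Local Notation Qc := (cut_quiver C).

Lemma cut_deriv_sandwich c : c \in C ->
  idem K Qc (tgt Q c) * @cut_deriv K V Q W C c * idem K Qc (src Q c) =
  @cut_deriv K V Q W C c.
Proof.
move=> cC; have [io cio ioE] := embed_exists K (cut_embedding C).
have [r cr [rio _]] := retract_exists K (cut_embedding C).
apply: (can_inj (retract_embed cio cr ioE rio)).
by rewrite !rmorphM /= !(chI cio) (io_cut_deriv cio ioE cW cutW cC) cD_sandwich.
Qed.

End CutDerivatives.

Section DegreeMap.
Variables (K : fieldType) (V V' : finType) (Q : quiver V) (Q' : quiver V').
Variables (C : {set arr Q}) (C' : {set arr Q'}) (sigma : V -> V').
Variable h : {rmorphism cpalg K Q -> cpalg K Q'}.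
Hypotheses (ch : cont_hom sigma h).
Hypothesis hC : forall a, cdeg C' (a \in C) (h (arrow_elt K a)).

Lemma cdeg_map n f : cdeg C n f -> cdeg C' n (h f).
Proof.
move=> fn x s; move: (leqnn (size s)); move: {2}(size s) => m.
elim: m n f fn x s => [|m IHm] n f fn x s sm nz.
  case: s sm nz => // _; rewrite (chE _ ch) coefD => nz.
  have : coef (\sum_v coef f v [::] *: idem K Q' (sigma v)) x [::] != 0.
    move: nz; rewrite [X in _ + X]coef_sum [X in _ + X]big1 ?addr0 // => a _.
    by have /ordge1P ha := chJ ch a; rewrite coefM_nil ha mul0r.
  rewrite coef_sum => nz'.
  have [v] : exists v, coef f v [::] != 0.
    apply: contrapT => /forallNP N; case/eqP: nz'; apply: big1 => v _.
    by rewrite coefZ (_ : coef f v [::] = 0) ?mul0r //; apply/eqP/negPn/negP/N.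
  by move=> /fn <-.
have [s0|s0] := eqVneq s [::]; first by apply: (IHm n f fn x) => //; rewrite s0.
move: nz; rewrite (chE _ ch) coefD coef_sum big1 ?add0r => [|v _]; last first.
  by rewrite coefZ coef_idem (negPf s0) andbF mulr0.
rewrite coef_sum => nz.
have [a nza] : exists a, coef (h (arrow_elt K a) * h (lstrip a f)) x s != 0.
  apply: contrapT => /forallNP N; case/eqP: nz; apply: big1 => a _.
  by apply/eqP/negPn/negP/N.
rewrite coefM in nza.
have [i nzi] : exists i : 'I_(size s).+1, coef (h (arrow_elt K a)) x (take i s) *
    coef (h (lstrip a f)) (wend x (take i s)) (drop i s) != 0.
  apply: contrapT => /forallNP N; case/eqP: nza; apply: big1 => i _.
  by apply/eqP/negPn/negP/N.
have a0 : coef (h (arrow_elt K a)) x (take i s) != 0.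
  by apply: contra_neq nzi => ->; rewrite mul0r.
have f0 : coef (h (lstrip a f)) (wend x (take i s)) (drop i s) != 0.
  by apply: contra_neq nzi => ->; rewrite mulr0.
have i0 : (0 < i)%N.
  rewrite lt0n; apply: contra_neq a0 => ->; rewrite take0.
  by have /ordge1P -> := chJ ch a.
have dm : (size (drop i s) <= m)%N.
  rewrite size_drop leq_subLR (leq_trans sm) // -add1n leq_add2r.
  exact: i0.
have [l0|l0] := eqVneq (lstrip a f) 0; first by move: f0; rewrite l0 rmorph0 coef0 eqxx.
have nC : ((a \in C) <= n)%N.
  have [y [t nzt]] : exists y t, coef (lstrip a f) y t != 0.
    apply: contrapT => /forallNP N; case/eqP: l0; apply: coefP => y t.
    rewrite coef0; apply/eqP/negPn/negP => H; apply: (N y).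
    by exists t.
  move: nzt; rewrite coef_lstrip; case: ifP => _; last by rewrite eqxx.
  by move=> /fn <-; rewrite /= leq_addr.
rewrite -(cat_take_drop i s) count_cat (hC a0).
by rewrite (IHm _ _ (@cdeg_lstrip _ _ _ _ n a _ fn) _ _ dm f0) subnKC.
Qed.

End DegreeMap.

Section Half.
Variables (K : fieldType) (V V' : finType) (Q : quiver V) (Q' : quiver V').
Variables (W : cpalg K Q) (W' : cpalg K Q') (C : {set arr Q}) (C' : {set arr Q'}).
Local Notation Qc := (cut_quiver C).
Local Notation Qc' := (cut_quiver C').
Hypotheses (cW : cyclic_elt W) (cW' : cyclic_elt W').
Hypotheses (cutW : is_cut W C) (cutW' : is_cut W' C').
Variables (io : {rmorphism cpalg K Qc -> cpalg K Q}).
Hypotheses (cio : cont_hom id io)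
  (ioE : forall a : arr Qc, io (arrow_elt K a) = arrow_elt K (cut_inc a)).
Variables (io' : {rmorphism cpalg K Qc' -> cpalg K Q'}).
Hypotheses (cio' : cont_hom id io')
  (ioE' : forall a : arr Qc', io' (arrow_elt K a) = arrow_elt K (cut_inc a)).
Variables (sigma : V -> V') (tau : V' -> V).
Hypotheses (sK : cancel sigma tau) (tK : cancel tau sigma).
Variables (F : {rmorphism cpalg K Qc -> cpalg K Qc'})
  (G : {rmorphism cpalg K Qc' -> cpalg K Qc}).
Hypotheses (cG : cont_hom tau G) (FK : cancel F G).
Hypothesis FI : forall x, cut_ideal W C x -> cut_ideal W' C' (F x).
Variable N : nat.
Hypothesis IN : forall f, ordge N f -> cut_ideal W C f.

Let s (c : arr Q') : cpalg K Qc := G (@cut_deriv K V' Q' W' C' c).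
Let S := [set f | exists2 c, c \in C' & f = s c].

Let IS f : cut_ideal W C f -> closed_ideal S f.
Proof.
move=> /FI H; rewrite -(FK f); move: H.
apply: (closed_ideal_min (I := fun x => closed_ideal S (G x))).
  exact: (ch_closed cG (closed_ideal_closed _)).
by move=> _ [c cC ->]; apply: closed_ideal_gen; exists c.
Qed.

(** The arrow c' of the cut is sent to the sum over c of the z c c' that encode
    the expansion of dd c W in the transported relations. Then P W' is the sum of the
    P c' (G r'), and cut_euler rotates it into the sum of the c (dd c W). *)
Lemma relation_lift : exists P : {rmorphism cpalg K Q' -> cpalg K Q},
  [/\ cont_hom tau P, forall f, P (io' f) = io (G f),
      forall a, cdeg C (a \in C') (P (arrow_elt K a)) & dd_equiv (P W') W].
Proof.
have SN f : ordge N f -> closed_ideal S f by move=> /IN/IS.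
have zE c : exists z : arr Q' -> cpalg K Q, c \in C ->
    (forall t, clin C c (z t)) /\ expand io C' s c z = dd c W.
  have [cC|cC] := boolP (c \in C); last by exists (fun=> 0).
  have Sc : closed_ideal S (@cut_deriv K V Q W C c).
    by apply: IS; apply: closed_ideal_gen; exists c.
  have [z [zc zE]] := expand_solve cio ioE SN cC Sc.
  exists z => _; split=> //.
  by rewrite zE (io_cut_deriv cio ioE cW cutW cC) cD_sandwich.
have [z zP] := choice zE.
pose zeta0 t := \sum_(c in C) z c t.
pose zeta t := idem K Q (tau (src Q' t)) * zeta0 t * idem K Q (tau (tgt Q' t)).
have zeta0_1 t : cdeg C 1 (zeta0 t).
  by apply: cdeg_sum => c cC; apply: (@clin_cdeg _ _ _ _ c); have [] := zP c cC.
have zeta1 t : cdeg C 1 (zeta t).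
  rewrite -[1%N]addn0; apply: cdegM; last exact: cdeg_idem.
  by rewrite -[1%N]add0n; apply: cdegM => //; apply: cdeg_idem.
have zetaD c y : c \in C -> forall t, cD c (zeta0 t) y = cD c (z c t) y.
  move=> cC t; rewrite /zeta0 cD_suml (bigD1 c) //= big1 ?addr0 // => c2 /andP[c2C c2c].
  apply: cD_avoids; have [c2l _] := zP c2 c2C.
  by apply: (clin_avoids cC _ (c2l t)); rewrite eq_sym.
have zetaW c : c \in C -> \sum_(t in C') cD c (zeta t) (io (s t)) = dd c W.
  move=> cC; have [_ <-] := zP c cC; apply: eq_bigr => t tC.
  rewrite cD_idemMr cD_idemMl zetaD //; congr (cD _ _ _).
  rewrite -!(chI cio) -!rmorphM /= -!(chI cG) -!rmorphM; congr (io (G _)).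
  exact: cut_deriv_sandwich.
pose y b := if insub b is Some a then io (G (arrow_elt K (a : arr Qc'))) else zeta b.
have yP b : (exists2 a : arr Qc', b = cut_inc a & y b = io (G (arrow_elt K a))) \/
    (b \in C' /\ y b = zeta b).
  rewrite /y; case: insubP => [a _ <-|]; first by left; exists a.
  by rewrite negbK; right.
have [||b|b|P cP PE] := @hom_exists _ _ _ Q' Q tau y.
- by exists sigma.
- move=> b; have [[a _ ->]|[_ ->]] := yP b; last exact: cdeg_ordge1 (zeta1 b).
  by apply/(ch_ord cio)/(chJ cG).
- have [[a -> ->]|[_ ->]] := yP b; last by rewrite /zeta !mulrA idem_mul.
  rewrite -(chI cio) -(chI cG) -!rmorphM; congr (io (G _)).
  exact: (@idem_arrow K _ Qc' a).
- have [[a -> ->]|[_ ->]] := yP b; last by rewrite /zeta -!mulrA idem_mul.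
  rewrite -(chI cio) -(chI cG) -!rmorphM; congr (io (G _)).
  exact: (@arrow_idem K _ Qc' a).
have Pio f : P (io' f) = io (G f).
  have c1 : cont_hom tau (P \o io' : {rmorphism cpalg K Qc' -> cpalg K Q}).
    exact: cont_hom_comp cio' cP (fun=> erefl).
  have c2 : cont_hom tau (io \o G : {rmorphism cpalg K Qc' -> cpalg K Q}).
    exact: cont_hom_comp cG cio (fun=> erefl).
  apply: (ch_ext c1 c2) => a /=; rewrite ioE' PE.
  have [[a' /val_inj <- ->]//|[aC _]] := yP (cut_inc a).
  by have := valP a; rewrite -/(cut_inc a) aC.
exists P; split=> // [a|b].
  rewrite PE; have [[a' -> ->]|[aC ->]] := yP a; last by rewrite aC; apply: zeta1.
  by rewrite (negPf (valP a')); apply: cdeg_io cio ioE _.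
have Pc c : c \in C' -> P (arrow_elt K c) = zeta c.
  move=> cC; rewrite PE; have [[a ca _]|[]//] := yP c.
  by have := valP a; rewrite -/(cut_inc a) -ca cC.
rewrite -(ch_dd_equiv cP (cut_potential cutW')) rmorph_sum dd_sum.
transitivity (\sum_(c' in C') dd b (\sum_(c in C) arrow_elt K c * cD c (zeta c') (io (s c')))).
  apply: eq_bigr => c cC; rewrite (cut_euler b _ (zeta1 c)) rmorphM /= Pc //.
  by rewrite -(io_cut_deriv cio' ioE' cW' cutW' cC) Pio.
rewrite -dd_sum exchange_big /= -(cut_potential cutW b); congr (dd b _).
by apply: eq_bigr => c cC; rewrite -mulr_sumr zetaW.
Qed.

End Half.

Section RightEquivalence.
Variables (K : fieldType) (V V' : finType) (Q : quiver V) (Q' : quiver V').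
Variables (W : cpalg K Q) (W' : cpalg K Q') (C : {set arr Q}) (C' : {set arr Q'}).

(** The composite H of P' and P fixes the arrows outside of the cut. As it
    preserves the derivatives of W, its values on C solve the system of
    cut_unipotent. *)
Lemma lifts_unipotent (P : {rmorphism cpalg K Q' -> cpalg K Q})
    (P' : {rmorphism cpalg K Q -> cpalg K Q'}) (sigma : V -> V') (tau : V' -> V)
    (io : {rmorphism cpalg K (cut_quiver C) -> cpalg K Q})
    (io' : {rmorphism cpalg K (cut_quiver C') -> cpalg K Q'})
    (F : {rmorphism cpalg K (cut_quiver C) -> cpalg K (cut_quiver C')})
    (G : {rmorphism cpalg K (cut_quiver C') -> cpalg K (cut_quiver C)}) :
  cyclic_elt W -> is_cut W C ->
  (forall c, c \in C ->
    ~ closed_ideal [set f | exists2 c', (c' \in C) && (c' != c)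
                          & f = @cut_deriv K V Q W C c'] (@cut_deriv K V Q W C c)) ->
  cancel sigma tau -> cont_hom id io ->
  (forall a, io (arrow_elt K a) = arrow_elt K (cut_inc a)) -> cancel F G ->
  cont_hom tau P -> cont_hom sigma P' ->
  (forall f, P (io' f) = io (G f)) -> (forall f, P' (io f) = io' (F f)) ->
  (forall a, cdeg C (a \in C') (P (arrow_elt K a))) ->
  (forall a, cdeg C' (a \in C) (P' (arrow_elt K a))) ->
  dd_equiv (P W') W -> dd_equiv (P' W) W' ->
  injective P' /\ forall y, exists x, P x = y.
Proof.
move=> cW cutW minW sK cio ioE FK cP cP' Pio Pio' PC PC' PW PW'.
have cc : cont_hom id (P \o P' : {rmorphism cpalg K Q -> cpalg K Q}).
  exact: cont_hom_comp cP' cP sK.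
have Hio f : P (P' (io f)) = io f by rewrite Pio' Pio FK.
have HW : dd_equiv (P (P' W)) W.
  by move=> b; rewrite (ch_dd_equiv cP PW').
pose eta c := P (P' (arrow_elt K c)).
have eta1 c : c \in C -> cdeg C 1 (eta c).
  move=> cC; apply: (cdeg_map cP PC); have := PC' c; rewrite cC.
  by [].
have etae c : c \in C -> idem K Q (src Q c) * eta c * idem K Q (tgt Q c) = eta c.
  have e v : P (P' (idem K Q v)) = idem K Q v by rewrite (chI cP') (chI cP) sK.
  by move=> _; rewrite -(e (src Q c)) -(e (tgt Q c)) -!rmorphM idem_arrow arrow_idem.
have etaW c2 : c2 \in C -> \sum_(c in C) cD c2 (eta c) (dd c W) = dd c2 W.
  (* Differentiate the image under H of the sum of the c (dd c W). *)
  move=> c2C; rewrite -[RHS]HW.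
  have -> : dd c2 (P (P' W)) = dd c2 (P (P' (\sum_(c in C) arrow_elt K c * dd c W))).
    by apply/(ch_dd_equiv cP)/(ch_dd_equiv cP') => b; rewrite (cut_potential cutW).
  rewrite !rmorph_sum dd_sum; apply: eq_bigr => c cC /=.
  rewrite !rmorphM -(io_cut_deriv cio ioE cW cutW cC) Hio /dd cDM mulr1 mul1r.
  have av : avoids c2 (io (@cut_deriv K V Q W C c)).
    by apply: (cdeg_avoids c2C); apply: cdeg_io.
  by rewrite (cD_avoids _ av) addr0.
have uni := cut_unipotent cio ioE cW cutW minW eta1 etae etaW.
have c2 a : ordge 2 ((P \o P' : {rmorphism cpalg K Q -> cpalg K Q}) (arrow_elt K a)
    - arrow_elt K a).
  have [aC|aC] := boolP (a \in C); first exact: uni.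
  have [a' <-] : exists a' : arr (cut_quiver C), cut_inc a' = a.
    by exists (exist _ a aC).
  by rewrite /= -ioE Hio subrr; apply: ordge_0.
split=> [x y xy|y].
  by apply: (unipotent_inj cc c2); rewrite /= xy.
by have [x xy] := unipotent_surj cc c2 y; exists (P' x).
Qed.

End RightEquivalence.

Section RightEquivalence.
Variables (K : fieldType) (V V' : finType) (Q : quiver V) (Q' : quiver V').
Variables (W : cpalg K Q) (W' : cpalg K Q') (C : {set arr Q}) (C' : {set arr Q'}).

Lemma QP_right_equiv (sigma : V -> V') (tau : V' -> V)
    (F : {rmorphism cpalg K (cut_quiver C) -> cpalg K (cut_quiver C')})
    (G : {rmorphism cpalg K (cut_quiver C') -> cpalg K (cut_quiver C)}) :
  cyclic_elt W -> cyclic_elt W' -> algebraic_cut W C -> algebraic_cut W' C' ->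
  cancel sigma tau -> cancel tau sigma -> cont_hom sigma F -> cont_hom tau G ->
  cancel F G -> cancel G F -> (forall x, cut_ideal W C x <-> cut_ideal W' C' (F x)) ->
  exists (h : {rmorphism cpalg K Q -> cpalg K Q'}) (g : {rmorphism cpalg K Q' -> cpalg K Q}),
    [/\ cont_hom sigma h, cont_hom tau g, cancel h g, cancel g h & dd_equiv (h W) W'].
Proof.
move=> cW cW' [cutW fW _ minW] [cutW' fW' _ minW'] sK tK cF cG FK GK FI.
have [io cio ioE] := embed_exists K (cut_embedding C).
have [io' cio' ioE'] := embed_exists K (cut_embedding C').
have [N IN] := radical_nilpotent (closed_ideal_closed _) fW.
have [N' IN'] := radical_nilpotent (closed_ideal_closed _) fW'.
have FI1 x : cut_ideal W C x -> cut_ideal W' C' (F x) by move/FI.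
have GI y : cut_ideal W' C' y -> cut_ideal W C (G y) by rewrite -{1}(GK y) => /FI.
have [P [cP Pio PC PW]] := relation_lift cW cW' cutW cutW' cio ioE cio' ioE' sK tK cG FK FI1 IN.
have [P' [cP' Pio' PC' PW']] := relation_lift cW' cW cutW' cutW cio' ioE' cio ioE tK sK cF GK GI IN'.
have [Pi' Ps] := lifts_unipotent cW cutW minW sK cio ioE FK cP cP' Pio Pio' PC PC' PW PW'.
have [Pi Ps'] := lifts_unipotent cW' cutW' minW' tK cio' ioE' GK cP' cP Pio' Pio PC' PC PW' PW.
have Pa : @alg_iso K (cp_kalg K Q) (cp_kalg K Q') P'.
  split; last exact: inj_surj_bij.
  by move=> c; rewrite /= /cp_str (chZ cP') rmorph1.
have [g [cg gK1 gK2]] := alg_iso_cont_inv Pa (chI cP') tK.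
by exists P', g.
Qed.

End RightEquivalence.

(** * Vertices, loops and mutations *)

Section SimpleModules.
Variables (K : fieldType) (V : finType) (R : quiver V) (I : ideal (cp_kalg K R)).
Implicit Types (z : cpalg K R).

Lemma qpiD z z' : quot_pi I (z + z' : cpalg K R) = quot_pi I z + quot_pi I z'.
Proof. exact: (rmorphD (quot_pi I)). Qed.

(** Let P be the ideal of the z without constant term at k, and m0 nonzero and
    fixed by the idempotent of k. If P m0 were the whole module, m0 would be j m0 for
    some j in the radical, although 1 - j is a unit. So P kills m0, and then all of
    M, as the elements killed by P form a submodule. *)
Lemma simple_vertex (M : lmodType (quotalg I)) k : simple_module M ->
  (exists x : M, quot_pi I (idem K R k) *: x != 0) ->
  forall z, coef z k [::] = 0 -> forall m : M, quot_pi I z *: m = 0.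
Proof.
move=> [_ Msimple] [x ex0].
pose S1 : {pred M} := fun m => `[< forall z, coef z k [::] = 0 -> quot_pi I z *: m = 0 >].
have S1c : submod_closed S1.
  split=> [|a u v /asboolP Su /asboolP Sv]; apply/asboolP => z z0.
    by rewrite scaler0.
  rewrite -[a]quot_reprK scalerDr scalerA -qpiM Su ?Sv ?addr0 //.
  by rewrite coefM_nil z0 mul0r.
have [S10|S1T] := Msimple S1 S1c; last first.
  by move=> z z0 m; have := S1T m; rewrite inE => /asboolP; apply.
set m0 := _ *: x in ex0.
pose S2 : {pred M} := fun m => `[< exists z, coef z k [::] = 0 /\ m = quot_pi I z *: m0 >].
have S2c : submod_closed S2.
  split=> [|a u v /asboolP[z [z0 ->]] /asboolP[z' [z'0 ->]]]; apply/asboolP.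
    by exists 0; rewrite coef0 (rmorph0 (quot_pi I)) scale0r.
  exists (quot_repr a * z + z'); rewrite coefD coefM_nil z0 z'0 mulr0 addr0.
  by rewrite qpiD qpiM quot_reprK scalerDl scalerA.
have [S20|S2T] := Msimple S2 S2c.
  have : m0 \in S1.
    apply/asboolP => z z0; apply/eqP; have := S20 (quot_pi I z *: m0).
    by rewrite inE => <-; apply/asboolP; exists z.
  by rewrite S10 inE (negPf ex0).
have : m0 \in S2 by rewrite S2T.
move=> /asboolP[z [z0 m0z]].
have em0 : quot_pi I (idem K R k) *: m0 = m0 by rewrite /m0 scalerA -qpiM idem_mul.
pose j := idem K R k * z.
have j1 : ordge 1 j.
  apply/ordge1P => v; rewrite coefM_nil coef_idem andbT.
  by case: eqP => [->|_]; rewrite ?z0 ?mulr0 ?mul0r.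
have jm : quot_pi I j *: m0 = m0 by rewrite /j qpiM -scalerA -m0z em0.
have [w [w1 _]] := geometric j1.
have m0E : m0 = quot_pi I w *: (quot_pi I (1 - j) *: m0).
  by rewrite scalerA -qpiM w1 (rmorph1 (quot_pi I)) scale1r.
case/eqP: ex0; rewrite m0E.
have -> : quot_pi I (1 - j) *: m0 = 0; last by rewrite scaler0.
rewrite (rmorphB (quot_pi I)) scalerBl jm (rmorph1 (quot_pi I)) scale1r.
exact: subrr.
Qed.

End SimpleModules.

Section Data.
Variables (K : fieldType) (V : finType) (Q : quiver V) (C : {set arr Q}) (W : cpalg K Q).

Lemma potential_ord n : potential_ge n W -> ordge n W.
Proof.
move=> Wn x s sn; apply/eqP/negPn/negP => nz.
have w : walk x s by apply: contraNT nz => /coef_notwalk ->.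
have [|_] := Wn (exist _ (x, s) w); first by rewrite coefE.
by rewrite /plen /parrs leqNgt sn.
Qed.

Lemma cut_deriv_ord c : reduced_QP W -> ordge 2 (@cut_deriv K V Q W C c).
Proof.
move=> Wr x s s2; rewrite -[LHS]/(coef (cut_restrict (cderiv W c)) x s) coef_restrict.
rewrite (dd_cderiv _ (cyclic_potential Wr)).
by apply: (ordge_dd _ (potential_ord Wr)); rewrite size_map.
Qed.

Lemma cut_ideal_ord : reduced_QP W -> forall x, cut_ideal W C x -> ordge 2 x.
Proof.
move=> Wr; apply: (closed_ideal_min (I := ordge 2)); first exact: ordge_closed.
by move=> _ [c _ ->]; apply: cut_deriv_ord.
Qed.

(** In the quiver of the cut no arrow ends at a strict source, and none starts
    at a strict sink. *)
Lemma strict_no_cycle k (f : cpalg K (cut_quiver C)) :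
  strict_source C k \/ strict_sink C k -> ordge 1 f ->
  idem K (cut_quiver C) k * f * idem K (cut_quiver C) k = f -> f = 0.
Proof.
move=> hk f1 fk; apply: coefP => x s; rewrite coef0.
case: s => [|a s]; first exact: f1.
apply/eqP/negPn/negP; rewrite -fk coefM_idem coef_idemM => nz.
have w : walk x (a :: s).
  by apply: contraNT nz => /coef_notwalk ->; rewrite !mulr0.
have xk : x = k.
  by apply/eqP; apply: contraNT nz => /negPf ->; rewrite mul0r mulr0.
have ek : wend x (a :: s) = k.
  by apply/eqP; apply: contraNT nz => /negPf ->; rewrite mul0r.
case: hk => hk.
  move: ek; rewrite lastI /wend map_rcons last_rcons => ek.
  have [bC _] := hk (val (last a s)).
  by have := valP (last a s); rewrite bC.
have [aC _] := hk (val a).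
by have := valP a; rewrite aC // -xk (walk_start w).
Qed.

End Data.

Lemma cyclic_map (K : fieldType) (V V' : finType) (Q : quiver V) (Q' : quiver V')
    (sigma : V -> V') (h : {rmorphism cpalg K Q -> cpalg K Q'}) f :
  cont_hom sigma h -> cyclic_elt f -> cyclic_elt (h f).
Proof.
move=> ch /cyclicE ->; rewrite rmorph_sum; apply: cyclic_elt_sum => v _ /=.
apply: (@cyclic_sandwich _ _ _ (sigma v)); rewrite !rmorphM /= !(chI ch).
by rewrite !mulrA idem_mul -mulrA idem_mul.
Qed.

Lemma psum_cyclic (K : fieldType) (V : finType) (R T : quiver V) (U : cpalg K R)
    (S : cpalg K T) : cyclic_elt U -> cyclic_elt S -> cyclic_elt (psum U S).
Proof.
move=> cU cS.
have eR : embedding (Q' := qsum R T) (fun a => inl a)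
   (fun a => match a with inl b => Some [:: b] | inr _ => None end).
  by split=> // -[a|//] /(_ a).
have eT : embedding (Q' := qsum R T) (fun a => inr a)
   (fun a => match a with inl _ => None | inr b => Some [:: b] end).
  by split=> // -[//|a] /(_ a).
have [h ch ha] := embed_exists K eR; have [t ct ta] := embed_exists K eT.
rewrite /psum (pull_embed eR _ ch ha) (pull_embed eT _ ct ta).
by apply: cyclic_eltD; [apply: cyclic_map ch cU|apply: cyclic_map ct cS].
Qed.

Lemma mutation_premut (K : fieldType) (V : finType) (Q R : quiver V) (k : V)
    (W : cpalg K Q) (U : cpalg K R) : is_mutation k W U ->
  exists W1 : cpalg K Q, [/\ loop_free_at Q k, dd_equiv W W1, cyclic_elt W1,
    starts_off k W1 /\ ends_off k W1
    & isomorphic (jacobian (@premut K V Q k W1)) (jacobian U)].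
Proof.
move=> [lf Ur [W1 [QP1 WW1 W1k [T [S [tS re]]]]]]; exists W1.
have c1 := cyclic_potential QP1.
have off := mut_potential_off QP1 W1k.
have cU := cyclic_potential Ur.
have cS : cyclic_elt S by apply: (@cyclic_potential _ _ 2) => p /tS.1[cp ->].
split=> //; first exact: cyc_equiv_dd.
have cP := psum_cyclic cU cS.
apply: (isomorphic_trans (right_equiv_jac _ cP re)).
  by apply: premut_cyclic => //; case: off.
exact: isomorphic_sym (psum_jac cU cP tS).
Qed.

Theorem theorem5p2 (K : closedFieldType) (V V' : finType)
    (Q : quiver V) (Q' : quiver V') (W : cpalg K Q) (W' : cpalg K Q')
    (C : {set arr Q}) (C' : {set arr Q'})
    (hW : in_W1 W C) (hW' : in_W1 W' C')
    (k : V) (hk : strict_source C k \/ strict_sink C k)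
    (phi : {rmorphism truncated W C -> truncated W' C'}) (hphi : alg_iso phi)
    (k' : V') (hkk' : vertex_corr phi k k') :
  isomorphic (jacobian W) (jacobian W') /\
  loop_free_at Q' k' /\
  (forall (R : quiver V) (U : cpalg K R) (R' : quiver V') (U' : cpalg K R'),
     is_mutation k W U -> is_mutation k' W' U' ->
     isomorphic (jacobian U) (jacobian U')).
Proof.
have [_ Wr aC] := hW; have [_ Wr' aC'] := hW'.
have cW := cyclic_potential Wr; have cW' := cyclic_potential Wr'.
have [sigma [tau [F [G [[sK tK] [cF cG] [FK GK] FI tauE]]]]] :=
  lift_iso (closed_ideal_closed _) (closed_ideal_closed _)
    (cut_ideal_ord Wr) (cut_ideal_ord Wr') hphi.
have [h [g [ch cg hK gK hWW]]] := QP_right_equiv cW cW' aC aC' sK tK cF cG FK GK FI.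
(* Otherwise a lift of the image of idem k has no constant term at k', so it
   acts as zero on the simple module M'. *)
have tk : tau k' = k.
  have [M [M' [f [[_ [x ex0]] [M's M'k] [f1 fK _]]]]] := hkk'.
  have [E EE] := quot_piP (phi (quot_pi _ (idem K (cut_quiver C) k))).
  apply/eqP/negPn/negP => tkk.
  have E0 : coef E k' [::] = 0 by rewrite (tauE _ _ EE) coef_idem (negPf tkk).
  have := simple_vertex M's M'k E0 (f x); rewrite -EE.
  rewrite -[_ *: f x]/((phi \; *:%R) (quot_pi _ (idem K (cut_quiver C) k)) (f x)).
  rewrite -linearZ -(linear0 f) => /(can_inj fK) ex.
  by rewrite ex eqxx in ex0.
have sk : sigma k = k' by rewrite -tk tK.
split; first exact: jac_iso ch cg hK gK hWW cW cW'.
split=> [a [sa ta]|R U R' U' /mutation_premut[W1 [lf WW1 c1 [s1 e1] i1]]].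
  (* A loop would give a nonzero element of the radical between k' and k', either
     itself or, if it lies in C', its derivative; G would map it to one at k. *)
  have nocycle f : ordge 1 f -> idem K (cut_quiver C') k' * f * idem K (cut_quiver C') k' = f ->
      f = 0.
    move=> f1 fk; apply: (can_inj GK); rewrite rmorph0.
    apply: (strict_no_cycle hk); first exact: (ch_ord cG).
    by rewrite -tk -!(chI cG) -!rmorphM fk.
  have [aC1|aC1] := boolP (a \in C').
    have [cutW' _ _ minW'] := aC'; apply: (minW' a aC1).
    rewrite (nocycle (@cut_deriv K V' Q' W' C' a)); first exact: ideal0.
      by apply: (@ordge_le _ _ _ 1 2) => //; apply: cut_deriv_ord.
    by rewrite -{1}ta -{1}sa; apply: cut_deriv_sandwich.
  pose b : arr (cut_quiver C') := exist _ a aC1.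
  have := nocycle _ (ordge_arrow K b).
  have -> : idem K (cut_quiver C') k' * arrow_elt K b * idem K (cut_quiver C') k' = arrow_elt K b.
    have := @idem_arrow K _ _ b; have := @arrow_idem K _ _ b.
    by rewrite /= sa ta => e1 e2; rewrite e2.
  move=> /(_ erefl) /(congr1 (fun x => coef x (src Q' a) [:: b])).
  by rewrite coef_arrow coef0 !eqxx => /eqP; rewrite oner_eq0.
move=> /mutation_premut[W1' [lf' WW1' c1' [s1' e1'] i1']].
apply: (isomorphic_trans (isomorphic_sym i1)); apply: isomorphic_trans i1'.
apply: (premut_jac ch cg hK gK sK tK sk) => //.
move=> b; rewrite -WW1' -hWW; apply: (ch_dd_equiv ch) => c.
by rewrite WW1.
Qed.
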